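(* Let $Q$ be a finite connected acyclic quiver and let $C_1,C_2$ be component clusters connected by a mutation. Then for every pair $(\alpha,\alpha')$ with $\alpha\in C_1\setminus C_2$ and $\alpha'\in C_2\setminus C_1$ there is a component cluster $C_3$ with $C_1\cap C_2\subseteq C_3$ such that all generalized Schur roots occurring in the generic decomposition of $\alpha+\alpha'$ belong to $C_3$.
   Context: $k$ is an algebraically closed field of characteristic $0$, $Q$ has vertex set $Q_0=\{1,\dots,n\}$, $e_i$ the standard basis of $\mathbb{Z}^n$. For $a,b\in\mathbb{N}^n$, $\operatorname{ext}(a,b)$ is the generic (minimal) value of $\dim\operatorname{Ext}^1_{kQ}(M,N)$ over representations of dimension vectors $a,b$. A (positive) Schur root is a nonzero $d$ for which some representation of dimension vector $d$ has endomorphism ring $k$. Generalized Schur roots: positive Schur roots together with $-e_i$, $i\in Q_0$. Ext-orthogonality: positive Schur roots $a,b$ are ext-orthogonal if $\operatorname{ext}(a,b)=\operatorname{ext}(b,a)=0$; $-e_i$ and positive $d$ are ext-orthogonal iff $d_i=0$; negative Schur roots are pairwise ext-orthogonal. A component cluster is a maximal set of pairwise distinct, pairwise ext-orthogonal generalized Schur roots. Two component clusters $C_1,C_2$ are connected by a mutation if $|C_1\cap C_2|=\min(|C_1|,|C_2|)-1$. Generic decomposition: every $d\in\mathbb{Z}^n$ has a unique decomposition $d=d_1\oplus\cdots\oplus d_s$ (sum with multiplicities) into generalized Schur roots that are pairwise ext-orthogonal (for distinct positive summands, $\operatorname{ext}(d_i,d_j)=0$ for $i\neq j$); for $d\in\mathbb{N}^n$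 it is Kac's generic decomposition. *)

(* Defs.v *)
From HB Require Import structures.
From mathcomp Require Import all_boot all_order all_algebra.
Set Implicit Arguments. Unset Strict Implicit. Unset Printing Implicit Defensive.
Import Order.TTheory GRing.Theory Num.Theory.
Local Open Scope ring_scope.

Record quiver (n : nat) := Quiver {
  narr : nat;
  qsrc : 'I_narr -> 'I_n;
  qtgt : 'I_narr -> 'I_n }.
Arguments narr {n} q.
Arguments qsrc {n} q _.
Arguments qtgt {n} q _.

Definition qedge n (Q : quiver n) : rel 'I_n :=
  fun i j => [exists a : 'I_(narr Q), (qsrc Q a == i) && (qtgt Q a == j)].

Definition acyclic_quiver n (Q : quiver n) : Prop :=
  forall a : 'I_(narr Q), ~~ connect (qedge Q) (qtgt Q a) (qsrc Q a).

Definition connected_quiver n (Q : quiver n) : Prop :=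
  (0 < n)%N /\
  forall i j : 'I_n, connect (fun x y => qedge Q x y || qedge Q y x) i j.

Definition zvec n := {ffun 'I_n -> int}.

Definition evec n (i : 'I_n) : zvec n := [ffun j => (i == j)%:Z].

Definition posvec n (d : zvec n) : Prop :=
  (forall i, 0 <= d i) /\ d != 0.

Definition negroot n (d : zvec n) : Prop := exists i, d = - evec i.

Definition natdv n (d : zvec n) : 'I_n -> nat := fun i => `|d i|%N.

Section Reps.
Variable k : fieldType.
Variable n : nat.
Variable Q : quiver n.

(* a representation of dimension vector d: a k-linear map
   M_a : k^{d(s a)} -> k^{d(t a)} for each arrow a (acting on row vectors) *)
Definition repr (d : 'I_n -> nat) :=
  forall a : 'I_(narr Q), 'M[k]_(d (qsrc Q a), d (qtgt Q a)).

Definition vtxmaps (d e : 'I_n -> nat) := forall i : 'I_n, 'M[k]_(d i, e i).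
Definition arrmaps (d e : 'I_n -> nat) :=
  forall a : 'I_(narr Q), 'M[k]_(d (qsrc Q a), e (qtgt Q a)).

Definition is_hom d e (M : repr d) (N : repr e) (phi : vtxmaps d e) : Prop :=
  forall a, M a *m phi (qtgt Q a) = phi (qsrc Q a) *m N a.

Definition end_is_k d (M : repr d) : Prop :=
  forall phi : vtxmaps d d, is_hom M M phi ->
    exists c : k, forall i, phi i = c%:M.

(* The standard (Ringel) map
     delta : (+)_i Hom(M_i,N_i) -> (+)_a Hom(M_{s a}, N_{t a}),
     (phi_i) |-> (M_a phi_{t a} - phi_{s a} N_a)_a,
   whose kernel is Hom(M,N) and whose cokernel is Ext^1_{kQ}(M,N). *)
Definition ringel_delta d e (M : repr d) (N : repr e) (phi : vtxmaps d e)
  : arrmaps d e :=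
  fun a => M a *m phi (qtgt Q a) - phi (qsrc Q a) *m N a.

Definition arr_indep d e r (G : 'I_r -> arrmaps d e) : Prop :=
  forall c : 'I_r -> k,
    (forall a, \sum_(j < r) c j *: G j a = 0) -> forall j, c j = 0.

Definition image_dim d e (M : repr d) (N : repr e) (r : nat) : Prop :=
  (exists F : 'I_r -> vtxmaps d e,
      arr_indep (fun j => ringel_delta M N (F j))) /\
  (forall F : 'I_r.+1 -> vtxmaps d e,
      ~ arr_indep (fun j => ringel_delta M N (F j))).

(* dim Ext^1_{kQ}(M,N) = x, i.e. dim coker delta = x *)
Definition ext_dim d e (M : repr d) (N : repr e) (x : nat) : Prop :=
  exists r, image_dim M N r /\
    (x + r = \sum_(a < narr Q) d (qsrc Q a) * e (qtgt Q a))%N.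

(* ext(a,b) = x : x is the generic (= minimal) value of dim Ext^1(M,N)
   over representations M, N of dimension vectors a, b *)
Definition ext_is (a b : zvec n) (x : nat) : Prop :=
  (exists (M : repr (natdv a)) (N : repr (natdv b)), ext_dim M N x) /\
  (forall (M : repr (natdv a)) (N : repr (natdv b)) y,
      ext_dim M N y -> (x <= y)%N).

Definition schur_root (d : zvec n) : Prop :=
  posvec d /\ exists M : repr (natdv d), end_is_k M.

Definition gen_schur_root (d : zvec n) : Prop :=
  schur_root d \/ negroot d.

Definition ext_orth (a b : zvec n) : Prop :=
  (posvec a /\ posvec b /\ ext_is a b 0 /\ ext_is b a 0) \/
  (exists i, a = - evec i /\ posvec b /\ b i = 0) \/
  (exists i, b = - evec i /\ posvec a /\ a i = 0) \/
  (negroot a /\ negroot b).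

Definition component_cluster (C : seq (zvec n)) : Prop :=
  [/\ uniq C,
      (forall x, x \in C -> gen_schur_root x),
      (forall x y, x \in C -> y \in C -> x != y -> ext_orth x y) &
      (forall z, gen_schur_root z -> (forall x, x \in C -> ext_orth z x) ->
         z \in C)].

Definition card_inter (C1 C2 : seq (zvec n)) : nat :=
  size [seq x <- C1 | x \in C2].

Definition connected_by_mutation (C1 C2 : seq (zvec n)) : Prop :=
  card_inter C1 C2 = (minn (size C1) (size C2)).-1.

Definition gen_decomp (s : seq (zvec n)) (d : zvec n) : Prop :=
  [/\ \sum_(x <- s) x = d,
      (forall x, x \in s -> gen_schur_root x) &
      (forall i j, (i < size s)%N -> (j < size s)%N -> i != j ->
         ext_orth (nth 0 s i) (nth 0 s j))].

End Reps.

(* Main.v *)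
Require Import Defs.
From HB Require Import structures.
From mathcomp Require Import all_boot all_order all_algebra.
From mathcomp Require Import boolp ring zify.
Set Implicit Arguments. Unset Strict Implicit. Unset Printing Implicit Defensive.
Import Order.TTheory GRing.Theory Num.Theory.
Local Open Scope ring_scope.

(* Let c be ext-orthogonal to alpha and alpha'. Since ext(c, -) and ext(-, c) are
   subadditive, do not become positive when e_i is subtracted at a vertex with
   c_i = 0, and are additive over ext-orthogonal sums, c is ext-orthogonal to every
   summand of alpha + alpha'. Together with the uniqueness of the generic
   decomposition this makes C1 /\ C2 and the summands of alpha + alpha' one pairwise
   ext-orthogonal family. Such families have at most 2n members, because an integral
   relation between the positive ones would yield two generic decompositions of one
   vector, so the family extends to a maximal one.

   Existence of decompositions. If d is not a Schur root, every generic
   representation has a nonscalar endomorphism. An endomorphism with two eigenvalues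
   splits the representation. If there is none, a nonzero nilpotent endomorphism of
   maximal rank deforms with constant rank along every path of representations, and
   the first-order term of the deformation makes the dimension vectors of its kernel
   and its image ext-orthogonal.

   Uniqueness. Real roots are recognized by an open condition. In general, join
   generic sums for two decompositions s and t of d by a polynomial path. An
   endomorphism with distinct eigenvalues on the summands of s deforms along it, and
   for a weight x the Hankel determinant of the weighted traces of its powers is the
   product of the numbers x.s_i times a squared Vandermonde determinant. Hence
   x.s_i = 0 for some i iff x.t_j = 0 for some j, so the summands of s and t are
   proportional, and comparing ext shows that they are equal or ext-orthogonal. *)

(** Dominance and dimension arguments for group actions are replaced by polynomial paths in one
    variable t: an open condition that holds at one point of a path holds at almost all of them. The
    obstacle is that a splitting lifts along a path only as a formal power series. Since polynomial
    functions respect congruence modulo t^m, a truncation of order beyond the degree of the open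
    condition is enough. Two generic numbers carry the bookkeeping: ext over independent pairs (M,
    N) and ext over pairs (M, M). On a Schur root they agree if the Tits form q is 1 and differ by
    one if q <= 0, so their difference counts summands. This fixes the length of a decomposition
    before any uniqueness is known, and that length bounds the number of eigenvalues of an
    endomorphism along the path that compares two decompositions. Traces of powers are used on that
    path because they are polynomial in t, whereas eigenvalues and their multiplicities are not. *)

Notation rep := Defs.repr.

(** Turns a lower bound on a rank into the non-vanishing of one determinant, with [X] and [Y] kept
    constant while [A] varies. *)
Lemma fullrank_sandwich (F : fieldType) p q (A : 'M[F]_(p, q)) r :
  (r <= \rank A)%N ->
  exists (X : 'M[F]_(r, p)) (Y : 'M[F]_(q, r)), X *m A *m Y = 1%:M.
Proof.
move=> hr.
exists (pid_mx r *m invmx (col_ebase A)), (invmx (row_ebase A) *m pid_mx r).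
have e : invmx (col_ebase A) *m A *m invmx (row_ebase A) = pid_mx (\rank A).
  have := mulmx_ebase A; have := col_ebase_unit A; have := row_ebase_unit A.
  move: (pid_mx _) (col_ebase A) (row_ebase A) => P C D uD uC <-.
  by rewrite !mulmxA mulVmx // mul1mx mulmxK.
have -> : pid_mx r *m invmx (col_ebase A) *m A *m (invmx (row_ebase A) *m pid_mx r)
  = pid_mx r *m (invmx (col_ebase A) *m A *m invmx (row_ebase A)) *m pid_mx r :> 'M_r.
  by rewrite !mulmxA.
rewrite e.
rewrite mul_pid_mx mul_pid_mx.
have hp := rank_leq_row A; have hq := rank_leq_col A.
have e1 : minn p (minn r (\rank A)) = r.
  by rewrite (minn_idPl hr) (minn_idPr (leq_trans hr hp)).
by rewrite e1 minnn (minn_idPr (leq_trans hr hq)) pid_mx_1.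
Qed.

(** * Non-roots of polynomials in characteristic 0 *)

Section PolyNonroot.
Variables (k : fieldType) (hchar : [pchar k] =i pred0).

Lemma natr_inj_char0 : injective (fun m : nat => m%:R : k).
Proof.
move=> a b; wlog le : a b / (a <= b)%N => [hw|] /=.
  by case/orP: (leq_total a b) => le e; [apply: hw | apply/esym/hw].
move=> e; have /pcharf0P h := hchar.
by apply/eqP; rewrite eqn_leq le /= -subn_eq0 -h natrB // e subrr.
Qed.

Lemma natr_neq0 m : (0 < m)%N -> m%:R != 0 :> k.
Proof. by move=> hm; have /pcharf0P -> := hchar; rewrite -lt0n. Qed.

(** The integers below [size f] are distinct elements of k, too many to be all roots. *)
Lemma poly_nonroot (f : {poly k}) : f != 0 -> exists t, f.[t] != 0.
Proof.
move=> f0; apply: contrapT => h.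
have := @max_poly_roots _ f [seq i%:R | i <- iota 0 (size f)] f0.
rewrite size_map size_iota ltnn => H; suff: false by []; apply: H.
  by apply/allP => x _; rewrite /root; apply: contraT => x0; case: h; exists x.
rewrite map_inj_uniq ?iota_uniq //; exact: natr_inj_char0.
Qed.

Lemma poly_eq0_nonroot (f g : {poly k}) : g != 0 ->
  (forall t, g.[t] != 0 -> f.[t] = 0) -> f = 0.
Proof.
move=> g0 h; apply/eqP; apply: contraT => f0.
have /poly_nonroot [t] : f * g != 0 by rewrite mulf_neq0.
by rewrite hornerM mulf_eq0 negb_or => /andP[ft /h /eqP]; rewrite (negPf ft).
Qed.
End PolyNonroot.

(** * Polynomial functions and Zariski-open conditions *)

(* [pth] stands for polynomial paths in a variable t, and [pcg m] for their congruence modulo t^m. *)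
Record pspace (k : fieldType) := PSpace {
  pt : Type;
  pth : Type;
  pev : pth -> k -> pt;
  pcg : nat -> pth -> pth -> Prop;
  pline : pt -> pt -> pth;
  pline0 : forall x y, pev (pline x y) 0 = x;
  pline1 : forall x y, pev (pline x y) 1 = y }.

Section PolyFun.
Variables (k : fieldType) (X : pspace k).

(** Regular functions seen through paths: along each path the value is a polynomial in t, and modulo
    t^m it depends only on the path modulo t^m. The second clause is what allows a path to be
    replaced by an approximation of high order. *)
Definition polyfun (G : pt X -> k) : Prop :=
  exists Gh : pth X -> {poly k},
    (forall p t, (Gh p).[t] = G (pev p t)) /\
    (forall m p p', pcg m p p' -> 'X^m %| Gh p - Gh p').

Lemma polyfun_ext G G' : (forall x, G x = G' x) -> polyfun G -> polyfun G'.
Proof. by move=> /funext ->. Qed.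

Lemma polyfun_const c : polyfun (fun=> c).
Proof.
by exists (fun=> c%:P); split=> [p t|m p p' _]; rewrite ?hornerC // subrr dvdp0.
Qed.

Lemma polyfunD G H : polyfun G -> polyfun H -> polyfun (fun x => G x + H x).
Proof.
move=> [g [g1 g2]] [h [h1 h2]]; exists (fun p => g p + h p); split=> [p t|m p p' e].
  by rewrite hornerD g1 h1.
by rewrite opprD addrACA dvdp_add ?(g2 _ _ _ e) ?(h2 _ _ _ e).
Qed.

Lemma polyfunM G H : polyfun G -> polyfun H -> polyfun (fun x => G x * H x).
Proof.
move=> [g [g1 g2]] [h [h1 h2]]; exists (fun p => g p * h p); split=> [p t|m p p' e].
  by rewrite hornerM g1 h1.
have -> : g p * h p - g p' * h p' = (g p - g p') * h p + g p' * (h p - h p').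
  by rewrite mulrBl mulrBr addrA subrK.
by apply: dvdp_add; [apply/dvdp_mulr/g2 | apply/dvdp_mull/h2].
Qed.

Lemma polyfunN G : polyfun G -> polyfun (fun x => - G x).
Proof.
move=> h; apply: polyfun_ext (polyfunM (polyfun_const (-1)) h) => x.
by rewrite mulN1r.
Qed.

Lemma polyfun_sum (I : Type) (r : seq I) (P : pred I) (G : I -> pt X -> k) :
  (forall i, polyfun (G i)) -> polyfun (fun x => \sum_(i <- r | P i) G i x).
Proof.
move=> h; elim: r => [|i r IH].
  by apply: polyfun_ext (polyfun_const 0) => x; rewrite big_nil.
case Pi: (P i); last by apply: polyfun_ext IH => x; rewrite big_cons Pi.
by apply: polyfun_ext (polyfunD (h i) IH) => x; rewrite big_cons Pi.
Qed.

Lemma polyfun_prod (I : Type) (r : seq I) (P : pred I) (G : I -> pt X -> k) :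
  (forall i, polyfun (G i)) -> polyfun (fun x => \prod_(i <- r | P i) G i x).
Proof.
move=> h; elim: r => [|i r IH].
  by apply: polyfun_ext (polyfun_const 1) => x; rewrite big_nil.
case Pi: (P i); last by apply: polyfun_ext IH => x; rewrite big_cons Pi.
by apply: polyfun_ext (polyfunM (h i) IH) => x; rewrite big_cons Pi.
Qed.

Definition polymx p q (F : pt X -> 'M[k]_(p, q)) : Prop :=
  forall i j, polyfun (fun x => F x i j).

Lemma polymx_const p q (A : 'M[k]_(p, q)) : polymx (fun=> A).
Proof. by move=> i j; apply: polyfun_const. Qed.

Lemma polymxM p q r (A : pt X -> 'M[k]_(p, q)) (B : pt X -> 'M[k]_(q, r)) :
  polymx A -> polymx B -> polymx (fun x => A x *m B x).
Proof.
move=> hA hB i j.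
have := @polyfun_sum _ (index_enum 'I_q) xpredT (fun l x => A x i l * B x l j).
move=> /(_ (fun l => polyfunM (hA i l) (hB l j))).
by apply: polyfun_ext => x; rewrite mxE.
Qed.

Lemma polymxD p q (A B : pt X -> 'M[k]_(p, q)) :
  polymx A -> polymx B -> polymx (fun x => A x + B x).
Proof.
move=> hA hB i j; apply: polyfun_ext (polyfunD (hA i j) (hB i j)) => x.
by rewrite mxE.
Qed.

Lemma polymxN p q (A : pt X -> 'M[k]_(p, q)) :
  polymx A -> polymx (fun x => - A x).
Proof. by move=> hA i j; apply: polyfun_ext (polyfunN (hA i j)) => x; rewrite mxE. Qed.

Lemma polymxZ p q (c : pt X -> k) (A : pt X -> 'M[k]_(p, q)) :
  polyfun c -> polymx A -> polymx (fun x => c x *: A x).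
Proof.
by move=> hc hA i j; apply: polyfun_ext (polyfunM hc (hA i j)) => x; rewrite mxE.
Qed.

Lemma polyfun_det p (A : pt X -> 'M[k]_p) :
  polymx A -> polyfun (fun x => \det (A x)).
Proof.
move=> hA; apply: polyfun_sum => s; apply: polyfunM; first exact: polyfun_const.
by apply: polyfun_prod => i; apply: hA.
Qed.

Lemma polymx_adj p (A : pt X -> 'M[k]_p) :
  polymx A -> polymx (fun x => \adj (A x)).
Proof.
move=> hA i j.
have h : polymx (fun x => row' j (col' i (A x))).
  by move=> a b; apply: polyfun_ext (hA (lift j a) (lift i b)) => x; rewrite !mxE.
apply: polyfun_ext (polyfunM (polyfun_const ((-1) ^+ (j + i))) (polyfun_det h)).
by move=> x; rewrite mxE.
Qed.

Lemma polyfun_tr p (A : pt X -> 'M[k]_p) :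
  polymx A -> polyfun (fun x => \tr (A x)).
Proof. by move=> hA; apply: polyfun_sum => i; apply: hA. Qed.

Lemma polymx_path p q (F : pt X -> 'M[k]_(p, q)) (P : pth X) : polymx F ->
  exists Fh : 'M[{poly k}]_(p, q), forall t, map_mx (horner_eval t) Fh = F (pev P t).
Proof.
move=> hF.
have /choice [f hf] : forall ij : 'I_p * 'I_q, exists g : {poly k},
    forall t, g.[t] = F (pev P t) ij.1 ij.2.
  by case=> i j; case: (hF i j) => g [g1 _]; exists (g P).
by exists (\matrix_(i, j) f (i, j)) => t; apply/matrixP => i j; rewrite !mxE /horner_eval hf.
Qed.

Definition zopen (O : pt X -> Prop) : Prop :=
  forall x, O x -> exists G, [/\ polyfun G, G x != 0 & forall y, G y != 0 -> O y].

Lemma zopenI O O' : zopen O -> zopen O' -> zopen (fun x => O x /\ O' x).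
Proof.
move=> h h' x [/h [G [G1 G2 G3]] /h' [H [H1 H2 H3]]].
exists (fun y => G y * H y); split; first exact: polyfunM.
  by rewrite mulf_neq0.
by move=> y; rewrite mulf_eq0 negb_or => /andP[/G3 ? /H3].
Qed.

Lemma zopenT : zopen (fun=> True).
Proof.
by move=> x _; exists (fun=> 1); split=> //; [apply: polyfun_const | rewrite oner_neq0].
Qed.

Lemma zopen_ext O O' : (forall x, O x <-> O' x) -> zopen O -> zopen O'.
Proof. by move=> /(_ _)/propext-/funext ->. Qed.

Lemma zopen_rank p q (F : pt X -> 'M[k]_(p, q)) r :
  polymx F -> zopen (fun x => r <= \rank (F x))%N.
Proof.
move=> hF x /fullrank_sandwich [L [R LR]].
exists (fun y => \det (L *m F y *m R)); split.
- by apply: polyfun_det; apply: polymxM (polymxM _ _) _ => //; apply: polymx_const.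
- by rewrite LR det1 oner_neq0.
move=> y d0; have u : L *m F y *m R \in unitmx by rewrite unitmxE unitfE.
rewrite -(mxrank_unit u); apply: leq_trans (mxrankM_maxl _ _) _; exact: mxrankM_maxr.
Qed.

Lemma zopen_path O (P : pth X) t0 : zopen O -> O (pev P t0) ->
  exists2 f : {poly k}, f.[t0] != 0 & forall t, f.[t] != 0 -> O (pev P t).
Proof.
move=> h /h [G [[g [g1 _]] G2 G3]]; exists (g P); first by rewrite g1.
by move=> t; rewrite g1 => /G3.
Qed.

Hypothesis hchar : [pchar k] =i pred0.

(** Irreducibility of the space: on the line joining a point of each set, the two defining functions
    restrict to nonzero polynomials, and their product has a non-root. *)
Lemma zopen_meet O O' : zopen O -> zopen O' ->
  (exists x, O x) -> (exists x, O' x) -> exists x, O x /\ O' x.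
Proof.
move=> h h' [x Ox] [x' Ox'].
have [f f0 fO] : exists2 f : {poly k}, f.[0] != 0 & forall t, f.[t] != 0 -> O (pev (pline x x') t).
  by apply: zopen_path => //; rewrite pline0.
have [g g1 gO] : exists2 f : {poly k}, f.[1] != 0 & forall t, f.[t] != 0 -> O' (pev (pline x x') t).
  by apply: zopen_path => //; rewrite pline1.
have /(poly_nonroot hchar) [t] : f * g != 0.
  by rewrite mulf_neq0 //; [apply: contraNneq f0 | apply: contraNneq g1] => ->; rewrite horner0.
rewrite hornerM mulf_eq0 negb_or => /andP[/fO ? /gO ?].
by exists (pev (pline x x') t).
Qed.

(* Cramer's rule: if X C(x0) Y = 1 with X, Y of the maximal rank, then
   w = det(X C Y) v - v C Y adj(X C Y) X. *)
Lemma kernel_lift p q (C : pt X -> 'M[k]_(p, q)) x0 (v : 'rV[k]_p) :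
  polymx C -> (forall x, \rank (C x) <= \rank (C x0))%N -> v *m C x0 = 0 ->
  exists2 w : pt X -> 'rV[k]_p, polymx w & w x0 = v /\
    exists G, [/\ polyfun G, G x0 != 0 & forall x, G x != 0 -> w x *m C x = 0].
Proof.
move=> hC hr hv; case: (fullrank_sandwich (leqnn (\rank (C x0)))) => L [R LR].
pose D x := L *m C x *m R.
have hD : polymx D by apply: polymxM (polymxM _ _) _ => //; apply: polymx_const.
exists (fun x => \det (D x) *: v - v *m C x *m R *m \adj (D x) *m L).
  apply: polymxD; first by apply: polymxZ; [apply: polyfun_det | apply: polymx_const].
  apply: polymxN; do 2![apply: polymxM; last by [apply: polymx_const | apply: polymx_adj]].
  by do 2?[apply: polymxM]; rewrite //; apply: polymx_const.
split.
  by rewrite /D LR det1 scale1r -2!mulmxA hv !mul0mx subr0.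
exists (fun x => \det (D x)); split; [exact: polyfun_det | by rewrite /D LR det1 oner_neq0|].
move=> x dx.
have uD : D x \in unitmx by rewrite unitmxE unitfE.
(* Invertibility of [D x] bounds the rank of [C x *m R] from below by the maximal rank, so [R] is
   injective on the row space of [C x]. *)
have rk : \rank (C x *m R) = \rank (C x).
  apply/eqP; rewrite eqn_leq mxrankM_maxl /= (leq_trans (hr x)) //.
  by rewrite -{1}(mxrank_unit uD) /D -mulmxA mxrankM_maxr.
set w := (_ - _); have : w *m C x *m R = 0.
  have -> : w *m C x *m R =
      \det (D x) *: (v *m C x *m R) - v *m C x *m R *m \adj (D x) *m D x.
    by rewrite /w !mulmxBl -!scalemxAl {4}/D !mulmxA.
  by rewrite -[X in _ - X]mulmxA mul_adj_mx mul_mx_scalar subrr.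
move=> wR.
have inj : row_free (row_base (C x) *m R).
  by rewrite /row_free (eqmxMr R (eq_row_base (C x))) rk.
have /submxP [y yE] : (w *m C x <= row_base (C x))%MS.
  by rewrite eq_row_base submxMl.
apply/eqP; rewrite yE; suff -> : y = 0 by rewrite mul0mx.
by apply: (row_free_inj inj); rewrite /= mul0mx mulmxA -yE.
Qed.

End PolyFun.

(** * Products of path spaces *)

Section ProdSpace.
Variables (k : fieldType) (X Y : pspace k).

Fact prodP0 (x y : pt X * pt Y) :
  (pev (pline x.1 y.1) 0, pev (pline x.2 y.2) 0) = x.
Proof. by rewrite !pline0 -surjective_pairing. Qed.
Fact prodP1 (x y : pt X * pt Y) :
  (pev (pline x.1 y.1) 1, pev (pline x.2 y.2) 1) = y.
Proof. by rewrite !pline1 -surjective_pairing. Qed.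

Definition prod_pspace : pspace k :=
  @PSpace k (pt X * pt Y) (pth X * pth Y)
    (fun p t => (pev p.1 t, pev p.2 t))
    (fun m p p' => pcg m p.1 p'.1 /\ pcg m p.2 p'.2)
    (fun x y => (pline x.1 y.1, pline x.2 y.2)) prodP0 prodP1.

Lemma polyfun_fst G : @polyfun k X G -> @polyfun k prod_pspace (fun z => G z.1).
Proof.
move=> [g [g1 g2]]; exists (fun p => g p.1); split=> [p t|m p p' [e _]] //; exact: g2.
Qed.

Lemma polyfun_snd G : @polyfun k Y G -> @polyfun k prod_pspace (fun z => G z.2).
Proof.
move=> [g [g1 g2]]; exists (fun p => g p.2); split=> [p t|m p p' [_ e]] //; exact: g2.
Qed.

Lemma zopen_fst O : @zopen k X O -> @zopen k prod_pspace (fun z => O z.1).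
Proof.
move=> h x /h [G [G1 G2 G3]]; exists (fun z => G z.1); split=> //.
  exact: polyfun_fst.
by move=> y /G3.
Qed.

Lemma zopen_snd O : @zopen k Y O -> @zopen k prod_pspace (fun z => O z.2).
Proof.
move=> h x /h [G [G1 G2 G3]]; exists (fun z => G z.2); split=> //.
  exact: polyfun_snd.
by move=> y /G3.
Qed.
End ProdSpace.

(** * Families of matrices *)

Section Fam.
Variables (I : finType) (p q : I -> nat).

Definition fam (R : Type) := forall i, 'M[R]_(p i, q i).

(** Index set of all entries of the family; flattening a family to one row vector makes the Ringel
    map a matrix, to which rank arguments apply. *)
Definition coords : finType := {i : I & ('I_(p i) * 'I_(q i))%type}.

Lemma card_coords : #|coords| = (\sum_i p i * q i)%N.
Proof.
rewrite card_tagged sumnE big_map big_enum /=.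
by apply: eq_bigr => i _; rewrite card_prod !card_ord.
Qed.

Variable k : fieldType.

Definition enc (F : fam k) : 'rV[k]_#|coords| :=
  \row_l F (tag (enum_val l)) (tagged (enum_val l)).1 (tagged (enum_val l)).2.

Definition dec (u : 'rV[k]_#|coords|) : fam k := fun i =>
  \matrix_(a, b) u 0 (enum_rank (Tagged (fun i => ('I_(p i) * 'I_(q i))%type) (a, b))).

Lemma encK : cancel enc dec.
Proof.
move=> F; apply: functional_extensionality_dep => i; apply/matrixP => a b.
by rewrite !mxE enum_rankK.
Qed.

Lemma decK : cancel dec enc.
Proof.
move=> u; apply/rowP => l; rewrite !mxE; congr (u 0 _).
by rewrite -[in RHS](enum_valK l); case: (enum_val l) => i [a b].
Qed.

Lemma enc0 : enc (fun=> 0) = 0.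
Proof. by apply/rowP => l; rewrite !mxE. Qed.

Lemma dec0 i : dec 0 i = 0.
Proof. by apply/matrixP => a b; rewrite !mxE. Qed.

Lemma dec_lin c u v i : dec (c *: u + v) i = c *: dec u i + dec v i.
Proof. by apply/matrixP => a b; rewrite !mxE. Qed.

Lemma enc_lin c F G : enc (fun i => c *: F i + G i) = c *: enc F + enc G.
Proof. by apply/rowP => l; rewrite !mxE. Qed.

Definition fam_line (x y : fam k) : fam {poly k} := fun i =>
  \matrix_(a, b) ((x i a b)%:P + (y i a b - x i a b) *: 'X).

Definition fam_ev (P : fam {poly k}) (t : k) : fam k :=
  fun i => map_mx (horner_eval t) (P i).

Fact fam_line0 x y : fam_ev (fam_line x y) 0 = x.
Proof.
apply: functional_extensionality_dep => i; apply/matrixP => a b.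
by rewrite !mxE /horner_eval !hornerE.
Qed.
Fact fam_line1 x y : fam_ev (fam_line x y) 1 = y.
Proof.
apply: functional_extensionality_dep => i; apply/matrixP => a b.
by rewrite !mxE /horner_eval hornerD hornerC hornerZ hornerX mulr1 addrC subrK.
Qed.

Definition fam_pspace : pspace k :=
  @PSpace k (fam k) (fam {poly k}) fam_ev
    (fun m P P' => forall i a b, 'X^m %| P i a b - P' i a b)
    fam_line fam_line0 fam_line1.

Lemma polymx_coord i : @polymx k fam_pspace _ _ (fun x => x i).
Proof.
move=> a b; exists (fun P => P i a b); split=> [P t|m P P' //]; by rewrite /= mxE.
Qed.

Definition polyfam (X : pspace k) (F : pt X -> fam k) :=
  forall i, polymx (fun x => F x i).

Lemma polymx_enc (X : pspace k) (F : pt X -> fam k) :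
  polyfam F -> polymx (fun x => enc (F x)).
Proof.
move=> h a l; apply: polyfun_ext (h (tag (enum_val l)) (tagged (enum_val l)).1 (tagged (enum_val l)).2).
by move=> x; rewrite mxE.
Qed.

End Fam.

Section LinRank.
Variable F : fieldType.

Lemma lin1_mxE p q (f : 'rV[F]_p -> 'rV[F]_q) :
  linear f -> forall u, u *m lin1_mx f = f u.
Proof.
move=> hf u; pose f' : {linear 'rV[F]_p -> 'rV[F]_q} :=
  HB.pack f (GRing.isLinear.Build F _ _ *:%R f hf).
exact: (mul_rV_lin1 f').
Qed.

(** The outer maps are given as linear functions, so that blockwise operations need not be written
    as matrices in the coordinates of [enc]. *)
Lemma rank_factor p q p' q' (A : 'M[F]_(p, q)) (B : 'M[F]_(p', q'))
    (f : 'rV[F]_p -> 'rV[F]_p') (h : 'rV[F]_q' -> 'rV[F]_q) :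
  linear f -> linear h -> (forall u, u *m A = h (f u *m B)) ->
  (\rank A <= \rank B)%N.
Proof.
move=> hf hh e; have -> : A = lin1_mx f *m B *m lin1_mx h.
  apply/row_matrixP => i; rewrite !rowE !mulmxA !lin1_mxE // e //.
exact: leq_trans (mxrankM_maxl _ _) (mxrankM_maxr _ _).
Qed.
End LinRank.

Definition vadd n (a b : 'I_n -> nat) : 'I_n -> nat := fun v => (a v + b v)%N.

(** * The Ringel map in coordinates *)

Section Dmat.
Variables (k : fieldType) (n : nat) (Q : quiver n).
Implicit Types a b d e : 'I_n -> nat.

Definition vcoords d e := coords d e.
Definition acoords d e :=
  coords (fun x : 'I_(narr Q) => d (qsrc Q x)) (fun x => e (qtgt Q x)).
Definition dimV d e : nat := #|vcoords d e|.
Definition dimA d e : nat := #|acoords d e|.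

Lemma dimVE d e : dimV d e = (\sum_i d i * e i)%N.
Proof. exact: card_coords. Qed.
Lemma dimAE d e : dimA d e = (\sum_(x < narr Q) d (qsrc Q x) * e (qtgt Q x))%N.
Proof. exact: card_coords. Qed.

Lemma dimADl a b e : dimA (vadd a b) e = (dimA a e + dimA b e)%N.
Proof. by rewrite !dimAE -big_split; apply: eq_bigr => i _; rewrite mulnDl. Qed.
Lemma dimADr e a b : dimA e (vadd a b) = (dimA e a + dimA e b)%N.
Proof. by rewrite !dimAE -big_split; apply: eq_bigr => i _; rewrite mulnDr. Qed.

Definition encV d e (phi : vtxmaps k d e) : 'rV[k]_(dimV d e) := enc phi.
Definition decV d e (u : 'rV[k]_(dimV d e)) : vtxmaps k d e := dec u.
Definition encA d e (Z : arrmaps k Q d e) : 'rV[k]_(dimA d e) :=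
  enc (p := fun x => d (qsrc Q x)) (q := fun x => e (qtgt Q x)) Z.
Definition decA d e (u : 'rV[k]_(dimA d e)) : arrmaps k Q d e :=
  dec (p := fun x => d (qsrc Q x)) (q := fun x => e (qtgt Q x)) u.

Lemma encVK d e : cancel (@encV d e) (@decV d e). Proof. exact: encK. Qed.
Lemma decVK d e : cancel (@decV d e) (@encV d e). Proof. exact: decK. Qed.
Lemma encAK d e : cancel (@encA d e) (@decA d e). Proof. exact: encK. Qed.
Lemma decAK d e : cancel (@decA d e) (@encA d e). Proof. exact: decK. Qed.

Lemma decV_lin d e c (u v : 'rV_(dimV d e)) i :
  decV (c *: u + v) i = c *: decV u i + decV v i.
Proof. exact: dec_lin. Qed.
Lemma decA_lin d e c (u v : 'rV_(dimA d e)) i :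
  decA (c *: u + v) i = c *: decA u i + decA v i.
Proof. exact: dec_lin. Qed.
Lemma encA_lin d e c (F G : arrmaps k Q d e) :
  encA (fun i => c *: F i + G i) = c *: encA F + encA G.
Proof. exact: enc_lin. Qed.
Lemma encV_lin d e c (F G : vtxmaps k d e) :
  encV (fun i => c *: F i + G i) = c *: encV F + encV G.
Proof. exact: enc_lin. Qed.

Definition dmap d e (M : rep k Q d) (N : rep k Q e) (u : 'rV_(dimV d e)) :=
  encA (ringel_delta M N (decV u)).

Lemma dmap_linear d e (M : rep k Q d) (N : rep k Q e) : linear (dmap M N).
Proof.
move=> c u v; rewrite /dmap -encA_lin; congr (encA _).
apply: functional_extensionality_dep => x; rewrite /ringel_delta !decV_lin.
rewrite mulmxDr mulmxDl -scalemxAr -scalemxAl scalerBr opprD !addrA.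
by congr (_ + _); rewrite -!addrA; congr (_ + _); rewrite addrC.
Qed.

(** Vectors are rows, so the left kernel is Hom(M, N) and the column corank is dim Ext(M, N). *)
Definition dmat d e (M : rep k Q d) (N : rep k Q e) : 'M[k]_(dimV d e, dimA d e) :=
  lin1_mx (dmap M N).

Lemma dmatE d e (M : rep k Q d) (N : rep k Q e) u :
  u *m dmat M N = encA (ringel_delta M N (decV u)).
Proof. exact/lin1_mxE/dmap_linear. Qed.

Lemma dmat_enc d e (M : rep k Q d) (N : rep k Q e) phi :
  encV phi *m dmat M N = encA (ringel_delta M N phi).
Proof. by rewrite dmatE encVK. Qed.

Definition ext_zero d e (M : rep k Q d) (N : rep k Q e) : Prop :=
  forall Z : arrmaps k Q d e, exists phi, forall x, ringel_delta M N phi x = Z x.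

Lemma row_full_ext d e (M : rep k Q d) (N : rep k Q e) :
  row_full (dmat M N) <-> ext_zero M N.
Proof.
split=> [h Z|h].
  have /submxP [u uE] : (encA Z <= dmat M N)%MS by apply: submx_full.
  exists (decV u) => x; have := congr1 (@decA _ _) uE.
  by rewrite dmatE !encAK => ->.
rewrite -sub1mx; apply/row_subP => i; apply/submxP.
case: (h (decA (row i 1%:M))) => phi hphi; exists (encV phi).
by rewrite dmat_enc -[LHS]decAK; congr encA; apply: functional_extensionality_dep => x.
Qed.

Definition hom_zero d e (M : rep k Q d) (N : rep k Q e) : Prop :=
  forall phi : vtxmaps k d e, is_hom M N phi -> forall i, phi i = 0.

Lemma is_homE d e (M : rep k Q d) (N : rep k Q e) phi :
  is_hom M N phi <-> encV phi *m dmat M N = 0.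
Proof.
rewrite dmat_enc; split=> [h|/(congr1 (@decA _ _)) h x].
  have -> : ringel_delta M N phi = fun=> 0.
    by apply: functional_extensionality_dep => x; rewrite /ringel_delta h subrr.
  exact: enc0.
move: h; rewrite encAK => /(congr1 (fun f => f x)).
by rewrite /decA dec0 => /eqP; rewrite subr_eq0 => /eqP.
Qed.

Lemma row_free_hom d e (M : rep k Q d) (N : rep k Q e) :
  row_free (dmat M N) <-> hom_zero M N.
Proof.
split=> [h phi /is_homE hp i|h].
  have e0 : encV phi = 0 by apply: (row_free_inj h); rewrite /= mul0mx.
  by rewrite -[phi]encVK e0 /decV dec0.
rewrite -kermx_eq0; apply/eqP/row_matrixP => i; rewrite row0.
set u := row i _; have : u *m dmat M N = 0.
  by apply/sub_kermxP; rewrite row_sub.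
rewrite -[u]decVK => /is_homE /h z; rewrite -(enc0 d e k); congr encV.
exact: functional_extensionality_dep.
Qed.

Definition rsp d : pspace k :=
  fam_pspace (fun x : 'I_(narr Q) => d (qsrc Q x)) (fun x => d (qtgt Q x)) k.

Definition polyrep (X : pspace k) d (M : pt X -> rep k Q d) : Prop :=
  forall x, polymx (fun z => M z x).

Lemma polyrep_id d : polyrep (X := rsp d) id.
Proof. by move=> x; apply: polymx_coord. Qed.

Lemma polyrep_const (X : pspace k) d (M : rep k Q d) : polyrep (X := X) (fun=> M).
Proof. by move=> x; apply: polymx_const. Qed.

Lemma polymx_dmat (X : pspace k) d e (M : pt X -> rep k Q d) (N : pt X -> rep k Q e) :
  polyrep M -> polyrep N -> polymx (fun z => dmat (M z) (N z)).
Proof.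
move=> hM hN i j.
have h : polymx (fun z => encA (ringel_delta (M z) (N z) (decV (delta_mx 0 i)))).
  apply: polymx_enc => x; apply: polymxD; last apply: polymxN.
    by apply: polymxM => //; apply: polymx_const.
  by apply: polymxM => //; apply: polymx_const.
by apply: polyfun_ext (h 0 j) => z; rewrite /dmat [in RHS]mxE.
Qed.

Lemma zopen_dmat_rank (X : pspace k) d e (M : pt X -> rep k Q d)
    (N : pt X -> rep k Q e) r : polyrep M -> polyrep N ->
  zopen (fun z => r <= \rank (dmat (M z) (N z)))%N.
Proof. by move=> hM hN; apply: zopen_rank; apply: polymx_dmat. Qed.

Lemma zopen_ext_zero (X : pspace k) d e (M : pt X -> rep k Q d)
    (N : pt X -> rep k Q e) : polyrep M -> polyrep N ->
  zopen (fun z => ext_zero (M z) (N z)).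
Proof.
move=> hM hN; apply: zopen_ext (zopen_dmat_rank (r := dimA d e) hM hN) => z.
by rewrite -row_full_ext /row_full eqn_leq rank_leq_col.
Qed.

Lemma zopen_hom_zero (X : pspace k) d e (M : pt X -> rep k Q d)
    (N : pt X -> rep k Q e) : polyrep M -> polyrep N ->
  zopen (fun z => hom_zero (M z) (N z)).
Proof.
move=> hM hN; apply: zopen_ext (zopen_dmat_rank (r := dimV d e) hM hN) => z.
by rewrite -row_free_hom /row_free eqn_leq rank_leq_row.
Qed.

Definition rsp2 d e := prod_pspace (rsp d) (rsp e).

Lemma polyrep_fst d e : polyrep (X := rsp2 d e) fst.
Proof. by move=> x i j; apply: (@polyfun_fst _ (rsp d) (rsp e) (fun M => M x i j)); apply: polymx_coord. Qed.
Lemma polyrep_snd d e : polyrep (X := rsp2 d e) snd.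
Proof. by move=> x i j; apply: (@polyfun_snd _ (rsp d) (rsp e) (fun M => M x i j)); apply: polymx_coord. Qed.

(** * Generic ext *)

Definition rep0 d : rep k Q d := fun=> 0.

Lemma rkmax_ex d e : exists r, `[< exists (M : rep k Q d) (N : rep k Q e), \rank (dmat M N) = r >].
Proof. by exists (\rank (dmat (rep0 d) (rep0 e))); apply/asboolP; do 2!eexists. Qed.
Lemma rkmax_bound d e r :
  `[< exists (M : rep k Q d) (N : rep k Q e), \rank (dmat M N) = r >] -> (r <= dimA d e)%N.
Proof. by move=> /asboolP [M [N <-]]; apply: rank_leq_col. Qed.
Definition rkmax d e : nat := ex_maxn (rkmax_ex d e) (@rkmax_bound d e).

Lemma srkmax_ex d : exists r, `[< exists M : rep k Q d, \rank (dmat M M) = r >].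
Proof. by exists (\rank (dmat (rep0 d) (rep0 d))); apply/asboolP; eexists. Qed.
Lemma srkmax_bound d r :
  `[< exists M : rep k Q d, \rank (dmat M M) = r >] -> (r <= dimA d d)%N.
Proof. by move=> /asboolP [M <-]; apply: rank_leq_col. Qed.
Definition srkmax d : nat := ex_maxn (srkmax_ex d) (@srkmax_bound d).

Definition gext d e : nat := (dimA d e - rkmax d e)%N.
(** Here one M fills both arguments, whereas in [gext d d] they vary independently; the gap between
    the two counts summands in [count_imag]. *)
Definition sext d : nat := (dimA d d - srkmax d)%N.

Lemma rkmax_le d e (M : rep k Q d) (N : rep k Q e) : (\rank (dmat M N) <= rkmax d e)%N.
Proof. by rewrite /rkmax; case: ex_maxnP => r _; apply; apply/asboolP; exists M, N. Qed.
Lemma rkmax_wit d e : exists (M : rep k Q d) (N : rep k Q e), \rank (dmat M N) = rkmax d e.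
Proof. by rewrite /rkmax; case: ex_maxnP => r /asboolP. Qed.
Lemma srkmax_le d (M : rep k Q d) : (\rank (dmat M M) <= srkmax d)%N.
Proof. by rewrite /srkmax; case: ex_maxnP => r _; apply; apply/asboolP; exists M. Qed.
Lemma srkmax_wit d : exists M : rep k Q d, \rank (dmat M M) = srkmax d.
Proof. by rewrite /srkmax; case: ex_maxnP => r /asboolP. Qed.

Lemma rkmax_dimA d e : (rkmax d e <= dimA d e)%N.
Proof. by case: (rkmax_wit d e) => M [N <-]; apply: rank_leq_col. Qed.
Lemma rkmax_dimV d e : (rkmax d e <= dimV d e)%N.
Proof. by case: (rkmax_wit d e) => M [N <-]; apply: rank_leq_row. Qed.
Lemma srkmax_dimA d : (srkmax d <= dimA d d)%N.
Proof. by case: (srkmax_wit d) => M <-; apply: rank_leq_col. Qed.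
Lemma gextE d e : (gext d e + rkmax d e)%N = dimA d e.
Proof. by rewrite subnK // rkmax_dimA. Qed.
Lemma sextE d : (sext d + srkmax d)%N = dimA d d.
Proof. by rewrite subnK // srkmax_dimA. Qed.

Lemma gext_eq0 d e : gext d e = 0 <->
  exists (M : rep k Q d) (N : rep k Q e), ext_zero M N.
Proof.
split=> [h|[M [N /row_full_ext h]]].
  have := gextE d e; rewrite h add0n.
  case: (rkmax_wit d e) => M [N <-] /eqP h'; exists M, N.
  by apply/row_full_ext.
apply/eqP; rewrite subn_eq0; apply: leq_trans (rkmax_le M N).
by move: h; rewrite /row_full => /eqP ->.
Qed.

(** * Direct sums and isomorphisms *)

Definition dsum a b (A : rep k Q a) (B : rep k Q b) : rep k Q (vadd a b) :=
  fun x => block_mx (A x) 0 0 (B x).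

Lemma row_mx_lin (m p q : nat) c (A A' : 'M[k]_(m, p)) (B B' : 'M[k]_(m, q)) :
  row_mx (c *: A + A') (c *: B + B') = c *: row_mx A B + row_mx A' B'.
Proof. by rewrite scale_row_mx add_row_mx. Qed.
Lemma col_mx_lin (m p q : nat) c (A A' : 'M[k]_(p, m)) (B B' : 'M[k]_(q, m)) :
  col_mx (c *: A + A') (c *: B + B') = c *: col_mx A B + col_mx A' B'.
Proof. by rewrite scale_col_mx add_col_mx. Qed.

(** Cutting homomorphisms into column blocks identifies the Ringel map with a block-diagonal one;
    the two inequalities are the two directions of this identification. *)
Lemma rank_dsumr g a b (N : rep k Q g) (A : rep k Q a) (B : rep k Q b) :
  \rank (dmat N (dsum A B)) = (\rank (dmat N A) + \rank (dmat N B))%N.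
Proof.
have mul_dsum (phi : vtxmaps k g (vadd a b)) x :
    ringel_delta N (dsum A B) phi x =
    row_mx (ringel_delta N A (fun v => lsubmx (phi v : 'M_(_, a v + b v))) x)
           (ringel_delta N B (fun v => rsubmx (phi v : 'M_(_, a v + b v))) x).
  rewrite /ringel_delta /dsum.
  rewrite -[phi (qtgt Q x) in LHS](@hsubmxK _ _ (a _) (b _)).
  rewrite -[phi (qsrc Q x) in LHS](@hsubmxK _ _ (a _) (b _)).
  rewrite mul_mx_row mul_row_block !mulmx0 addr0 add0r.
  by rewrite opp_row_mx add_row_mx.
rewrite -rank_diag_block_mx; apply/eqP; rewrite eqn_leq; apply/andP; split.
  apply: (@rank_factor _ _ _ _ _ _ _
    (fun u => row_mx (encV (fun v => lsubmx (decV u v : 'M_(_, a v + b v))))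
                     (encV (fun v => rsubmx (decV u v : 'M_(_, a v + b v)))))
    (fun w => encA (e := vadd a b)
       (fun x => row_mx (decA (lsubmx w) x) (decA (rsubmx w) x)))).
  - move=> c u v; rewrite -row_mx_lin -!encV_lin; congr (row_mx (encV _) (encV _));
      by apply: functional_extensionality_dep => i; rewrite decV_lin linearP.
  - move=> c u v; rewrite -encA_lin; congr encA.
    apply: functional_extensionality_dep => x.
    by rewrite -row_mx_lin -!decA_lin !linearP.
  move=> u; rewrite dmatE mul_row_block !mulmx0 addr0 add0r row_mxKl row_mxKr.
  rewrite !dmat_enc !encAK; congr encA; apply: functional_extensionality_dep => x.
  exact: mul_dsum.
apply: (@rank_factor _ _ _ _ _ _ _
    (fun w => encV (e := vadd a b)
       (fun x => row_mx (decV (lsubmx w) x) (decV (rsubmx w) x)))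
    (fun u => row_mx (encA (fun x => lsubmx (decA u x : 'M_(_, a _ + b _))))
                     (encA (fun x => rsubmx (decA u x : 'M_(_, a _ + b _)))))).
- move=> c u v; rewrite -encV_lin; congr encV.
  apply: functional_extensionality_dep => x.
  by rewrite -row_mx_lin -!decV_lin !linearP.
- move=> c u v; rewrite -row_mx_lin -!encA_lin; congr (row_mx (encA _) (encA _));
    by apply: functional_extensionality_dep => i; rewrite decA_lin linearP.
move=> u; rewrite dmat_enc encAK -[u in LHS]hsubmxK mul_row_block !mulmx0 addr0 add0r.
rewrite !dmatE; congr (row_mx (encA _) (encA _)); apply: functional_extensionality_dep => x.
  rewrite mul_dsum row_mxKl; congr (ringel_delta N A _ x).
  by apply: functional_extensionality_dep => v; rewrite row_mxKl.
rewrite mul_dsum row_mxKr; congr (ringel_delta N B _ x).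
  by apply: functional_extensionality_dep => v; rewrite row_mxKr.
Qed.

Lemma rank_dsuml g a b (N : rep k Q g) (A : rep k Q a) (B : rep k Q b) :
  \rank (dmat (dsum A B) N) = (\rank (dmat A N) + \rank (dmat B N))%N.
Proof.
have mul_dsum (phi : vtxmaps k (vadd a b) g) x :
    ringel_delta (dsum A B) N phi x =
    col_mx (ringel_delta A N (fun v => usubmx (phi v : 'M_(a v + b v, _))) x)
           (ringel_delta B N (fun v => dsubmx (phi v : 'M_(a v + b v, _))) x).
  rewrite /ringel_delta /dsum.
  rewrite -[phi (qtgt Q x) in LHS](@vsubmxK _ (a _) (b _)).
  rewrite -[phi (qsrc Q x) in LHS](@vsubmxK _ (a _) (b _)).
  rewrite mul_block_col mul_col_mx !mul0mx addr0 add0r.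
  by rewrite opp_col_mx add_col_mx.
rewrite -rank_diag_block_mx; apply/eqP; rewrite eqn_leq; apply/andP; split.
  apply: (@rank_factor _ _ _ _ _ _ _
    (fun u => row_mx (encV (fun v => usubmx (decV u v : 'M_(a v + b v, _))))
                     (encV (fun v => dsubmx (decV u v : 'M_(a v + b v, _)))))
    (fun w => encA (d := vadd a b)
       (fun x => col_mx (decA (lsubmx w) x) (decA (rsubmx w) x)))).
  - move=> c u v; rewrite -row_mx_lin -!encV_lin; congr (row_mx (encV _) (encV _));
      by apply: functional_extensionality_dep => i; rewrite decV_lin linearP.
  - move=> c u v; rewrite -encA_lin; congr encA.
    apply: functional_extensionality_dep => x.
    by rewrite -col_mx_lin -!decA_lin !linearP.
  move=> u; rewrite dmatE mul_row_block !mulmx0 addr0 add0r row_mxKl row_mxKr.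
  rewrite !dmat_enc !encAK; congr encA; apply: functional_extensionality_dep => x.
  exact: mul_dsum.
apply: (@rank_factor _ _ _ _ _ _ _
    (fun w => encV (d := vadd a b)
       (fun x => col_mx (decV (lsubmx w) x) (decV (rsubmx w) x)))
    (fun u => row_mx (encA (fun x => usubmx (decA u x : 'M_(a _ + b _, _))))
                     (encA (fun x => dsubmx (decA u x : 'M_(a _ + b _, _)))))).
- move=> c u v; rewrite -encV_lin; congr encV.
  apply: functional_extensionality_dep => x.
  by rewrite -col_mx_lin -!decV_lin !linearP.
- move=> c u v; rewrite -row_mx_lin -!encA_lin; congr (row_mx (encA _) (encA _));
    by apply: functional_extensionality_dep => i; rewrite decA_lin linearP.
move=> u; rewrite dmat_enc encAK -[u in LHS]hsubmxK mul_row_block !mulmx0 addr0 add0r.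
rewrite !dmatE; congr (row_mx (encA _) (encA _)); apply: functional_extensionality_dep => x.
  rewrite mul_dsum col_mxKu; congr (ringel_delta A N _ x).
  by apply: functional_extensionality_dep => v; rewrite col_mxKu.
rewrite mul_dsum col_mxKd; congr (ringel_delta B N _ x).
  by apply: functional_extensionality_dep => v; rewrite col_mxKd.
Qed.

Definition rep_iso d (M M' : rep k Q d) : Prop :=
  exists g h : vtxmaps k d d,
    [/\ forall v, g v *m h v = 1%:M, forall v, h v *m g v = 1%:M &
        forall x, M' x = g (qsrc Q x) *m M x *m h (qtgt Q x)].

Lemma rep_iso_sym d (M M' : rep k Q d) : rep_iso M M' -> rep_iso M' M.
Proof.
move=> [g [h [gh hg e]]]; exists h, g; split=> // x.
by rewrite e !mulmxA hg mul1mx -mulmxA hg mulmx1.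
Qed.

Lemma rank_isor_le g d (N : rep k Q g) (M M' : rep k Q d) : rep_iso M M' ->
  (\rank (dmat N M) <= \rank (dmat N M'))%N.
Proof.
move=> [f [h [fh hf e]]]; apply: (@rank_factor _ _ _ _ _ _ _
  (fun u => encV (e := d) (fun v => decV u v *m h v))
  (fun w => encA (e := d) (fun x => decA w x *m f (qtgt Q x)))).
- move=> c u v; rewrite -encV_lin; congr encV.
  by apply: functional_extensionality_dep => i; rewrite decV_lin mulmxDl scalemxAl.
- move=> c u v; rewrite -encA_lin; congr encA.
  by apply: functional_extensionality_dep => i; rewrite decA_lin mulmxDl scalemxAl.
move=> u; rewrite dmat_enc encAK dmatE; congr encA.
apply: functional_extensionality_dep => x; rewrite /ringel_delta mulmxBl e.
rewrite -!mulmxA hf !mulmx1; congr (_ - _ *m _).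
by rewrite !mulmxA hf mul1mx.
Qed.

Lemma rank_isol_le g d (N : rep k Q g) (M M' : rep k Q d) : rep_iso M M' ->
  (\rank (dmat M N) <= \rank (dmat M' N))%N.
Proof.
move=> [f [h [fh hf e]]]; apply: (@rank_factor _ _ _ _ _ _ _
  (fun u => encV (d := d) (fun v => f v *m decV u v))
  (fun w => encA (d := d) (fun x => h (qsrc Q x) *m decA w x))).
- move=> c u v; rewrite -encV_lin; congr encV.
  by apply: functional_extensionality_dep => i; rewrite decV_lin mulmxDr scalemxAr.
- move=> c u v; rewrite -encA_lin; congr encA.
  by apply: functional_extensionality_dep => i; rewrite decA_lin mulmxDr scalemxAr.
move=> u; rewrite dmat_enc encAK dmatE; congr encA.
apply: functional_extensionality_dep => x; rewrite /ringel_delta mulmxBr e.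
rewrite !mulmxA hf !mul1mx; congr (_ *m _ - _).
by rewrite -!mulmxA hf mulmx1.
Qed.

Lemma rank_isor g d (N : rep k Q g) (M M' : rep k Q d) : rep_iso M M' ->
  \rank (dmat N M) = \rank (dmat N M').
Proof.
by move=> h; apply/eqP; rewrite eqn_leq !rank_isor_le //; apply: rep_iso_sym.
Qed.
Lemma rank_isol g d (N : rep k Q g) (M M' : rep k Q d) : rep_iso M M' ->
  \rank (dmat M N) = \rank (dmat M' N).
Proof.
by move=> h; apply/eqP; rewrite eqn_leq !rank_isol_le //; apply: rep_iso_sym.
Qed.

Hypothesis hchar : [pchar k] =i pred0.

(* A generic representation of dimension vector g computes ext against several
   fixed dimension vectors at once. *)
Lemma gext_addr g a b : (gext g (vadd a b) <= gext g a + gext g b)%N.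
Proof.
case: (rkmax_wit g a) => N1 [A hA]; case: (rkmax_wit g b) => N2 [B hB].
have [N [h1 h2]] : exists N : pt (rsp g), (rkmax g a <= \rank (dmat N A))%N /\
    (rkmax g b <= \rank (dmat N B))%N.
  apply: (@zopen_meet _ (rsp g) hchar (fun N => rkmax g a <= \rank (dmat N A))%N
    (fun N => rkmax g b <= \rank (dmat N B))%N).
  - exact: zopen_dmat_rank (@polyrep_id _) (@polyrep_const _ _ _).
  - exact: zopen_dmat_rank (@polyrep_id _) (@polyrep_const _ _ _).
  - by exists N1; rewrite hA.
  - by exists N2; rewrite hB.
have h := rkmax_le N (dsum A B); rewrite rank_dsumr in h.
rewrite -(leq_add2r (rkmax g (vadd a b))) gextE dimADr -!gextE addnACA.
by rewrite leq_add2l (leq_trans _ h) // leq_add.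
Qed.

Lemma gext_addl g a b : (gext (vadd a b) g <= gext a g + gext b g)%N.
Proof.
case: (rkmax_wit a g) => A [N1 hA]; case: (rkmax_wit b g) => B [N2 hB].
have [N [h1 h2]] : exists N : pt (rsp g), (rkmax a g <= \rank (dmat A N))%N /\
    (rkmax b g <= \rank (dmat B N))%N.
  apply: (@zopen_meet _ (rsp g) hchar (fun N => rkmax a g <= \rank (dmat A N))%N
    (fun N => rkmax b g <= \rank (dmat B N))%N).
  - exact: zopen_dmat_rank (@polyrep_const _ _ _) (@polyrep_id _).
  - exact: zopen_dmat_rank (@polyrep_const _ _ _) (@polyrep_id _).
  - by exists N1; rewrite hA.
  - by exists N2; rewrite hB.
have h := rkmax_le (dsum A B) N; rewrite rank_dsuml in h.
rewrite -(leq_add2r (rkmax (vadd a b) g)) gextE dimADl -!gextE addnACA.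
by rewrite leq_add2l (leq_trans _ h) // leq_add.
Qed.

End Dmat.

Lemma dep_choice (I : Type) (T : I -> Type) (P : forall i, T i -> Prop) :
  (forall i, exists y, P i y) -> exists f : forall i, T i, forall i, P i (f i).
Proof. by move=> h; exists (fun i => projT1 (cid (h i))) => i; case: (cid (h i)). Qed.

(** * Matrices over k[t] *)

Section PolyMx.
Variable k : fieldType.

Definition mxev p q (t : k) (F : 'M[{poly k}]_(p, q)) : 'M[k]_(p, q) :=
  map_mx (horner_eval t) F.
Definition mxC p q (F : 'M[k]_(p, q)) : 'M[{poly k}]_(p, q) := map_mx polyC F.

Lemma mxevD p q t (F G : 'M_(p, q)) : mxev t (F + G) = mxev t F + mxev t G.
Proof. exact: map_mxD. Qed.
Lemma mxevN p q t (F : 'M_(p, q)) : mxev t (- F) = - mxev t F.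
Proof. exact: map_mxN. Qed.
Lemma mxevM p q r t (F : 'M_(p, q)) (G : 'M_(q, r)) :
  mxev t (F *m G) = mxev t F *m mxev t G.
Proof. exact: map_mxM. Qed.
Lemma mxevZ p q t c (F : 'M_(p, q)) : mxev t (c *: F) = c.[t] *: mxev t F.
Proof. exact: map_mxZ. Qed.
Lemma mxevC p q t (F : 'M_(p, q)) : mxev t (mxC F) = F.
Proof. by apply/matrixP => i j; rewrite !mxE /horner_eval hornerC. Qed.
Lemma mxev1 p t : mxev t (1%:M : 'M_p) = 1%:M.
Proof. exact: map_mx1. Qed.
Lemma mxev0 p q t : mxev t (0 : 'M_(p, q)) = 0.
Proof. exact: map_mx0. Qed.
Lemma mxev_block p q r s t (A : 'M_(p, q)) (B : 'M_(p, s)) (C : 'M_(r, q)) (D : 'M_(r, s)) :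
  mxev t (block_mx A B C D) = block_mx (mxev t A) (mxev t B) (mxev t C) (mxev t D).
Proof. exact: map_block_mx. Qed.

Lemma mxev_divX p q (F : 'M[{poly k}]_(p, q)) : mxev 0 F = 0 ->
  exists F', F = 'X *: F'.
Proof.
move=> e; exists (\matrix_(i, j) (F i j %/ 'X)); apply/matrixP => i j.
rewrite !mxE mulrC divpK // -['X]subr0 -polyC0 dvdp_XsubCl /root.
by have /matrixP/(_ i j) := e; rewrite !mxE /horner_eval => ->.
Qed.

(** Isolates the terms of order one in [c], the only ones that count when a Newton correction is
    chosen. *)
Lemma expand_conj p q c (U : 'M[{poly k}]_p) (D Y : 'M_(p, q)) (U' : 'M_q) :
  (1%:M + c *: U) *m (D + c *: Y) *m (1%:M + c *: U') =
  D + c *: (U *m D + Y + D *m U' +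
            c *: (U *m Y + U *m D *m U' + Y *m U' + c *: (U *m Y *m U'))).
Proof.
rewrite !(mulmxDl, mulmxDr, mul1mx, mulmx1) -!(scalemxAl, scalemxAr) !scalerA.
move: (U *m D *m U') (U *m Y *m U') (D *m U') (Y *m U') (U *m D) (U *m Y).
move=> a1 a2 a3 a4 a5 a6; apply/matrixP => i j; rewrite !mxE; ring.
Qed.
End PolyMx.

(** * Newton lifting of a splitting and generic direct sums *)

Section Newton.
Variables (k : fieldType) (hchar : [pchar k] =i pred0).
Variables (n : nat) (Q : quiver n).
Variables (a b : 'I_n -> nat).
Notation pfam d := (fam (fun x : 'I_(narr Q) => d (qsrc Q x)) (fun x => d (qtgt Q x)) {poly k}).

(* The splitting A + B is lifted along the path P to all orders in t; at order m
   the automorphism g is corrected by unipotent block matrices, so that its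
   inverse h remains polynomial. *)
Lemma newton_split (A0 : rep k Q a) (B0 : rep k Q b) (P : pfam (vadd a b)) m :
  ext_zero A0 B0 -> ext_zero B0 A0 ->
  (forall x, mxev 0 (P x) = dsum A0 B0 x) ->
  exists (A : pfam a) (B : pfam b) (g h : forall v, 'M[{poly k}]_(a v + b v)) (E : pfam (vadd a b)),
   [/\ forall x, mxev 0 (A x) = A0 x /\ mxev 0 (B x) = B0 x,
       forall v, g v *m h v = 1%:M /\ h v *m g v = 1%:M,
       forall v, mxev 0 (g v) = 1%:M /\ mxev 0 (h v) = 1%:M &
       forall x, P x = g (qsrc Q x) *m block_mx (A x) 0 0 (B x) *m h (qtgt Q x) + 'X^(m.+1) *: E x].
Proof.
move=> eAB eBA P0; elim: m => [|m [A [B [g [h [E [hA hg hg0 hE]]]]]]].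
  have /dep_choice [E hE] : forall x, exists E',
      P x - block_mx (mxC (A0 x)) 0 0 (mxC (B0 x)) = 'X *: E'.
    move=> x; apply: mxev_divX; rewrite mxevD mxevN P0 mxev_block !mxevC !mxev0.
    by rewrite subrr.
  exists (fun x => mxC (A0 x)), (fun x => mxC (B0 x)), (fun=> 1%:M), (fun=> 1%:M), E.
  split=> [x|v|v|x]; rewrite ?mxevC ?mxev1 ?mul1mx // mulmx1 expr1 -hE addrC subrK //.
have c0 : ('X^(m.+1) : {poly k}).[0] = 0 by rewrite hornerXn expr0n.
pose c : {poly k} := 'X^(m.+1).
pose E0 x := mxev 0 (E x) : 'M_(a (qsrc Q x) + b (qsrc Q x), a (qtgt Q x) + b (qtgt Q x)).
(* The correction has to kill the off-diagonal blocks of the error at t = 0. These are two Ringel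
   equations, solvable because both Ext groups vanish; the diagonal blocks are absorbed into [A] and
   [B]. *)
have [x12 h12] := eAB (fun x => - ursubmx (E0 x)).
have [x21 h21] := eBA (fun x => - dlsubmx (E0 x)).
pose X12 v : 'M[{poly k}]_(a v + b v) := block_mx 0 (mxC (x12 v)) 0 0.
pose X21 v : 'M[{poly k}]_(a v + b v) := block_mx 0 0 (mxC (x21 v)) 0.
have n12 v : X12 v *m X12 v = 0.
  by rewrite mulmx_block !mulmx0 !mul0mx !addr0 -block_mx0 .
have n21 v : X21 v *m X21 v = 0.
  by rewrite mulmx_block !mulmx0 !mul0mx !addr0 -block_mx0 .
have inv (v : 'I_n) (Z : 'M[{poly k}]_(a v + b v)) : Z *m Z = 0 ->
    (1%:M + c *: Z) *m (1%:M - c *: Z) = 1%:M /\ (1%:M - c *: Z) *m (1%:M + c *: Z) = 1%:M.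
  move=> z; have z' : (c *: Z) *m (c *: Z) = 0.
    by rewrite -scalemxAl -scalemxAr z !scaler0.
  by split; rewrite mulmxDl mul1mx mulmxDr mulmx1 ?mulmxN ?mulNmx z' oppr0 ?addr0 ?subrK ?addrK.
(* A product of two factors, each unipotent by [n12] or [n21]; with both blocks in one factor the
   inverse need not be polynomial. *)
pose u v := (1%:M + c *: X12 v) *m (1%:M + c *: X21 v).
pose u' v := (1%:M - c *: X21 v) *m (1%:M - c *: X12 v).
have uu v : u v *m u' v = 1%:M /\ u' v *m u v = 1%:M.
  have [i1 i2] := inv v _ (n12 v); have [j1 j2] := inv v _ (n21 v).
  rewrite /u /u'; split.
    by rewrite mulmxA -(mulmxA (1%:M + _)) j1 mulmx1.
  by rewrite mulmxA -(mulmxA (1%:M - _)) i2 mulmx1.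
pose U v := X12 v + X21 v + c *: (X12 v *m X21 v).
pose U' v := - X12 v - X21 v + c *: (X21 v *m X12 v).
have uE v : u v = 1%:M + c *: U v.
  rewrite /u mulmxDl mul1mx mulmxDr mulmx1 -scalemxAl -scalemxAr /U !scalerDr scalerA.
  move: (X12 v *m X21 v) (X12 v) (X21 v) => a1 a2 a3.
  by apply/matrixP => i j; rewrite !mxE; ring.
have uE' v : u' v = 1%:M + c *: U' v.
  rewrite /u' mulmxDl mul1mx mulmxDr mulmx1 mulNmx mulmxN opprK -scalemxAl -scalemxAr /U' !scalerDr scalerA.
  move: (X21 v *m X12 v) (X12 v) (X21 v) => a1 a2 a3.
  by apply/matrixP => i j; rewrite !mxE; ring.
pose D x : 'M[{poly k}]_(a (qsrc Q x) + b (qsrc Q x), a (qtgt Q x) + b (qtgt Q x)) :=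
  block_mx (A x) 0 0 (B x).
pose Y x : 'M[{poly k}]_(a (qsrc Q x) + b (qsrc Q x), a (qtgt Q x) + b (qtgt Q x)) :=
  block_mx (mxC (ulsubmx (E0 x))) 0 0 (mxC (drsubmx (E0 x))).
pose W x := U (qsrc Q x) *m D x + Y x + D x *m U' (qtgt Q x) +
  c *: (U (qsrc Q x) *m Y x + U (qsrc Q x) *m D x *m U' (qtgt Q x) +
        Y x *m U' (qtgt Q x) + c *: (U (qsrc Q x) *m Y x *m U' (qtgt Q x))).
(* [W] satisfies u (D + c Y) u' = D + c W. Since it agrees with the old error at t = 0, the new
   error gains a power of t. *)
have W0 x : mxev 0 (W x) = mxev 0 (E x).
  have key p q (u0 : 'M_p) (d0 y0 : 'M_(p, q)) (u1 : 'M_q) (z0 : 'M_(p, q)) :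
      mxev 0 (u0 *m d0 + y0 + d0 *m u1 + c *: z0) =
      mxev 0 u0 *m mxev 0 d0 + mxev 0 y0 + mxev 0 d0 *m mxev 0 u1.
    by rewrite !(mxevD, mxevZ, mxevM) c0 scale0r addr0.
  have ev12 v : mxev 0 (X12 v) = block_mx 0 (x12 v) 0 0.
    by rewrite /X12 mxev_block !mxev0 mxevC.
  have ev21 v : mxev 0 (X21 v) = block_mx 0 0 (x21 v) 0.
    by rewrite /X21 mxev_block !mxev0 mxevC.
  have evU v : mxev 0 (U v) = block_mx 0 (x12 v) (x21 v) 0.
    rewrite /U 2!mxevD mxevZ c0 scale0r addr0 ev12 ev21 add_block_mx.
    by rewrite !addr0 !add0r.
  have evU' v : mxev 0 (U' v) = - block_mx 0 (x12 v) (x21 v) 0.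
    rewrite /U' 2!mxevD 2!mxevN mxevZ c0 scale0r addr0 ev12 ev21 -opprD add_block_mx.
    by rewrite !addr0 !add0r.
  have evD : mxev 0 (D x) = block_mx (A0 x) 0 0 (B0 x).
    by case: (hA x) => hA1 hA2; rewrite /D mxev_block !mxev0 hA1 hA2.
  rewrite /W key evU evU' evD {key}.
  rewrite mulmxN !mulmx_block !mulmx0 !mul0mx !addr0 !add0r /Y mxev_block !mxev0 !mxevC.
  rewrite opp_block_mx !add_block_mx !addr0 !add0r oppr0 !addr0.
  rewrite -/(E0 x) -[E0 x in RHS]submxK; congr block_mx.
  - by have := h12 x; rewrite /ringel_delta => /(congr1 -%R); rewrite opprK opprB.
  - by have := h21 x; rewrite /ringel_delta => /(congr1 -%R); rewrite opprK opprB.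
  - by rewrite subr0.
have /dep_choice [F hF] : forall x, exists F',
    E x - g (qsrc Q x) *m W x *m h (qtgt Q x) = 'X *: F'.
  move=> x; apply: mxev_divX; case: (hg0 (qsrc Q x)) => g1 _; case: (hg0 (qtgt Q x)) => _ h1.
  by rewrite mxevD mxevN !mxevM g1 h1 mul1mx mulmx1 W0 subrr.
exists (fun x => A x + c *: mxC (ulsubmx (E0 x))), (fun x => B x + c *: mxC (drsubmx (E0 x))).
exists (fun v => g v *m u v), (fun v => u' v *m h v), F; split=> [x|v|v|x].
- by case: (hA x) => e1 e2; rewrite !(mxevD, mxevZ) c0 !scale0r !addr0.
- case: (hg v) => e1 e2; case: (uu v) => e3 e4; split.
    by rewrite mulmxA -(mulmxA (g v)) e3 mulmx1.
  by rewrite mulmxA -(mulmxA (u' v)) e2 mulmx1.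
- case: (hg0 v) => e1 e2.
  have eu : mxev 0 (u v) = 1%:M by rewrite uE mxevD mxevZ c0 scale0r addr0 mxev1.
  have eu' : mxev 0 (u' v) = 1%:M by rewrite uE' mxevD mxevZ c0 scale0r addr0 mxev1.
  by split; rewrite mxevM ?eu ?eu' ?e1 ?e2 mulmx1.
have -> : block_mx (A x + c *: mxC (ulsubmx (E0 x))) 0 0 (B x + c *: mxC (drsubmx (E0 x))) =
    D x + c *: Y x.
  by rewrite /D /Y scale_block_mx add_block_mx !scaler0 !addr0.
have -> : g (qsrc Q x) *m u (qsrc Q x) *m (D x + c *: Y x) *m (u' (qtgt Q x) *m h (qtgt Q x)) =
    g (qsrc Q x) *m (u (qsrc Q x) *m (D x + c *: Y x) *m u' (qtgt Q x)) *m h (qtgt Q x).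
  by rewrite !mulmxA.
have -> : u (qsrc Q x) *m (D x + c *: Y x) *m u' (qtgt Q x) = D x + c *: W x.
  by rewrite uE uE' expand_conj.
rewrite hE mulmxDr mulmxDl -[block_mx _ _ _ _]/(D x) -addrA; congr (_ + _).
rewrite [in RHS]exprSr -[in RHS]scalerA -hF scalerBr -scalemxAr -scalemxAl.
by rewrite addrC subrK.
Qed.

(** Stands for the dominance of GL x Rep(a) x Rep(b) -> Rep(a + b). The line [P] from a split point
    to a point of [O] is approximated by a path [W] that splits. If [Gh W] were 0, then t^(size (Gh
    P)) would divide the nonzero polynomial [Gh P]; so [O] is met on [W]. *)
Lemma generic_dsum (O : rep k Q (vadd a b) -> Prop) (O2 : rep k Q a * rep k Q b -> Prop) :
  gext k Q a b = 0%N -> gext k Q b a = 0%N ->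
  @zopen k (rsp k Q (vadd a b)) O -> (exists M, O M) ->
  @zopen k (rsp2 k Q a b) O2 -> (exists AB, O2 AB) ->
  exists (A : rep k Q a) (B : rep k Q b),
    [/\ O2 (A, B), ext_zero A B, ext_zero B A & exists2 M, O M & rep_iso (dsum A B) M].
Proof.
move=> /gext_eq0 [A1 [B1 e1]] /gext_eq0 [B2 [A2 e2]] zO [M1 O1] zO2 nO2.
pose O3 (z : pt (rsp2 k Q a b)) := (ext_zero z.1 z.2 /\ ext_zero z.2 z.1) /\ O2 z.
have z3 : zopen O3.
  apply: zopenI => //; apply: zopenI; apply: zopen_ext_zero;
    by [apply: polyrep_fst | apply: polyrep_snd].
have [[A0 B0] O30] : exists z, O3 z.
  apply: zopen_meet => //; last first.
    apply: zopen_meet => //.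
    - apply: zopen_ext_zero; by [apply: polyrep_fst | apply: polyrep_snd].
    - apply: zopen_ext_zero; by [apply: polyrep_fst | apply: polyrep_snd].
    - by exists (A1, B1).
    - by exists (A2, B2).
  apply: zopenI; apply: zopen_ext_zero; by [apply: polyrep_fst | apply: polyrep_snd].
have [[eAB eBA] _] := O30; rewrite /= in eAB eBA.
have [G [[Gh [Gh1 Gh2]] GM1 GO]] := zO _ O1.
pose P := @pline k (rsp k Q (vadd a b)) (dsum A0 B0) M1.
have GP : Gh P != 0.
  by apply: contraNneq GM1 => e; rewrite -(@pline1 k (rsp k Q (vadd a b)) (dsum A0 B0) M1) -Gh1 -/P e horner0.
have P0 x : mxev 0 (P x) = dsum A0 B0 x.
  by have := congr1 (fun f => f x) (@pline0 k (rsp k Q (vadd a b)) (dsum A0 B0) M1).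
have [A [B [g [h [E [hA hg _ hE]]]]]] := newton_split (size (Gh P)) eAB eBA P0.
pose W : pth (rsp k Q (vadd a b)) := fun x =>
  g (qsrc Q x) *m block_mx (A x) 0 0 (B x) *m h (qtgt Q x).
have GW : Gh W != 0.
  apply: contraTneq (Gh2 (size (Gh P)) P W _) => [->|].
    by rewrite subr0; apply/negP => /(dvdp_leq GP); rewrite size_polyXn ltnn.
  move=> x i j; rewrite hE -/(W x) mxE addrAC subrr add0r mxE exprS.
  by rewrite -mulrA dvdp_mull // dvdp_mulIl.
have [f f0 fO] : exists2 f : {poly k}, f.[0] != 0 & forall t, f.[t] != 0 ->
    O3 (@pev _ (rsp2 k Q a b) (A, B) t).
  apply: zopen_path => //; have <- // : (A0, B0) = @pev _ (rsp2 k Q a b) (A, B) 0.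
  by congr pair; apply: functional_extensionality_dep => x; case: (hA x).
have /(poly_nonroot hchar) [t] : Gh W * f != 0.
  by rewrite mulf_neq0 //; apply: contraNneq f0 => ->; rewrite horner0.
rewrite hornerM mulf_eq0 negb_or Gh1 => /andP[/GO OW /fO [[/= o1 o2] o3]].
exists (fun x => mxev t (A x)), (fun x => mxev t (B x)); split=> //.
exists (pev W t) => //; exists (fun v => mxev t (g v)), (fun v => mxev t (h v)); split.
- by move=> v; case: (hg v) => e _; rewrite -mxevM e mxev1.
- by move=> v; case: (hg v) => _ e; rewrite -mxevM e mxev1.
move=> x; rewrite /= /fam_ev -/(mxev t (W x)) /W 2!mxevM mxev_block !mxev0 //.
Qed.
End Newton.

Section PolyMx2.
Variables (k : fieldType) (hchar : [pchar k] =i pred0).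

Lemma polymx_eq0 p q (F : 'M[{poly k}]_(p, q)) (g : {poly k}) : g != 0 ->
  (forall t, g.[t] != 0 -> mxev t F = 0) -> F = 0.
Proof.
move=> g0 h; apply/matrixP => i j; rewrite [RHS]mxE.
apply: (poly_eq0_nonroot hchar g0) => t /h /matrixP /(_ i j).
by rewrite !mxE.
Qed.

Lemma mxev_decomp p q (F : 'M[{poly k}]_(p, q)) :
  exists F1, F = mxC (mxev 0 F) + 'X *: F1.
Proof.
have [|F1 e] := @mxev_divX k p q (F - mxC (mxev 0 F)).
  by rewrite mxevD mxevN mxevC subrr.
by exists F1; rewrite -e addrC subrK.
Qed.

Lemma scaleX_inj p q (F : 'M[{poly k}]_(p, q)) : 'X *: F = 0 -> F = 0.
Proof.
move=> /matrixP e; apply/matrixP => i j; have /eqP := e i j; rewrite !mxE.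
by rewrite mulf_eq0 polyX_eq0 => /eqP.
Qed.
End PolyMx2.

(** * Deformation of homomorphisms along paths *)

Section Lifting.
Variables (k : fieldType) (hchar : [pchar k] =i pred0).
Variables (n : nat) (Q : quiver n).
Implicit Types a b d e : 'I_n -> nat.

(** Where the Ringel matrix has maximal rank its kernel varies polynomially. *)
Lemma hom_lift (X : pspace k) d e (M : pt X -> rep k Q d) (N : pt X -> rep k Q e)
    (p : pth X) t0 (phi : vtxmaps k d e) :
  polyrep M -> polyrep N ->
  (forall x, \rank (dmat (M x) (N x)) <=
             \rank (dmat (M (pev p t0)) (N (pev p t0))))%N ->
  is_hom (M (pev p t0)) (N (pev p t0)) phi ->
  exists (ph : forall v, 'M[{poly k}]_(d v, e v)) (f : {poly k}),
    [/\ forall v, mxev t0 (ph v) = phi v, f.[t0] != 0 &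
        forall t, f.[t] != 0 ->
          is_hom (M (pev p t)) (N (pev p t)) (fun v => mxev t (ph v))].
Proof.
move=> hM hN hr /is_homE hphi.
have [w hw [w0 [G [[Gh [G1 _]] G2 G3]]]] := kernel_lift (polymx_dmat hM hN) hr hphi.
have /dep_choice [ph hph] : forall v, exists F : 'M[{poly k}]_(d v, e v),
    forall t, mxev t F = decV (w (pev p t)) v.
  move=> v; have hv : polymx (fun x => decV (w x) v).
    by move=> i j; apply: polyfun_ext (hw 0 _) => x; rewrite mxE.
  by have [F hF] := polymx_path p hv; exists F.
exists ph, (Gh p); split=> [v||t]; rewrite ?G1 //.
  by rewrite hph w0 encVK.
move=> /G3 h; apply/is_homE.
have -> : (fun v => mxev t (ph v)) = decV (w (pev p t)).
  by apply: functional_extensionality_dep => v; rewrite hph.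
by rewrite decVK.
Qed.

Definition rep_path d (M Y : rep k Q d) : pth (rsp k Q d) :=
  fun x => mxC (M x) + 'X *: mxC (Y x).

Lemma rep_pathE d (M Y : rep k Q d) t : pev (rep_path M Y) t = fun x => M x + t *: Y x.
Proof.
apply: functional_extensionality_dep => x.
by rewrite /= /fam_ev -/(mxev t _) mxevD mxevZ !mxevC hornerX.
Qed.

(** The coefficient of t in the intertwining relation. The relation is known only where [f] does not
    vanish, which is enough for an identity of polynomials that can be divided by t. *)
Lemma hom_first_order d e (M Y : rep k Q d) (N Z : rep k Q e)
    (ph ph1 : forall v, 'M[{poly k}]_(d v, e v)) (phi : vtxmaps k d e) (f : {poly k}) :
  (forall v, ph v = mxC (phi v) + 'X *: ph1 v) -> is_hom M N phi -> f != 0 ->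
  (forall t, f.[t] != 0 -> is_hom (fun x => M x + t *: Y x : 'M_(_, _))
      (fun x => N x + t *: Z x : 'M_(_, _)) (fun v => mxev t (ph v))) ->
  forall x, M x *m mxev 0 (ph1 (qtgt Q x)) + Y x *m phi (qtgt Q x) =
            phi (qsrc Q x) *m Z x + mxev 0 (ph1 (qsrc Q x)) *m N x.
Proof.
move=> e1 h0 f0 hf x; apply/eqP; rewrite -subr_eq0; apply/eqP.
pose D := mxC (M x) *m ph1 (qtgt Q x) + mxC (Y x) *m ph (qtgt Q x) -
  (mxC (phi (qsrc Q x)) *m mxC (Z x) + ph1 (qsrc Q x) *m (mxC (N x) + 'X *: mxC (Z x))).
have D0 : D = 0.
  apply: scaleX_inj; apply: (polymx_eq0 hchar f0) => t ft.
  have E := hf t ft x; rewrite /= !e1 !(mxevD, mxevZ, mxevC, hornerX) in E.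
  rewrite mxevZ hornerX /D mxevD mxevN !(mxevD, mxevM, mxevZ, mxevC, hornerX) e1.
  rewrite !(mxevD, mxevM, mxevZ, mxevC, hornerX).
  move: E (h0 x); move: (mxev t _) (mxev t _) => p1 p2.
  rewrite !(mulmxDl, mulmxDr) -!(scalemxAl, scalemxAr) => E1 E2; rewrite E2 in E1.
  move: E1 => /eqP; rewrite -subr_eq0 => /eqP E1.
  rewrite -[RHS]E1 !(scalerDr, scalerN, scalerA).
  move: (M x *m p2) (Y x *m phi _) (phi _ *m N x) (p1 *m N x) (p1 *m Z x) (Y x *m p2) (phi _ *m Z x).
  move=> a1 a2 a3 a4 a5 a6 a7; apply/matrixP => i j; rewrite !mxE; ring.
have := congr1 (mxev 0) D0; rewrite mxev0 /D mxevD mxevN !(mxevD, mxevM, mxevZ, mxevC) e1.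
by rewrite !(mxevD, mxevZ, mxevC) hornerX !scale0r !addr0.
Qed.

(** Equivalently, dim Ext(M, M) and dim End(M) are minimal. *)
Definition rep_generic d (M : rep k Q d) : Prop := \rank (dmat M M) = srkmax k Q d.

Lemma generic_wit d : exists M : rep k Q d, rep_generic M.
Proof. exact: srkmax_wit. Qed.

Lemma zopen_generic d : @zopen k (rsp k Q d) (@rep_generic d).
Proof.
apply: zopen_ext (zopen_dmat_rank (r := srkmax k Q d) (@polyrep_id k n Q d) (@polyrep_id k n Q d)) => M.
rewrite /rep_generic; split=> [h|->//]; apply/eqP.
by rewrite eqn_leq srkmax_le.
Qed.

Lemma end_lift d (p : pth (rsp k Q d)) t0 (phi : vtxmaps k d d) :
  rep_generic (pev p t0 : rep k Q d) -> is_hom (pev p t0) (pev p t0) phi ->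
  exists (ph : forall v, 'M[{poly k}]_(d v, d v)) (f : {poly k}),
    [/\ forall v, mxev t0 (ph v) = phi v, f.[t0] != 0 &
        forall t, f.[t] != 0 -> is_hom (pev p t) (pev p t) (fun v => mxev t (ph v))].
Proof.
move=> g h; apply: (@hom_lift (rsp k Q d) _ _ id id p t0 phi) => //.
- exact: polyrep_id.
- exact: polyrep_id.
by move=> x; rewrite /= g srkmax_le.
Qed.

(* Over a generic M every endomorphism deforms along with M, so that left and
   right multiplication by it agree on Ext(M, M). *)
Lemma generic_end_central d (M : rep k Q d) phi (Y : rep k Q d) :
  rep_generic M -> is_hom M M phi ->
  exists psi : vtxmaps k d d, forall x,
    M x *m psi (qtgt Q x) + Y x *m phi (qtgt Q x) =
    phi (qsrc Q x) *m Y x + psi (qsrc Q x) *m M x.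
Proof.
move=> g h; have e0 : pev (rep_path M Y) 0 = M.
  by rewrite rep_pathE; apply: functional_extensionality_dep => x; rewrite scale0r addr0.
have [||ph [f [p0 f0 hf]]] := @end_lift d (rep_path M Y) 0 phi; rewrite ?e0 //.
have /dep_choice [ph1 hph] : forall v, exists F1, ph v = mxC (phi v) + 'X *: F1.
  by move=> v; have [F1] := mxev_decomp (ph v); rewrite p0; exists F1.
exists (fun v => mxev 0 (ph1 v)); apply: (hom_first_order hph h) (_ : f != 0) _.
  by apply: contraNneq f0 => ->; rewrite horner0.
by move=> t /hf; rewrite rep_pathE.
Qed.

(** * Additivity over ext-orthogonal sums *)

(** The inequality opposite to [gext_addr]: maximal rank against a fixed [N] is an open condition,
    so by [generic_dsum] it is attained at a direct sum, where the rank is additive. *)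
Lemma gext_sumr g a b : gext k Q a b = 0%N -> gext k Q b a = 0%N ->
  gext k Q g (vadd a b) = (gext k Q g a + gext k Q g b)%N.
Proof.
move=> ab ba; apply/eqP; rewrite eqn_leq (gext_addr Q hchar) /=.
case: (rkmax_wit k Q g (vadd a b)) => N [M0 hM0].
have [A [B [_ _ _ [M hM iM]]]] :=
  @generic_dsum k hchar n Q a b (fun M => rkmax k Q g (vadd a b) <= \rank (dmat N M))%N (fun=> True)
   ab ba (zopen_dmat_rank (@polyrep_const _ _ _ (rsp k Q _) _ N) (@polyrep_id _ _ _ _))
   (ex_intro _ M0 (eq_leq (esym hM0))) (@zopenT _ _) (ex_intro _ (rep0 k a, rep0 k b) I).
rewrite -(rank_isor N iM) rank_dsumr in hM.
have hA := rkmax_le N A; have hB := rkmax_le N B.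
have := gextE k Q g (vadd a b); have := gextE k Q g a; have := gextE k Q g b.
by rewrite dimADr; lia.
Qed.

Lemma gext_suml g a b : gext k Q a b = 0%N -> gext k Q b a = 0%N ->
  gext k Q (vadd a b) g = (gext k Q a g + gext k Q b g)%N.
Proof.
move=> ab ba; apply/eqP; rewrite eqn_leq (gext_addl Q hchar) /=.
case: (rkmax_wit k Q (vadd a b) g) => M0 [N hM0].
have [A [B [_ _ _ [M hM iM]]]] :=
  @generic_dsum k hchar n Q a b (fun M => rkmax k Q (vadd a b) g <= \rank (dmat M N))%N (fun=> True)
   ab ba (zopen_dmat_rank (@polyrep_id _ _ _ _) (@polyrep_const _ _ _ (rsp k Q _) _ N))
   (ex_intro _ M0 (eq_leq (esym hM0))) (@zopenT _ _) (ex_intro _ (rep0 k a, rep0 k b) I).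
rewrite -(rank_isol N iM) rank_dsuml in hM.
have hA := rkmax_le A N; have hB := rkmax_le B N.
have := gextE k Q (vadd a b) g; have := gextE k Q a g; have := gextE k Q b g.
by rewrite dimADl; lia.
Qed.

(** Some generic representation splits into generic summands with vanishing mixed Ext groups. *)
Lemma sext_sum a b : gext k Q a b = 0%N -> gext k Q b a = 0%N ->
  sext k Q (vadd a b) = (sext k Q a + sext k Q b)%N.
Proof.
move=> ab ba.
have [|A [B [[/= gA gB] eAB eBA [M hM iM]]]] :=
  @generic_dsum k hchar n Q a b (@rep_generic _) (fun z => rep_generic z.1 /\ rep_generic z.2)
   ab ba (@zopen_generic _) (generic_wit _)
   (zopenI (zopen_fst (@zopen_generic a)) (zopen_snd (@zopen_generic b))).
  by case: (generic_wit a) => A hA; case: (generic_wit b) => B hB; exists (A, B).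
move: hM; rewrite /rep_generic -(rank_isol M iM) -(rank_isor _ iM) rank_dsuml !rank_dsumr gA gB.
move/row_full_ext: eAB => /eqP ->; move/row_full_ext: eBA => /eqP -> hM.
have := sextE k Q (vadd a b); have := sextE k Q a; have := sextE k Q b.
by rewrite dimADl !dimADr; lia.
Qed.

Lemma gext_self_sum a b : gext k Q a b = 0%N -> gext k Q b a = 0%N ->
  gext k Q (vadd a b) (vadd a b) = (gext k Q a a + gext k Q b b)%N.
Proof. by move=> ab ba; rewrite gext_suml // !gext_sumr // ab ba addn0. Qed.

(** * Bricks *)

Definition nzv a : Prop := exists v, (0 < a v)%N.
Definition schurv a : Prop := nzv a /\ exists M : rep k Q a, end_is_k M.

Definition idV a : vtxmaps k a a := fun v => 1%:M.

Lemma is_hom_id a (M : rep k Q a) : is_hom M M (@idV a).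
Proof. by move=> x; rewrite mulmx1 mul1mx. Qed.

Lemma encV_id_neq0 a : nzv a -> encV (@idV a) != 0.
Proof.
case=> v v0; apply/eqP => /(congr1 (@decV k n a a)) /(congr1 (fun f => f v)).
rewrite encVK /decV dec0 /idV => /matrixP /(_ (Ordinal v0) (Ordinal v0)).
by rewrite !mxE eqxx => /eqP; rewrite oner_eq0.
Qed.

Lemma idV_scale a c : encV (fun v => c%:M) = c *: encV (@idV a).
Proof.
apply/rowP => l; rewrite !mxE; by case: eqP; rewrite ?mulr1n ?mulr0n ?mulr1 ?mulr0.
Qed.

Lemma end_is_kE a (M : rep k Q a) : nzv a ->
  end_is_k M <-> ((dimV a a).-1 <= \rank (dmat M M))%N.
Proof.
move=> a0; have := mxrank_ker (dmat M M); have := rank_leq_row (dmat M M).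
have hid : (encV (@idV a) <= kermx (dmat M M))%MS.
  by apply/sub_kermxP/is_homE/is_hom_id.
have r1 : \rank (encV (@idV a)) = 1%N by rewrite rank_rV encV_id_neq0.
have := mxrankS hid; rewrite r1 => h1 h2 h3.
split=> [h|h phi /is_homE hphi].
  have : (kermx (dmat M M) <= encV (@idV a))%MS.
    apply/row_subP => i; set u := row i _.
    have : u *m dmat M M = 0 by apply/sub_kermxP; rewrite row_sub.
    rewrite -[u]decVK => /is_homE /h [c hc].
    have -> : decV u = fun v => c%:M by apply: functional_extensionality_dep.
    by rewrite idV_scale scalemx_sub.
  by move=> /mxrankS; rewrite r1; lia.
have hk : (kermx (dmat M M) <= encV (@idV a))%MS.
  by rewrite -(geq_leqif (mxrank_leqif_sup hid)) r1; lia.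
have /sub_rVP [c hc] : (encV phi <= encV (@idV a))%MS.
  by apply: submx_trans hk; apply/sub_kermxP.
exists c => v; have := congr1 (@decV k n a a) hc.
by rewrite -idV_scale !encVK => ->.
Qed.

Lemma srkmax_lt a : nzv a -> (srkmax k Q a < dimV a a)%N.
Proof.
move=> a0; case: (srkmax_wit k Q a) => M <-; rewrite ltn_neqAle rank_leq_row andbT.
apply/negP => /row_free_hom h; case: a0 => v v0.
have := h _ (is_hom_id M) v; rewrite /idV => /matrixP /(_ (Ordinal v0) (Ordinal v0)).
by rewrite !mxE eqxx => /eqP; rewrite oner_eq0.
Qed.

Lemma schurvE a : schurv a <-> nzv a /\ (srkmax k Q a).+1 = dimV a a.
Proof.
split=> [[a0 [M /(end_is_kE M a0) h]]|[a0 h]]; split=> //.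
  by apply/eqP; rewrite eqn_leq srkmax_lt //=; have := srkmax_le M; lia.
by case: (srkmax_wit k Q a) => M hM; exists M; apply/end_is_kE => //; rewrite hM -h.
Qed.

Lemma zopen_brick a : nzv a -> @zopen k (rsp k Q a) (@end_is_k k n Q a).
Proof.
move=> a0; apply: zopen_ext (zopen_dmat_rank (r := (dimV a a).-1) (@polyrep_id k n Q a) (@polyrep_id k n Q a)) => M.
by split=> /(end_is_kE M a0).
Qed.

(* Otherwise the identity of a brick A would deform along every direction Y of
   the second argument, and Ext(A, A) would vanish. *)
Lemma schur_generic_hom a : schurv a -> (dimV a a <= dimA Q a a)%N ->
  rkmax k Q a a = dimV a a.
Proof.
move=> sa hd; apply/eqP; rewrite eqn_leq rkmax_dimV leqNgt; apply/negP => hlt.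
have [a0 [A bA]] := sa; have /schurvE [_ hs] := sa.
have rA : \rank (dmat A A) = srkmax k Q a.
  by apply/eqP; rewrite eqn_leq srkmax_le; move/end_is_kE: bA => /(_ a0); lia.
suff /row_full_ext : ext_zero A A.
  by rewrite /row_full rA => /eqP; move: hd hs; rewrite /dimA; lia.
move=> Y; pose Y' : rep k Q a := Y.
have e0 : pev (rep_path A Y') 0 = A.
  by rewrite rep_pathE; apply: functional_extensionality_dep => x; rewrite scale0r addr0.
(* Under [hlt] the Ringel rank never reaches [dimV a a], so the brick, of corank one in its rows, is
   a point of maximal rank among all pairs and the identity can be lifted while only the second
   argument moves. *)
have [||||ph [f [p0 f0 hf]]] := @hom_lift (rsp k Q a) a a (fun=> A) id (rep_path A Y') 0 (@idV a);
  rewrite ?e0.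
- exact: polyrep_const.
- exact: polyrep_id.
- by move=> x; rewrite /= rA; have := rkmax_le A x; lia.
- exact: is_hom_id.
have /dep_choice [ph1 hph] : forall v, exists F1, ph v = mxC (idV a v) + 'X *: F1.
  by move=> v; have [F1] := mxev_decomp (ph v); rewrite p0; exists F1.
have hfo := @hom_first_order a a A (fun=> 0) A Y' ph ph1 (@idV a) f hph (is_hom_id A).
have f1 : f != 0 by apply: contraNneq f0 => ->; rewrite horner0.
have {}hfo := hfo f1 _.
exists (fun v => mxev 0 (ph1 v)) => x; rewrite /ringel_delta.
have -> : A x *m mxev 0 (ph1 (qtgt Q x)) =
    A x *m mxev 0 (ph1 (qtgt Q x)) + 0 *m @idV a (qtgt Q x) by rewrite mul0mx addr0.
rewrite (hfo _ x) /idV ?mul1mx ?addrK // => t /hf.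
rewrite rep_pathE; have -> // : (fun x => A x + t *: 0 : 'M_(_, _)) = A.
by apply: functional_extensionality_dep => y; rewrite scaler0 addr0.
Qed.

Lemma schur_dim a : schurv a -> (dimV a a <= (dimA Q a a).+1)%N.
Proof. by move=> /schurvE [_ <-]; rewrite ltnS srkmax_dimA. Qed.

Lemma schur_real_ext a : schurv a -> dimV a a = (dimA Q a a).+1 ->
  exists A : rep k Q a, end_is_k A /\ ext_zero A A.
Proof.
move=> sa e; have /schurvE [a0 hs] := sa; case: (srkmax_wit k Q a) => A hA; exists A.
split; first by apply/end_is_kE => //; lia.
by apply/row_full_ext; rewrite /row_full hA; move: hs; rewrite e => -[->].
Qed.

Lemma schur_gext0 a : schurv a -> (dimA Q a a <= dimV a a)%N -> gext k Q a a = 0%N.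
Proof.
move=> sa h; have := schur_dim sa; rewrite leq_eqVlt => /orP[/eqP e|].
  by have [A [_ hA]] := schur_real_ext sa e; apply/gext_eq0; exists A, A.
rewrite ltnS => h'; have := gextE k Q a a; rewrite (schur_generic_hom sa h'); lia.
Qed.

Lemma schur_gext a : schurv a -> (dimV a a <= dimA Q a a)%N ->
  (gext k Q a a + dimV a a)%N = dimA Q a a.
Proof. by move=> sa h; have := gextE k Q a a; rewrite (schur_generic_hom sa h). Qed.

(** A brick has End = k, while two independent generic representations of a root with q <= 0 have no
    homomorphisms; this accounts for the extra 1. For a real root both ext numbers are 0. *)
Lemma schur_sext a : schurv a ->
  sext k Q a = (gext k Q a a + (dimV a a <= dimA Q a a))%N.
Proof.
move=> sa; have /schurvE [a0 hs] := sa; have := sextE k Q a.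
case: leqP => h; first by have := schur_gext sa h; lia.
by rewrite (schur_gext0 sa (ltnW h)); have := schur_dim sa; lia.
Qed.

(** In a nonsplit extension of Hom-orthogonal bricks an endomorphism is triangular with scalar
    diagonal blocks. If the two scalars differed, the corner block divided by their difference would
    split the class [Z]. *)
Lemma brick_extension a b (A : rep k Q a) (B : rep k Q b) :
  nzv a -> end_is_k A -> end_is_k B -> hom_zero A B -> hom_zero B A ->
  ~ ext_zero B A -> schurv (vadd a b).
Proof.
move=> a0 bA bB hAB hBA nBA; split; first by case: a0 => v v0; exists v; rewrite /vadd; lia.
have [Z nZ] : exists Z : arrmaps k Q b a, forall phi, ~ forall x, ringel_delta B A phi x = Z x.
  by apply: contrapT => h; apply: nBA => Z; apply: contrapT => h'; apply: h; exists Z => phi e; apply: h'; exists phi.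
exists (fun x => block_mx (A x) 0 (Z x) (B x)) => phi hphi.
pose p11 v := ulsubmx (phi v : 'M_(a v + b v, a v + b v)).
pose p12 v := ursubmx (phi v : 'M_(a v + b v, a v + b v)).
pose p21 v := dlsubmx (phi v : 'M_(a v + b v, a v + b v)).
pose p22 v := drsubmx (phi v : 'M_(a v + b v, a v + b v)).
have E x : [/\ A x *m p11 (qtgt Q x) = p11 (qsrc Q x) *m A x + p12 (qsrc Q x) *m Z x,
               A x *m p12 (qtgt Q x) = p12 (qsrc Q x) *m B x,
               Z x *m p11 (qtgt Q x) + B x *m p21 (qtgt Q x) =
                 p21 (qsrc Q x) *m A x + p22 (qsrc Q x) *m Z x &
               Z x *m p12 (qtgt Q x) + B x *m p22 (qtgt Q x) = p22 (qsrc Q x) *m B x].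
  have := hphi x; rewrite -[phi (qtgt Q x)](@submxK _ (a _) (b _) (a _) (b _)).
  rewrite -[phi (qsrc Q x)](@submxK _ (a _) (b _) (a _) (b _)) !mulmx_block.
  by rewrite !mul0mx !mulmx0 !addr0 !add0r => /eq_block_mx.
have z12 v : p12 v = 0 by apply: hAB => x; case: (E x).
have [c hc] : exists c, forall v, p11 v = c%:M.
  by apply: bA => x; case: (E x) => -> _ _ _; rewrite z12 mul0mx addr0.
have [c' hc'] : exists c, forall v, p22 v = c%:M.
  by apply: bB => x; case: (E x) => _ _ _ <-; rewrite z12 mulmx0 add0r.
have ecc : c = c'.
  apply/eqP; rewrite -subr_eq0; apply/negP => /negP cc.
  apply: (nZ (fun v => - (c - c')^-1 *: p21 v)) => x.
  rewrite /ringel_delta -scalemxAl -scalemxAr -scalerBr scaleNr -scalerN opprB.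
  case: (E x) => _ _ + _; rewrite hc hc' mul_mx_scalar mul_scalar_mx => e3.
  have -> : p21 (qsrc Q x) *m A x - B x *m p21 (qtgt Q x) = (c - c') *: Z x.
    by rewrite scalerBl; apply/eqP; rewrite subr_eq addrAC e3 addrK.
  by rewrite scalerA mulVf ?scale1r.
have z21 v : p21 v = 0.
  apply: hBA => x; case: (E x) => _ _ + _; rewrite hc hc' mul_mx_scalar mul_scalar_mx ecc.
  by rewrite addrC => /addIr.
exists c => v; rewrite -[phi v](@submxK _ (a v) (b v) (a v) (b v)).
rewrite -/(p11 v) -/(p12 v) -/(p21 v) -/(p22 v) z12 z21 hc hc' ecc.
by rewrite -scalar_mx_block.
Qed.

Definition vmul m a : 'I_n -> nat := fun v => (m * a v)%N.

Lemma vmulS m a : vmul m.+1 a = vadd a (vmul m a).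
Proof. by []. Qed.

Lemma dimV_mulr m g a : dimV g (vmul m a) = (m * dimV g a)%N.
Proof. by rewrite !dimVE big_distrr; apply: eq_bigr => i _; rewrite /vmul /= mulnCA. Qed.
Lemma dimV_mull m g a : dimV (vmul m a) g = (m * dimV a g)%N.
Proof. by rewrite !dimVE big_distrr; apply: eq_bigr => i _; rewrite /vmul /= mulnA. Qed.
Lemma dimA_mulr m g a : dimA Q g (vmul m a) = (m * dimA Q g a)%N.
Proof. by rewrite !dimAE big_distrr; apply: eq_bigr => i _; rewrite /vmul /= mulnCA. Qed.
Lemma dimA_mull m g a : dimA Q (vmul m a) g = (m * dimA Q a g)%N.
Proof. by rewrite !dimAE big_distrr; apply: eq_bigr => i _; rewrite /vmul /= mulnA. Qed.

Lemma gext_vmulr m g a : (gext k Q g (vmul m a) <= m * gext k Q g a)%N.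
Proof.
elim: m => [|m IH]; last first.
  by rewrite vmulS mulSn (leq_trans (gext_addr Q hchar _ _ _)) // leq_add2l.
by have := gextE k Q g (vmul 0 a); rewrite dimA_mulr; lia.
Qed.
Lemma gext_vmull m g a : (gext k Q (vmul m a) g <= m * gext k Q a g)%N.
Proof.
elim: m => [|m IH]; last first.
  by rewrite vmulS mulSn (leq_trans (gext_addl Q hchar _ _ _)) // leq_add2l.
by have := gextE k Q (vmul 0 a) g; rewrite dimA_mull; lia.
Qed.

(** Induction on m. Bricks of types a and m a can be chosen Hom-orthogonal, since [gext] between
    them is at most m times [gext k Q a a]; negativity of the Euler form then forces a nonsplit
    extension. *)
Lemma schur_vmul m a : schurv a -> (dimV a a < dimA Q a a)%N -> (0 < m)%N ->
  schurv (vmul m a).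
Proof.
move=> sa hq; have he := schur_gext sa (ltnW hq); have [a0 nA] := sa.
case: m => // m _; elim: m => [|m IH].
  by have -> // : vmul 1 a = a; apply: functional_extensionality_dep => v; rewrite /vmul mul1n.
rewrite vmulS; have [b0 nB] := IH.
have [[A B] /= [[bA bB] [hAB hBA]]] : exists z : pt (rsp2 k Q a (vmul m.+1 a)),
    (end_is_k z.1 /\ end_is_k z.2) /\ (hom_zero z.1 z.2 /\ hom_zero z.2 z.1).
  apply: zopen_meet => //.
  - by apply: zopenI; [apply: zopen_fst; apply: zopen_brick | apply: zopen_snd; apply: zopen_brick].
  - by apply: zopenI; apply: zopen_hom_zero; by [apply: polyrep_fst | apply: polyrep_snd].
  - by case: nA nB => A hA [B hB]; exists (A, B).
  apply: zopen_meet => //.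
  - by apply: zopen_hom_zero; by [apply: polyrep_fst | apply: polyrep_snd].
  - by apply: zopen_hom_zero; by [apply: polyrep_fst | apply: polyrep_snd].
  - have [A [B h]] := rkmax_wit k Q a (vmul m.+1 a); exists (A, B).
    apply/row_free_hom; rewrite /row_free h /= eqn_leq rkmax_dimV /=.
    have := gextE k Q a (vmul m.+1 a); have := gext_vmulr m.+1 a a.
    by rewrite dimV_mulr dimA_mulr -he mulnDr; lia.
  have [B [A h]] := rkmax_wit k Q (vmul m.+1 a) a; exists (A, B).
  apply/row_free_hom; rewrite /row_free h /= eqn_leq rkmax_dimV /=.
  have := gextE k Q (vmul m.+1 a) a; have := gext_vmull m.+1 a a.
  by rewrite dimV_mull dimA_mull -he mulnDr; lia.
apply: (brick_extension a0 bA bB hAB hBA) => /row_full_ext h.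
have := rank_leq_row (dmat B A); move/eqP: h => ->.
by rewrite -/(dimA Q _ _) -/(dimV _ _) dimV_mull dimA_mull leq_mul2l /= leqNgt hq.
Qed.

End Lifting.

(** * Spectral decomposition of endomorphisms *)

Section Crt.
Variables (k : fieldType) (N : nat).

Definition pw (c : k) : {poly k} := ('X - c%:P) ^+ N.

Lemma coprime_pw c c' : c != c' -> coprimep (pw c) (pw c').
Proof.
by move=> h; apply/coprimep_expl/coprimep_expr/coprimep_XsubC2; rewrite subr_eq0 eq_sym.
Qed.

Lemma coprime_pw_prod c (s : seq k) : c \notin s -> coprimep (pw c) (\prod_(d <- s) pw d).
Proof.
elim: s => [|d s IH]; first by rewrite big_nil coprimep1.
rewrite inE negb_or big_cons => /andP[cd /IH h].
by rewrite coprimepMr coprime_pw.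
Qed.

Lemma dvdp_pw_prod (s : seq k) (p : {poly k}) : uniq s ->
  (forall c, c \in s -> pw c %| p) -> \prod_(c <- s) pw c %| p.
Proof.
elim: s => [|c s IH] /=; first by rewrite big_nil dvd1p.
move=> /andP[cs us] h; rewrite big_cons Gauss_dvdp ?coprime_pw_prod //.
by rewrite h ?mem_head //= IH // => d ds; apply: h; rewrite inE ds orbT.
Qed.

Lemma dvdp_count_pw (s r : seq k) : N = size r ->
  \prod_(c <- s) ('X - c%:P) ^+ count_mem c r %| \prod_(c <- s) pw c.
Proof.
move=> eN; elim: s => [|c s IH]; rewrite ?big_nil ?dvdpp // !big_cons.
by apply: dvdp_mul => //; apply: dvdp_exp2l; rewrite eN count_size.
Qed.

(** Chinese remainders: evaluated at an endomorphism, [q c] becomes the projection to the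
    generalized eigenspace of c, by one polynomial for all vertices. *)
Lemma crt_idempotents (s : seq k) : uniq s -> exists q : k -> {poly k},
  forall c, c \in s -> pw c %| 1 - q c /\
    forall d, d \in s -> d != c -> pw d %| q c.
Proof.
move=> us; suff /choice [q hq] : forall c, exists r : {poly k}, c \in s ->
    pw c %| 1 - r /\ forall d, d \in s -> d != c -> pw d %| r by exists q.
move=> c; case cs: (c \in s); last by exists 0.
have /Bezout_eq1_coprimepP [[u w] /= e] : coprimep (pw c) (\prod_(d <- rem c s) pw d).
  by apply: coprime_pw_prod; rewrite mem_rem_uniqF.
exists (w * \prod_(d <- rem c s) pw d) => _; split.
  have -> : 1 - w * (\prod_(d <- rem c s) pw d) = u * pw c by apply/eqP; rewrite subr_eq e.
  exact: dvdp_mull.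
move=> d ds dc; apply: dvdp_mull; rewrite (big_rem d) ?dvdp_mulr //=.
by rewrite mem_rem_uniq // inE dc.
Qed.
End Crt.

Section Idempotent.
Variable F : fieldType.

Lemma idem_base m (A : 'M[F]_m) : A *m A = A -> row_base A *m col_base A = 1%:M.
Proof.
move=> e; move: (row_base_free A) (col_base_full A) (mulmx_base A).
move: (row_base A) (col_base A) => R C fR fC CR.
apply: (row_free_inj fR); rewrite mul1mx; apply: (row_full_inj fC).
by rewrite !mulmxA -[LHS]mulmxA !CR.
Qed.

Lemma idem_split m (A : 'M[F]_m) : A *m A = A ->
  exists (P : 'M[F]_(m, \rank A)) (R : 'M[F]_(\rank A, m)),
    [/\ R *m P = 1%:M, P *m R = A, A *m P = P & R *m A = R].
Proof.
move=> e; have := mulmx_base A; have := idem_base e.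
move: (row_base A) (col_base A) => R C RC CR; exists C, R.
have h1 : C *m R *m C = C by rewrite -mulmxA RC mulmx1.
have h2 : R *m (C *m R) = R by rewrite mulmxA RC mul1mx.
by rewrite CR in h1 h2.
Qed.

Lemma tr_idem m (A : 'M[F]_m) : A *m A = A -> \tr A = (\rank A)%:R.
Proof. by move=> e; rewrite -{1}(mulmx_base A) mxtrace_mulC idem_base // mxtrace1. Qed.
End Idempotent.

Section Hmx.
Variable k : closedFieldType.

(* [horner_mx] is only defined in positive dimension. *)
Definition hmx m : 'M[k]_m -> {poly k} -> 'M[k]_m :=
  match m with 0 => fun _ _ => 0 | m'.+1 => fun A p => horner_mx A p end.

Lemma mx0_eq (A B : 'M[k]_0) : A = B. Proof. by apply/matrixP => -[]. Qed.

Lemma hmxD m (A : 'M_m) p q : hmx A (p + q) = hmx A p + hmx A q.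
Proof. by case: m A => [|m] A; [apply: mx0_eq | rewrite /= rmorphD]. Qed.
Lemma hmxB m (A : 'M_m) p q : hmx A (p - q) = hmx A p - hmx A q.
Proof. by case: m A => [|m] A; [apply: mx0_eq | rewrite /= rmorphB]. Qed.
Lemma hmxM m (A : 'M_m) p q : hmx A (p * q) = hmx A p *m hmx A q.
Proof. by case: m A => [|m] A; [apply: mx0_eq | rewrite /= rmorphM]. Qed.
Lemma hmxC m (A : 'M_m) c : hmx A c%:P = c%:M.
Proof. by case: m A => [|m] A; [apply: mx0_eq | rewrite /= horner_mx_C]. Qed.
Lemma hmx1 m (A : 'M_m) : hmx A 1 = 1%:M. Proof. exact: (hmxC A 1). Qed.
Lemma hmx0 m (A : 'M_m) : hmx A 0 = 0.
Proof. by rewrite -polyC0 hmxC raddf0. Qed.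
Lemma hmxX m (A : 'M_m) : hmx A 'X = A.
Proof. by case: m A => [|m] A; [apply: mx0_eq | rewrite /= horner_mx_X]. Qed.
Lemma hmx_sum m (A : 'M_m) (I : Type) (r : seq I) (F : I -> {poly k}) :
  hmx A (\sum_(i <- r) F i) = \sum_(i <- r) hmx A (F i).
Proof. by elim: r => [|i r IH]; rewrite ?big_nil ?hmx0 // !big_cons hmxD IH. Qed.

Lemma hmx_char_poly m (A : 'M_m) p : char_poly A %| p -> hmx A p = 0.
Proof.
case: m A => [|m] A; first by move=> _; apply: mx0_eq.
by move=> /dvdpP [q ->]; rewrite hmxM /= Cayley_Hamilton mulmx0.
Qed.

Lemma hmx_commute m m' (A : 'M_m) (B : 'M_m') (M : 'M_(m, m')) p :
  M *m B = A *m M -> M *m hmx B p = hmx A p *m M.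
Proof.
move=> e; elim/poly_ind: p => [|p c IH]; first by rewrite !hmx0 mulmx0 mul0mx.
rewrite !hmxD !hmxM !hmxX !hmxC mulmxDr mulmxDl !mulmxA IH.
by rewrite -!mulmxA e scalar_mxC.
Qed.

Lemma hmx_eigen m (A : 'M_m) (x : 'rV_m) c p : x *m A = c *: x -> x *m hmx A p = p.[c] *: x.
Proof.
move=> e; elim/poly_ind: p => [|p d IH]; first by rewrite hmx0 mulmx0 horner0 scale0r.
rewrite hmxD hmxM hmxX hmxC mulmxDr mulmxA IH -scalemxAl e mul_mx_scalar.
by rewrite scalerA hornerD hornerM hornerX hornerC scalerDl.
Qed.

Lemma root_char_eigen m (A : 'M[k]_m) c : root (char_poly A) c ->
  exists2 x : 'rV_m, x *m A = c *: x & x != 0.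
Proof. by rewrite -eigenvalue_root_char => /eigenvalueP. Qed.

Lemma tr_nilpotent m (A : 'M[k]_m) N : hmx A ('X ^+ N) = 0 -> \tr A = 0.
Proof.
case: m A => [|m] A nA; first by rewrite /mxtrace big_ord0.
have [r er] := closed_field_poly_normal (char_poly A).
rewrite (monicP (char_poly_monic A)) scale1r in er.
have r0 c : c \in r -> c = 0.
  move=> cr; have : root (char_poly A) c by rewrite er root_prod_XsubC.
  case/root_char_eigen => x xA x0; have := hmx_eigen ('X ^+ N) xA.
  rewrite nA mulmx0 hornerXn => /esym/eqP; rewrite scaler_eq0 (negPf x0) orbF.
  by rewrite expf_eq0 => /andP[_ /eqP].
have e : char_poly A = 'X ^+ (size r).
  rewrite er; elim: r r0 {er} => [|c r IH] h; first by rewrite big_nil.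
  rewrite big_cons IH => [|d dr]; last by apply: h; rewrite inE dr orbT.
  by rewrite (h c) ?mem_head // subr0 exprS.
have := size_char_poly A; rewrite e size_polyXn => -[sr].
have := char_poly_trace A (ltn0Sn m); rewrite e coefXn sr /= ltn_eqF // => /eqP.
by rewrite eq_sym oppr_eq0 => /eqP.
Qed.

End Hmx.

Section Spectral.
Variables (k : closedFieldType) (hchar : [pchar k] =i pred0).
Variables (n : nat) (Q : quiver n).
Implicit Types a b d e : 'I_n -> nat.

(** The spectral projections are polynomials in [phi], hence endomorphisms of M, and
    [generic_end_central] applied to them makes the eigenspaces ext-orthogonal. The value [e c v] is
    the multiplicity of c at v. *)
Lemma spectral_split d (M : rep k Q d) (phi : vtxmaps k d d) :
  rep_generic M -> is_hom M M phi ->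
  exists (cs : seq k) (e : k -> 'I_n -> nat) (N : nat),
    [/\ uniq cs, forall c, c \in cs -> nzv (e c),
        forall c c', c \in cs -> c' \in cs -> c != c' -> gext k Q (e c) (e c') = 0%N,
        forall v m, \tr (hmx (phi v) ('X ^+ m)) = \sum_(c <- cs) (e c v)%:R * c ^+ m &
        forall v p, (forall c, c \in cs -> pw N c %| p) -> hmx (phi v) p = 0].
Proof.
move=> gM hphi; pose P := \prod_(v < n) char_poly (phi v).
have mP : P \is monic by apply: monic_prod => v _; apply: char_poly_monic.
have [r er] := closed_field_poly_normal P; rewrite (monicP mP) scale1r in er.
(* All eigenvalues at all vertices are collected; [N] counts them with multiplicity, so no
   multiplicity exceeds it. *)
pose cs := undup r; pose N := size r; have ucs : uniq cs by apply: undup_uniq.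
have [q hq] := crt_idempotents N ucs.
have ann v p : (forall c, c \in cs -> pw N c %| p) -> hmx (phi v) p = 0.
  move=> /(dvdp_pw_prod ucs) h; apply: hmx_char_poly; apply: dvdp_trans h.
  apply: (@dvdp_trans _ P); first by rewrite /P (bigD1 v) //= dvdp_mulr.
  rewrite er -(prodr_undup_exp_count r xpredT (fun z => 'X - z%:P)) -/cs.
  exact: dvdp_count_pw.
pose E c v := hmx (phi v) (q c).
have N0 c : c \in cs -> (0 < N)%N by rewrite mem_undup /N; case: r {er cs N ucs q hq ann E}.
have dq c c' : c \in cs -> c' \in cs -> pw N c %| (c == c')%:R - q c'.
  move=> hc hc'; case: eqVneq => [->|ne]; first by case: (hq c' hc').
  by rewrite sub0r dvdpNr; case: (hq c' hc') => _; apply.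
have EE c c' v : c \in cs -> c' \in cs -> c != c' -> E c v *m E c' v = 0.
  move=> hc hc' ne; rewrite -hmxM; apply: ann => z hz.
  have [->|dc] := eqVneq z c; last first.
    by apply: dvdp_mulr; case: (hq c hc) => _; apply.
  by apply: dvdp_mull; case: (hq c' hc') => _; apply.
have E1 v : \sum_(c <- cs) E c v = 1%:M.
  rewrite -hmx_sum; apply/esym/eqP; rewrite -subr_eq0 -(hmx1 (phi v)) -hmxB; apply/eqP.
  apply: ann => z hz; rewrite (big_rem z) //= opprD addrA; apply: dvdp_sub.
    by case: (hq z hz).
  have : {subset rem z cs <= predI (mem cs) (predC1 z)}.
    by move=> c; rewrite mem_rem_uniq // !inE => /andP[-> ->].
  elim: (rem z cs) => [|c s IH] hs; first by rewrite big_nil dvdp0.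
  rewrite big_cons dvdp_add //; last by apply: IH => x xs; apply: hs; rewrite inE xs orbT.
  by have := hs c (mem_head _ _); rewrite !inE => /andP[hc dc]; case: (hq c hc) => _; apply; rewrite // eq_sym.
have EI c v : c \in cs -> E c v *m E c v = E c v.
  move=> hc; rewrite -[RHS]mulmx1 -(E1 v) (big_rem c) //= mulmxDr mulmx_sumr.
  rewrite big_seq big1 ?addr0 // => z; rewrite mem_rem_uniq // inE => /andP[dc hd].
  by rewrite EE // eq_sym.
have Ehom c x : M x *m E c (qtgt Q x) = E c (qsrc Q x) *m M x.
  by apply: hmx_commute; apply: hphi.
pose e c v := \rank (E c v).
exists cs, e, N; split=> //.
- move=> c hc; have : root P c by rewrite er root_prod_XsubC -mem_undup.
  rewrite /P /root horner_prod => /prodf_eq0 [v _ /root_char_eigen [x hx x0]].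
  exists v; rewrite lt0n mxrank_eq0; apply: contraNneq x0 => Ec.
  have := hmx_eigen (q c) hx; rewrite -/(E c v) Ec mulmx0.
  have -> : (q c).[c] = 1.
    have := dq c c hc hc; rewrite eqxx => h.
    have : root (1 - q c) c.
      rewrite -dvdp_XsubCl; apply: dvdp_trans h; rewrite /pw -{1}['X - _]expr1.
      by apply: dvdp_exp2l; apply: N0 hc.
    by rewrite /root hornerD hornerN hornerC subr_eq0 => /eqP.
  by rewrite scale1r => <-.
- move=> c c' hc hc' ne.
  have /dep_choice [P1 /dep_choice [R1 h1]] := fun v => idem_split (EI c v hc).
  have /dep_choice [P2 /dep_choice [R2 h2]] := fun v => idem_split (EI c' v hc').
  pose A1 : rep k Q (e c) := fun x => R1 _ *m M x *m P1 _.
  pose A2 : rep k Q (e c') := fun x => R2 _ *m M x *m P2 _.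
  apply/gext_eq0; exists A1, A2 => Z.
  (* A cocycle [Z] becomes a direction [Y] at M. After compression by [R1] and [P2] the centrality
     relation for [E c'] keeps [Y *m E c'] as [Z] and loses [E c' *m Y], because the projections are
     orthogonal. *)
  pose Y : rep k Q d := fun x => P1 _ *m Z x *m R2 _.
  have [psi hpsi] := generic_end_central hchar Y gM (Ehom c').
  exists (fun v => - (R1 v *m psi v *m P2 v)) => x.
  have := congr1 (fun F => R1 (qsrc Q x) *m F *m P2 (qtgt Q x)) (hpsi x).
  have PR1 v : P1 v *m R1 v = E c v by case: (h1 v).
  have PR2 v : P2 v *m R2 v = E c' v by case: (h2 v).
  have [RP1 _ EP1 RE1] := h1 (qsrc Q x); have [RP2 _ EP2 RE2] := h2 (qtgt Q x).
  rewrite !mulmxDr !mulmxDl /ringel_delta mulmxN mulNmx opprK.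
  have -> : R1 (qsrc Q x) *m (Y x *m E c' (qtgt Q x)) *m P2 (qtgt Q x) = Z x.
    by rewrite /Y !mulmxA RP1 mul1mx -!mulmxA EP2 RP2 mulmx1.
  have -> : R1 (qsrc Q x) *m (E c' (qsrc Q x) *m Y x) = 0.
    by rewrite mulmxA -RE1 -(mulmxA _ (E c _)) EE // mulmx0 mul0mx.
  rewrite mul0mx add0r => hZ.
  have -> : A1 x *m (R1 (qtgt Q x) *m psi (qtgt Q x) *m P2 (qtgt Q x)) =
      R1 (qsrc Q x) *m (M x *m psi (qtgt Q x)) *m P2 (qtgt Q x).
    rewrite /A1 -!mulmxA (mulmxA (P1 _) (R1 _)) PR1 (mulmxA (M x) (E c _)) Ehom.
    by rewrite !mulmxA RE1.
  have -> : R1 (qsrc Q x) *m psi (qsrc Q x) *m P2 (qsrc Q x) *m A2 x =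
      R1 (qsrc Q x) *m (psi (qsrc Q x) *m M x) *m P2 (qtgt Q x).
    rewrite /A2 -!mulmxA (mulmxA (P2 _) (R2 _)) PR2 (mulmxA (E c' _) (M x)) -Ehom.
    by rewrite -!mulmxA EP2.
  by rewrite -hZ addKr.
move=> v m; rewrite -[hmx _ _]mulmx1 -(E1 v) mulmx_sumr raddf_sum /=.
apply: eq_big_seq => c hc; rewrite /E -hmxM.
(* On the summand of c the m-th power is the scalar c^m plus a nilpotent map, which has trace 0. *)
have -> : 'X^m * q c = (c ^+ m)%:P * q c + ('X^m - (c ^+ m)%:P) * q c.
  by rewrite mulrBl addrC subrK.
rewrite hmxD mxtraceD hmxM hmxC mul_scalar_mx mxtraceZ -/(E c v) tr_idem ?EI //.
rewrite [X in _ + X](@tr_nilpotent _ _ _ N) ?addr0 1?mulrC //.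
have hX j (F : 'M[k]_(d v)) p : F = hmx (phi v) p -> hmx F ('X^j) = hmx (phi v) (p ^+ j).
  move=> ->; elim: j => [|j IH]; first by rewrite !expr0 !hmx1.
  by rewrite !exprS !hmxM hmxX IH.
rewrite (hX N _ _ erefl); apply: ann => c' hc'; rewrite exprMn.
have [->|ne] := eqVneq c' c.
  apply: dvdp_mull; apply: dvdp_exp2r; rewrite dvdp_XsubCl /root.
  by rewrite hornerD hornerN hornerXn hornerC subrr.
apply: dvdp_mulr; case: (hq c hc) => _ /(_ c' hc' ne) h; apply: dvdp_trans h _.
by rewrite -{1}[q c]expr1; apply: dvdp_exp2l; apply: N0 hc.
Qed.

End Spectral.

(** * Matrices of constant rank; coordinates on kernel and image *)

Section RankLemmas.
Variables (k : fieldType) (hchar : [pchar k] =i pred0).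

Lemma rank_semicont p q (F : 'M[{poly k}]_(p, q)) t0 :
  exists2 g : {poly k}, g.[t0] != 0 &
    forall t, g.[t] != 0 -> (\rank (mxev t0 F) <= \rank (mxev t F))%N.
Proof.
case: (fullrank_sandwich (leqnn (\rank (mxev t0 F)))) => L [R LR].
have e t : (\det (mxC L *m F *m mxC R)).[t] = \det (L *m mxev t F *m R).
  rewrite -[LHS]/(horner_eval t _) -det_map_mx; congr (\det _).
  by rewrite -[LHS]/(mxev t _) !mxevM !mxevC.
exists (\det (mxC L *m F *m mxC R)); first by rewrite e LR det1 oner_neq0.
move=> t; rewrite e => d0.
have u : L *m mxev t F *m R \in unitmx by rewrite unitmxE unitfE.
rewrite -(mxrank_unit u); apply: leq_trans (mxrankM_maxl _ _) _; exact: mxrankM_maxr.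
Qed.

(** Skeleton identity: for a rank factorization A = P J both [L *m P] and [J *m R] are invertible
    and cancel. *)
Lemma rank_factor_inv p q r (A : 'M[k]_(p, q)) (L : 'M_(r, p)) (R : 'M_(q, r)) :
  r = \rank A -> L *m A *m R \in unitmx -> A *m R *m invmx (L *m A *m R) *m L *m A = A.
Proof.
move=> er; have [P [J <-]] : exists (P : 'M_(p, r)) (J : 'M_(r, q)), P *m J = A.
  by rewrite er; exists (col_base A), (row_base A); rewrite mulmx_base.
move=> u; have {}u : (L *m P) *m (J *m R) \in unitmx by rewrite !mulmxA in u *.
have [u1 u2] : L *m P \in unitmx /\ J *m R \in unitmx by apply/andP; rewrite -unitmx_mul.
rewrite -!mulmxA; congr (P *m _); rewrite !mulmxA.
have -> : L *m P *m J *m R = (L *m P) *m (J *m R) by rewrite !mulmxA.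
have -> : invmx (L *m P *m (J *m R)) = invmx (J *m R) *m invmx (L *m P).
  have h : (invmx (J *m R) *m invmx (L *m P)) *m (L *m P *m (J *m R)) = 1%:M.
    by rewrite -mulmxA (mulmxA (invmx (L *m P))) mulVmx // mul1mx mulVmx.
  by apply: (can_inj (mulmxK u)); rewrite mulVmx // h.
transitivity ((J *m R *m invmx (J *m R)) *m (invmx (L *m P) *m (L *m P)) *m J).
  by rewrite !mulmxA.
by rewrite mulmxV // mulVmx // !mul1mx.
Qed.

(* The conclusion says that A1 maps ker A0 into im A0 at t = 0. *)
Lemma rank_first_order p q (A0 : 'M[k]_(p, q)) (A1 : 'M[{poly k}]_(p, q)) (g : {poly k}) :
  g != 0 ->
  (forall t, g.[t] != 0 -> (\rank (mxev t (mxC A0 + 'X *: A1)%R) <= \rank A0)%N) ->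
  kermx A0 *m mxev 0 A1 *m cokermx A0 = 0.
Proof.
move=> g0 hr; pose A := mxC A0 + 'X *: A1.
case: (fullrank_sandwich (leqnn (\rank A0))) => L [R LR].
pose D := mxC L *m A *m mxC R.
have D0 : (\det D).[0] = 1.
  rewrite -[LHS]/(horner_eval 0 _) -det_map_mx -[map_mx _ _]/(mxev 0 _) /D !mxevM !mxevC.
  by rewrite /A mxevD mxevC mxevZ hornerX scale0r addr0 LR det1.
have dD0 : \det D != 0 by apply: contra_eq_neq D0 => ->; rewrite horner0 eq_sym oner_neq0.
(* This is the skeleton identity for A(t), cleared of its denominator, restricted to the kernel and
   cokernel of [A0], and divided by t. At t = 0 only the first term survives, with determinant 1. *)
pose S := \det D *: (mxC (kermx A0) *m A1 *m mxC (cokermx A0)) -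
  'X *: (mxC (kermx A0) *m A1 *m mxC R *m \adj D *m mxC L *m A1 *m mxC (cokermx A0)).
have S0 : S = 0.
  apply: scaleX_inj; apply: (polymx_eq0 hchar (g := g * \det D)); first by rewrite mulf_neq0.
  move=> t; rewrite hornerM mulf_eq0 negb_or => /andP[/hr hrt dt].
  set At := mxev t A in hrt.
  have eD : mxev t D = L *m At *m R by rewrite /D !mxevM !mxevC.
  have udt : L *m At *m R \in unitmx.
    by rewrite unitmxE unitfE -eD /mxev det_map_mx.
  have rkAt : \rank At = \rank A0.
    apply/eqP; rewrite eqn_leq hrt /= -(mxrank_unit udt).
    by apply: leq_trans (mxrankM_maxl _ _) (mxrankM_maxr _ _).
  have KA : kermx A0 *m At = t *: (kermx A0 *m mxev t A1).
    by rewrite /At /A mxevD mxevZ mxevC hornerX mulmxDr mulmx_ker add0r scalemxAr.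
  have AK : At *m cokermx A0 = t *: (mxev t A1 *m cokermx A0).
    by rewrite /At /A mxevD mxevZ mxevC hornerX mulmxDl mulmx_coker add0r scalemxAl.
  have fac : At *m R *m \adj (L *m At *m R) *m L *m At = \det (L *m At *m R) *: At.
    have h := rank_factor_inv (esym rkAt) udt.
    transitivity (\det (L *m At *m R) *: (At *m R *m invmx (L *m At *m R) *m L *m At)).
      rewrite /invmx udt -!(scalemxAl, scalemxAr) scalerA mulfV ?scale1r //.
      by rewrite -unitfE -unitmxE.
    by rewrite h.
  have eadj : mxev t (\adj D) = \adj (L *m At *m R) by rewrite -eD /mxev map_mx_adj.
  have edet : (\det D).[t] = \det (L *m At *m R).
    by rewrite -eD /mxev det_map_mx.
  rewrite mxevZ hornerX /S mxevD mxevN !mxevZ !mxevM !mxevC eadj edet hornerX scalerBr !scalerA.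
  apply/eqP; rewrite subr_eq0; apply/eqP.
  have := congr1 (fun F => kermx A0 *m F *m cokermx A0) fac.
  have -> : kermx A0 *m (At *m R *m \adj (L *m At *m R) *m L *m At) *m cokermx A0 =
      (kermx A0 *m At) *m R *m \adj (L *m At *m R) *m L *m (At *m cokermx A0).
    by rewrite !mulmxA.
  have -> : kermx A0 *m (\det (L *m At *m R) *: At) *m cokermx A0 =
      \det (L *m At *m R) *: (kermx A0 *m (At *m cokermx A0)).
    by rewrite -scalemxAr -scalemxAl mulmxA.
  rewrite AK KA -!(scalemxAl, scalemxAr) !scalerA !mulmxA => ->.
  by rewrite mulrC.
have := congr1 (mxev 0) S0; rewrite mxev0 /S mxevD mxevN !mxevZ hornerX scale0r subr0 D0 scale1r.
by rewrite !mxevM !mxevC.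
Qed.

(** Coordinates: [B] is a basis of the kernel, [P *m J] factors A through its image, and [R] maps
    onto the cokernel. The sizes enter through equations so that prescribed dimension vectors can be
    used at all vertices at once. *)
Lemma ker_im_split m (A : 'M[k]_m) (r i : nat) : r = \rank (kermx A) -> i = \rank A ->
  exists (B : 'M_(r, m)) (B' : 'M_(m, r)) (P : 'M_(m, i)) (P' : 'M_(i, m))
    (J : 'M_(i, m)) (J' : 'M_(m, i)) (R : 'M_(m, r)) (R' : 'M_(r, m)),
    [/\ [/\ B *m B' = 1%:M, P' *m P = 1%:M, J *m J' = 1%:M & R' *m R = 1%:M],
        [/\ P *m J = A, B *m A = 0 & A *m R = 0],
        forall p (x : 'M_(p, m)), x *m A = 0 -> exists y, x = y *m B,
        forall p (x : 'M_(m, p)), A *m x = 0 -> exists y, x = R *m y &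
        (exists y, B = y *m kermx A) /\ (exists y, R = cokermx A *m y)].
Proof.
have er : \rank (cokermx A) = \rank (kermx A) by rewrite mxrank_coker mxrank_ker.
have [B' hB'] := row_freeP (row_base_free (kermx A)).
have [P' hP'] := row_fullP (col_base_full A).
have [J' hJ'] := row_freeP (row_base_free A).
have := col_base_full (cokermx A); have := mulmx_base (cokermx A).
move: (row_base (cokermx A)) (col_base (cokermx A)); rewrite er => JR R eR fR.
have [R' hR'] := row_fullP fR.
move=> -> ->; exists (row_base (kermx A)), B', (col_base A), P', (row_base A), J', R, R'.
have [JR' hJR] : exists JR', JR *m JR' = 1%:M.
  apply/row_freeP; rewrite /row_free eqn_leq rank_leq_row /= -{1}er -eR.
  exact: mxrankM_maxr.
have eR' : R = cokermx A *m JR' by rewrite -eR -mulmxA hJR mulmx1.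
have [X eX] : exists y, row_base (kermx A) = y *m kermx A.
  by apply/submxP; rewrite eq_row_base.
split=> //.
- split; first exact: mulmx_base.
    by rewrite eX -mulmxA mulmx_ker mulmx0.
  by rewrite eR' mulmxA mulmx_coker mul0mx.
- move=> p x /sub_kermxP; rewrite -(eq_row_base (kermx A)) => /submxP [y ->]; by exists y.
- move=> p x hx; exists (JR *m row_ebase A *m x).
  rewrite !mulmxA eR; have -> : cokermx A *m row_ebase A = 1%:M - pinvmx A *m A.
    have gen (C U : 'M[k]_m) rk : (rk <= m)%N -> C \in unitmx -> C *m pid_mx rk *m U = A ->
        invmx U *m (pid_mx rk : 'M_m) *m invmx C *m A = invmx U *m (pid_mx rk : 'M_m) *m U.
      move=> hrk uC <-; rewrite !mulmxA mulmxKV // -(mulmxA (invmx U) (pid_mx rk)) mul_pid_mx.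
      by rewrite minnn (minn_idPr hrk).
    rewrite /cokermx /pinvmx (gen _ _ _ (rank_leq_row A) (col_ebase_unit A) (mulmx_ebase A)).
    by rewrite /copid_mx mulmxBr mulmx1 mulmxBl mulVmx ?row_ebase_unit.
  rewrite mulmxBl mul1mx -mulmxA hx mulmx0 subr0 //.
by split; [exists X | exists JR'].
Qed.
End RankLemmas.

(** * Splitting a dimension vector that is not a Schur root *)

Section Split.
Variables (k : closedFieldType) (hchar : [pchar k] =i pred0).
Variables (n : nat) (Q : quiver n).
Implicit Types a b d e : 'I_n -> nat.

(* With K = ker phi and I = im phi, the first-order deformations of (M, phi)
   give Ext(K, M/K) = 0 and Ext(I, M/I) = 0, where dim M/K = dim I and
   dim M/I = dim K. *)
Lemma ker_im_ext d (M : rep k Q d) (phi : vtxmaps k d d) kk ii :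
  (forall v, kk v = \rank (kermx (phi v))) -> (forall v, ii v = \rank (phi v)) ->
  is_hom M M phi ->
  (forall Y : rep k Q d, exists psi : vtxmaps k d d,
     (forall x, M x *m psi (qtgt Q x) + Y x *m phi (qtgt Q x) =
                phi (qsrc Q x) *m Y x + psi (qsrc Q x) *m M x) /\
     (forall v, kermx (phi v) *m psi v *m cokermx (phi v) = 0)) ->
  gext k Q kk ii = 0%N /\ gext k Q ii kk = 0%N.
Proof.
move=> ekk eii hphi hY.
have /dep_choice [B /dep_choice [B' /dep_choice [P /dep_choice [P' /dep_choice [J
  /dep_choice [J' /dep_choice [R /dep_choice [R' H]]]]]]]] :=
  fun v => ker_im_split (ekk v) (eii v).
have BB' v : B v *m B' v = 1%:M by case: (H v) => -[].
have PP' v : P' v *m P v = 1%:M by case: (H v) => -[].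
have JJ' v : J v *m J' v = 1%:M by case: (H v) => -[].
have RR' v : R' v *m R v = 1%:M by case: (H v) => -[].
have PJ v : P v *m J v = phi v by case: (H v) => _ [].
have Bp v : B v *m phi v = 0 by case: (H v) => _ [].
have pR v : phi v *m R v = 0 by case: (H v) => _ [].
have kl v p (x : 'M_(p, _)) : x *m phi v = 0 -> exists y, x = y *m B v.
  by case: (H v) => _ _ h _ _; apply: h.
have kr v p (x : 'M_(_, p)) : phi v *m x = 0 -> exists y, x = R v *m y.
  by case: (H v) => _ _ _ h _; apply: h.
have BR v (psi : 'M_(d v)) : kermx (phi v) *m psi *m cokermx (phi v) = 0 -> B v *m psi *m R v = 0.
  move=> h; case: (H v) => _ _ _ _ [[y ->] [z ->]].
  by rewrite mulmxA -!(mulmxA y) h mul0mx mulmx0.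
(* The representations on ker phi, on im phi (isomorphic to M / ker phi) and on M / im phi. *)
pose NK : rep k Q kk := fun x => B _ *m M x *m B' _.
pose NI : rep k Q ii := fun x => P' _ *m M x *m P _.
pose NQ : rep k Q kk := fun x => R' _ *m M x *m R _.
have eK x : B _ *m M x = NK x *m B _.
  have [y ey] : exists y, B (qsrc Q x) *m M x = y *m B (qtgt Q x).
    by apply: kl; rewrite -mulmxA hphi mulmxA Bp mul0mx.
  by rewrite /NK ey -(mulmxA y) BB' mulmx1.
have eJ x : J _ *m M x = NI x *m J _.
  rewrite /NI -!mulmxA PJ hphi -PJ !mulmxA PP' mul1mx //.
have eP x : M x *m P _ = P _ *m NI x.
  have h : M x *m P (qtgt Q x) *m J (qtgt Q x) = P (qsrc Q x) *m NI x *m J (qtgt Q x).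
    by rewrite -(mulmxA (P _)) -eJ -mulmxA PJ hphi -PJ mulmxA.
  by rewrite -[LHS]mulmx1 -(JJ' (qtgt Q x)) mulmxA h -mulmxA JJ' mulmx1.
have eR x : M x *m R _ = R _ *m NQ x.
  have [y ey] : exists y, M x *m R (qtgt Q x) = R (qsrc Q x) *m y.
    by apply: kr; rewrite mulmxA -hphi -mulmxA pR mulmx0.
  by rewrite /NQ -mulmxA ey (mulmxA (R' _)) RR' mul1mx.
split; apply/gext_eq0.
  exists NK, NI => Z.
  have [psi [e1 e2]] := hY (fun x => B' _ *m Z x *m P' _).
  (* The rank condition says that [psi] maps the kernel into the image, so [B *m psi] factors
     through [J]. *)
  have eC v : B v *m psi v = B v *m psi v *m J' v *m J v.
    have [y ey] : exists y, 1%:M - J' v *m J v = R v *m y.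
      by apply: kr; rewrite mulmxBr mulmx1 -PJ mulmxA -(mulmxA _ (J v)) JJ' mulmx1 subrr.
    apply/eqP; rewrite -subr_eq0 -mulmxA -{1}[B v *m psi v]mulmx1 -mulmxBr ey.
    by rewrite mulmxA BR // mul0mx.
  exists (fun v => - (B v *m psi v *m J' v)) => x; rewrite /ringel_delta mulmxN mulNmx opprK.
  have := congr1 (fun F => B (qsrc Q x) *m F *m J' (qtgt Q x)) (e1 x).
  rewrite !mulmxDr !mulmxDl (mulmxA _ (phi _)) Bp mul0mx mul0mx add0r.
  have -> : B (qsrc Q x) *m (B' (qsrc Q x) *m Z x *m P' (qtgt Q x) *m phi (qtgt Q x)) *m J' (qtgt Q x) = Z x.
    by rewrite !mulmxA BB' mul1mx -PJ !mulmxA -(mulmxA (Z x)) PP' mulmx1 -mulmxA JJ' mulmx1.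
  have -> : B (qsrc Q x) *m (M x *m psi (qtgt Q x)) *m J' (qtgt Q x) =
      NK x *m (B (qtgt Q x) *m psi (qtgt Q x) *m J' (qtgt Q x)).
    by rewrite mulmxA eK !mulmxA.
  have -> : B (qsrc Q x) *m (psi (qsrc Q x) *m M x) *m J' (qtgt Q x) =
      B (qsrc Q x) *m psi (qsrc Q x) *m J' (qsrc Q x) *m NI x.
    rewrite mulmxA [in LHS]eC -(mulmxA _ (J _) (M x)) eJ !mulmxA -[LHS]mulmxA JJ' mulmx1 //.
  by move=> <-; rewrite addrA addNr add0r.
exists NI, NQ => Z.
have [psi [e1 e2]] := hY (fun x => J' _ *m Z x *m R' _).
have eS v : psi v *m R v = P v *m (P' v *m psi v *m R v).
  have [y ey] : exists y, 1%:M - P v *m P' v = y *m B v.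
    by apply: kl; rewrite mulmxBl mul1mx -PJ mulmxA -(mulmxA (P v)) PP' mulmx1 subrr.
  have : (1%:M - P v *m P' v) *m (psi v *m R v) = 0.
    by rewrite ey -mulmxA (mulmxA (B v)) BR // mulmx0.
  by rewrite mulmxBl mul1mx => /eqP; rewrite subr_eq0 => /eqP {1}->; rewrite !mulmxA.
exists (fun v => P' v *m psi v *m R v) => x; rewrite /ringel_delta.
have := congr1 (fun F => P' (qsrc Q x) *m F *m R (qtgt Q x)) (e1 x).
rewrite !mulmxDr !mulmxDl.
have -> : P' (qsrc Q x) *m (J' (qsrc Q x) *m Z x *m R' (qtgt Q x) *m phi (qtgt Q x)) *m R (qtgt Q x) = 0.
  by rewrite -!mulmxA pR !mulmx0.
rewrite addr0.
have -> : P' (qsrc Q x) *m (phi (qsrc Q x) *m (J' (qsrc Q x) *m Z x *m R' (qtgt Q x))) *m R (qtgt Q x) = Z x.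
  by rewrite -PJ !mulmxA PP' mul1mx JJ' mul1mx -mulmxA RR' mulmx1.
have -> : P' (qsrc Q x) *m (M x *m psi (qtgt Q x)) *m R (qtgt Q x) =
    NI x *m (P' (qtgt Q x) *m psi (qtgt Q x) *m R (qtgt Q x)).
  rewrite mulmxA -(mulmxA _ (psi _)) [in LHS]eS mulmxA //.
have -> : P' (qsrc Q x) *m (psi (qsrc Q x) *m M x) *m R (qtgt Q x) =
    P' (qsrc Q x) *m psi (qsrc Q x) *m R (qsrc Q x) *m NQ x.
  by rewrite -!mulmxA eR.
by move=> ->; rewrite addrK.
Qed.

End Split.

Section Split2.
Variables (k : closedFieldType) (hchar : [pchar k] =i pred0).
Variables (n : nat) (Q : quiver n).
Implicit Types a b d e : 'I_n -> nat.

Definition ttr d (phi : vtxmaps k d d) : k := \sum_v \tr (phi v).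

Lemma hom_add_scalar d (M : rep k Q d) (phi : vtxmaps k d d) c :
  is_hom M M phi -> is_hom M M (fun v => phi v - c%:M).
Proof. by move=> h x; rewrite mulmxBr mulmxBl h scalar_mxC. Qed.

Lemma ttr_sub_scalar d (phi : vtxmaps k d d) c :
  ttr (fun v => phi v - c%:M) = ttr phi - c * (\sum_v d v)%:R.
Proof.
rewrite /ttr natr_sum mulr_sumr -sumrB; apply: eq_bigr => v _.
by rewrite raddfB /= mxtrace_scalar mulr_natr.
Qed.

Lemma total_dim_gt0 d : nzv d -> (0 < \sum_v d v)%N.
Proof. by case=> v hv; rewrite (bigD1 v) //= addn_gt0 hv. Qed.

(* The case where every traceless endomorphism of every generic M is nilpotent:
   a nonzero one of maximal rank has constant rank along deformations. *)
Lemma nilpotent_split d : nzv d -> ~ schurv k Q d ->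
  (forall (M : rep k Q d) phi, rep_generic M -> is_hom M M phi -> ttr phi = 0 ->
     exists N, forall v, hmx (phi v) ('X ^+ N) = 0) ->
  exists a b, [/\ nzv a, nzv b, d = vadd a b, gext k Q a b = 0%N & gext k Q b a = 0%N].
Proof.
move=> d0 nsd hnil; have D0 := natr_neq0 hchar (total_dim_gt0 d0).
pose D : k := (\sum_v d v)%:R.
pose S r := `[< exists (M : rep k Q d) (phi : vtxmaps k d d),
  [/\ rep_generic M, is_hom M M phi, ttr phi = 0, exists v, phi v != 0 &
      (\sum_v \rank (phi v))%N = r] >].
have Sub r : S r -> (r <= \sum_v d v)%N.
  by move=> /asboolP [M [phi [_ _ _ _ <-]]]; apply: leq_sum => v _; apply: rank_leq_row.
have Sex : exists r, S r.
  have [M gM] := generic_wit k Q d.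
  have [phi0 [h0 n0]] : exists phi0, is_hom M M phi0 /\ ~ exists c : k, forall i, phi0 i = c%:M.
    apply: contrapT => h; apply: nsd; split=> //; exists M => phi hp; apply: contrapT => h'.
    by apply: h; exists phi.
  pose phi v := phi0 v - (ttr phi0 / D)%:M.
  exists (\sum_v \rank (phi v))%N; apply/asboolP; exists M, phi; split=> //.
  - exact: hom_add_scalar.
  - by rewrite ttr_sub_scalar divfK ?subrr.
  apply: contrapT => h; apply: n0; exists (ttr phi0 / D) => v.
  by apply/eqP; rewrite -subr_eq0; apply: contraT => hv; case: h; exists v.
have [rho /asboolP [M [phi [gM hphi tphi [v0 nphi] erho]]] rmax] := ex_maxnP Sex Sub.
pose kk v := \rank (kermx (phi v)); pose ii v := \rank (phi v).
have [||||e1 e2] := @ker_im_ext k n Q d M phi kk ii => //.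
  move=> Y; pose p := rep_path M Y.
  have p0 : pev p 0 = M.
    by rewrite rep_pathE; apply: functional_extensionality_dep => x; rewrite scale0r addr0.
  have [||ph0 [f [hph0 f0 hf]]] := @end_lift k n Q d p 0 phi; rewrite ?p0 //.
  (* Subtracting the normalized trace keeps the lift traceless, hence a competitor for the maximal
     rank [rho]. *)
  pose ct : {poly k} := (D^-1)%:P * \sum_v \tr (ph0 v).
  pose ph v := ph0 v - ct%:M.
  have ctE t : ct.[t] = ttr (fun v => mxev t (ph0 v)) / D.
    rewrite hornerM hornerC mulrC horner_sum; congr (_ / _); apply: eq_bigr => v _.
    by rewrite /mxev trace_map_mx.
  have phE t v : mxev t (ph v) = mxev t (ph0 v) - (ttr (fun v => mxev t (ph0 v)) / D)%:M.
    rewrite mxevD mxevN; congr (_ - _); rewrite -ctE.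
    by apply/matrixP => i j; rewrite !mxE /horner_eval hornerMn.
  have hph v : mxev 0 (ph v) = phi v.
    have e : ttr (fun v => mxev 0 (ph0 v)) = 0.
      by rewrite -[RHS]tphi; apply: eq_bigr => w _; rewrite hph0.
    by rewrite phE e mul0r hph0 raddf0 subr0.
  have hhom t : f.[t] != 0 -> is_hom (pev p t) (pev p t) (fun v => mxev t (ph v)).
    move=> /hf h; have -> : (fun v => mxev t (ph v)) =
      (fun v => mxev t (ph0 v) - (ttr (fun v => mxev t (ph0 v)) / D)%:M).
      by apply: functional_extensionality_dep => v; rewrite phE.
    exact: hom_add_scalar.
  have htr t : ttr (fun v => mxev t (ph v)) = 0.
    rewrite -[LHS]/(ttr _); have -> : (fun v => mxev t (ph v)) =
      (fun v => mxev t (ph0 v) - (ttr (fun v => mxev t (ph0 v)) / D)%:M).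
      by apply: functional_extensionality_dep => v; rewrite phE.
    by rewrite ttr_sub_scalar divfK ?subrr.
  have [f2 f20 hf2] : exists2 f2 : {poly k}, f2.[0] != 0 &
      forall t, f2.[t] != 0 -> rep_generic (pev p t : rep k Q d).
    by apply: (zopen_path (@zopen_generic k n Q d)); rewrite p0.
  have /choice [g hg] : forall v, exists g : {poly k}, g.[0] != 0 /\
      forall t, g.[t] != 0 -> (\rank (phi v) <= \rank (mxev t (ph v)))%N.
    by move=> v; have [g g0 hg] := rank_semicont (ph v) 0; exists g; rewrite -hph.
  pose F := f * f2 * \prod_v g v.
  have F0 : F != 0.
    have : F.[0] != 0.
      rewrite !hornerM !mulf_neq0 // horner_prod; apply/prodf_neq0 => v _.
      by case: (hg v).
    by apply: contraNneq => ->; rewrite horner0.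
  have hF t : F.[t] != 0 -> [/\ f.[t] != 0, f2.[t] != 0 & forall v, (g v).[t] != 0].
    rewrite !hornerM !mulf_eq0 !negb_or horner_prod => /andP[/andP[-> ->] /prodf_neq0 h].
    by split=> // v; apply: h.
  (* No rank drops near t = 0 and the total cannot exceed [rho], so the rank is constant at each
     vertex separately. *)
  have rkE t v : F.[t] != 0 -> (\rank (mxev t (ph v)) <= \rank (phi v))%N.
    move=> /hF [ft f2t gt].
    have hle w : (\rank (phi w) <= \rank (mxev t (ph w)))%N.
      by case: (hg w) => _; apply; apply: gt.
    have : (\sum_w \rank (mxev t (ph w)) <= rho)%N.
      apply: rmax; apply/asboolP; exists (pev p t), (fun w => mxev t (ph w)); split=> //.
      - exact: hf2.
      - exact: hhom.
      exists v0; rewrite -mxrank_eq0 -lt0n (leq_trans _ (hle v0)) //.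
      by rewrite lt0n mxrank_eq0.
    rewrite -erho (bigD1 v) //= [X in (_ <= X)%N](bigD1 v) //=.
    have : (\sum_(w | w != v) \rank (phi w) <= \sum_(w | w != v) \rank (mxev t (ph w)))%N.
      by apply: leq_sum.
    by move=> h1 h2; have := leq_trans (leq_add (leqnn _) h1) h2; rewrite leq_add2r.
  have /dep_choice [ph1 hph1] : forall v, exists F1, ph v = mxC (phi v) + 'X *: F1.
    by move=> v; have [F1] := mxev_decomp (ph v); rewrite hph; exists F1.
  exists (fun v => mxev 0 (ph1 v)); split.
    apply: (hom_first_order hchar hph1 hphi (f := f)).
      by apply: contraNneq f0 => ->; rewrite horner0.
    by move=> t /hhom; rewrite rep_pathE.
  move=> v; apply: (rank_first_order hchar F0) => t /(rkE t v).
  by rewrite hph1.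
exists kk, ii; split=> //.
- have [N hN] := hnil _ _ gM hphi tphi; have [v hv] := d0; exists v.
  rewrite /kk lt0n mxrank_eq0; apply/negP => /eqP h.
  have fr : row_free (phi v) by rewrite -kermx_eq0 h.
  have : hmx (phi v) ('X ^+ N) = 0 by [].
  elim: N {hN} => [|N IH].
    rewrite hmx1 => /matrixP /(_ (Ordinal hv) (Ordinal hv)) /eqP.
    by rewrite !mxE eqxx oner_eq0.
  rewrite exprSr hmxM hmxX => e; apply: IH; apply: (row_free_inj fr).
  by rewrite /= mul0mx.
- by exists v0; rewrite /ii lt0n mxrank_eq0.
by apply: functional_extensionality_dep => v; rewrite /vadd /kk /ii mxrank_ker subnK ?rank_leq_row.
Qed.

(** * Lists of dimension vectors *)

Definition dvec := {ffun 'I_n -> nat}.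
Definition vsum (s : seq dvec) : 'I_n -> nat := fun v => (\sum_(x <- s) x v)%N.

Lemma vsum_nil : vsum [::] = fun=> 0%N.
Proof. by apply: functional_extensionality_dep => v; rewrite /vsum big_nil. Qed.
Lemma vsum_cons x s : vsum (x :: s) = vadd x (vsum s).
Proof. by apply: functional_extensionality_dep => v; rewrite /vsum big_cons. Qed.
Lemma vsum_cat s t : vsum (s ++ t) = vadd (vsum s) (vsum t).
Proof. by apply: functional_extensionality_dep => v; rewrite /vsum big_cat. Qed.
Lemma vsum_perm s t : perm_eq s t -> vsum s = vsum t.
Proof. by move=> h; apply: functional_extensionality_dep => v; apply: perm_big. Qed.
Lemma vsum_nseq m x : vsum (nseq m x) = vmul m x.
Proof.
elim: m => [|m IH]; first by rewrite vsum_nil.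
by rewrite /= vsum_cons IH.
Qed.

Definition orth (x y : dvec) : bool := (gext k Q x y == 0%N) && (gext k Q y x == 0%N).

Lemma orth_sym : symmetric orth. Proof. by move=> x y; rewrite /orth andbC. Qed.

Lemma gext0l g : gext k Q (fun=> 0%N) g = 0%N.
Proof.
have := gextE k Q (fun=> 0%N) g; rewrite dimAE big1 => [|i _]; last by rewrite mul0n.
by lia.
Qed.
Lemma gext0r g : gext k Q g (fun=> 0%N) = 0%N.
Proof.
have := gextE k Q g (fun=> 0%N); rewrite dimAE big1 => [|i _]; last by rewrite muln0.
by lia.
Qed.

Lemma gext_vsumr g s : (gext k Q g (vsum s) <= \sum_(x <- s) gext k Q g x)%N.
Proof.
elim: s => [|x s IH]; first by rewrite big_nil vsum_nil gext0r.
by rewrite vsum_cons big_cons (leq_trans (gext_addr Q hchar _ _ _)) // leq_add2l.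
Qed.
Lemma gext_vsuml g s : (gext k Q (vsum s) g <= \sum_(x <- s) gext k Q x g)%N.
Proof.
elim: s => [|x s IH]; first by rewrite big_nil vsum_nil gext0l.
by rewrite vsum_cons big_cons (leq_trans (gext_addl Q hchar _ _ _)) // leq_add2l.
Qed.

Lemma orth_vsum x s : all (orth x) s -> gext k Q x (vsum s) = 0%N /\ gext k Q (vsum s) x = 0%N.
Proof.
move=> /allP h; split; apply/eqP; rewrite -leqn0.
  rewrite (leq_trans (gext_vsumr _ _)) // big_seq big1 // => y /h /andP[/eqP -> _] //.
rewrite (leq_trans (gext_vsuml _ _)) // big_seq big1 // => y /h /andP[_ /eqP ->] //.
Qed.

Lemma gext_vsumrE g s : pairwise orth s ->
  gext k Q g (vsum s) = (\sum_(x <- s) gext k Q g x)%N.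
Proof.
elim: s => [|x s IH]; first by rewrite big_nil vsum_nil gext0r.
rewrite pairwise_cons => /andP[/orth_vsum [h1 h2] /IH e].
by rewrite vsum_cons big_cons -e gext_sumr.
Qed.
Lemma gext_vsumlE g s : pairwise orth s ->
  gext k Q (vsum s) g = (\sum_(x <- s) gext k Q x g)%N.
Proof.
elim: s => [|x s IH]; first by rewrite big_nil vsum_nil gext0l.
rewrite pairwise_cons => /andP[/orth_vsum [h1 h2] /IH e].
by rewrite vsum_cons big_cons -e gext_suml.
Qed.

(** Multiplicities are repetitions, and equal entries are compared too: a root with ext(x, x) > 0
    can occur only once. *)
Definition vdec (s : seq dvec) : Prop :=
  (forall x, x \in s -> schurv k Q x) /\ pairwise orth s.

Lemma schur_split d : nzv d -> ~ schurv k Q d ->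
  exists a b, [/\ nzv a, nzv b, d = vadd a b, gext k Q a b = 0%N & gext k Q b a = 0%N].
Proof.
(* The negated goal is kept as [hn]: an endomorphism with two eigenvalues would contradict it, so
   the nilpotency hypothesis of [nilpotent_split] can be checked. *)
move=> d0 nsd; apply: contrapT => hn; apply: (hn); apply: nilpotent_split => // M phi gM hphi tphi.
have [cs [e [N [ucs e0 eorth etr enil]]]] := spectral_split hchar gM hphi.
have ed v : d v = (\sum_(c <- cs) e c v)%N.
  have E0 := etr v 0%N; rewrite expr0 hmx1 mxtrace1 in E0.
  apply: (natr_inj_char0 hchar); rewrite /= E0 natr_sum.
  by apply: eq_bigr => c _; rewrite expr0 mulr1.
case: cs ucs e0 eorth etr enil ed => [|c [|c' cs]] ucs e0 eorth etr enil ed.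
- by case: d0 => v; rewrite ed big_nil.
- exists N => v; apply: enil => c1; rewrite inE => /eqP ->.
  (* With a single eigenvalue c the trace is c times the total dimension, which is nonzero in k. *)
  suff -> : c = 0 by rewrite /pw subr0 dvdpp.
  apply/eqP; have := tphi; rewrite /ttr.
  rewrite (eq_bigr (fun v' => (e c v')%:R * c)); last first.
    by move=> v' _; rewrite -[phi v']hmxX -['X]expr1 etr big_seq1 expr1.
  rewrite -mulr_suml -natr_sum => /eqP; rewrite mulf_eq0 => /orP[|//].
  move=> h; suff : (\sum_v' e c v')%:R != 0 :> k by rewrite h.
  apply: natr_neq0 => //; apply: total_dim_gt0; exact: e0 (mem_head _ _).
case: hn; pose s := [seq [ffun v => e z v] | z <- c' :: cs] : seq dvec.
have hs z : ([ffun v => e z v] : dvec) = e z :> ('I_n -> nat).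
  by apply: functional_extensionality_dep => v; rewrite ffunE.
have [h1 h2] : gext k Q (e c) (vsum s) = 0%N /\ gext k Q (vsum s) (e c) = 0%N.
  have := @orth_vsum [ffun v => e c v] s; rewrite hs; apply.
  apply/allP => y /mapP [z hz ->]; rewrite /orth !hs; move: ucs => /= /andP[cz _].
  have ne : c != z by apply: contraNneq cz => ->.
  by rewrite !eorth ?inE ?eqxx ?hz ?orbT // 1?eq_sym // -in_cons hz orbT.
exists (e c), (vsum s); split=> //; first exact: e0 (mem_head _ _).
  have [|v hv] := e0 c'; first by rewrite !inE eqxx orbT.
  exists v.
  by rewrite /s /= vsum_cons /vadd ffunE addn_gt0 hv.
apply: functional_extensionality_dep => v.
rewrite ed big_cons /vadd /vsum big_map; congr (_ + _)%N.
by apply: eq_bigr => z _; rewrite ffunE.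
Qed.

(** Additivity writes ext(a, b) = 0 as a sum of the ext numbers between members of s and t, so each
    of them vanishes. *)
Lemma decomp_refine a b (s t : seq dvec) :
  gext k Q a b = 0%N -> gext k Q b a = 0%N -> vdec s -> vdec t -> vsum s = a -> vsum t = b ->
  vdec (s ++ t).
Proof.
move=> ab ba [s1 s2] [t1 t2] es et; split.
  by move=> x; rewrite mem_cat => /orP[/s1|/t1].
rewrite pairwise_cat s2 t2 !andbT; apply/allrelP => x y xs yt.
have key (p q : seq dvec) z w : pairwise orth p -> pairwise orth q -> z \in p -> w \in q ->
    gext k Q (vsum p) (vsum q) = 0%N -> gext k Q z w = 0%N.
  move=> pp pq zp wq; rewrite gext_vsumlE // => /eqP; rewrite sum_nat_seq_eq0 => /allP /(_ z zp) /=.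
  by rewrite gext_vsumrE // sum_nat_seq_eq0 => /allP /(_ w wq) /= /eqP.
by rewrite /orth !(key s t x y, key t s y x) ?es ?et.
Qed.

Lemma decomp_exists d : exists2 s, vdec s & vsum s = d.
Proof.
have [m] := ubnP (\sum_v d v)%N; elim: m d => // m IH d hd.
have [d0|nd] := pselect (nzv d); last first.
  exists [::]; first by split.
  rewrite vsum_nil; apply: functional_extensionality_dep => v; apply/eqP.
  by rewrite eq_sym -leqn0 leqNgt; apply/negP => h; apply: nd; exists v.
have [sd|nsd] := pselect (schurv k Q d).
  have e : ([ffun v => d v] : dvec) = d :> ('I_n -> nat).
    by apply: functional_extensionality_dep => v; rewrite ffunE.
  exists [:: [ffun v => d v]].
    by split=> // x; rewrite inE => /eqP ->; rewrite e.
  by rewrite vsum_cons vsum_nil e; apply: functional_extensionality_dep => v; rewrite /vadd addn0.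
have [a [b [a0 b0 eab ab ba]]] := schur_split d0 nsd.
have ha := total_dim_gt0 a0; have hb := total_dim_gt0 b0.
have hs : (\sum_v d v = \sum_v a v + \sum_v b v)%N by rewrite eab -big_split.
have [|s ds es] := IH a; first by lia.
have [|t dt et] := IH b; first by lia.
exists (s ++ t); last by rewrite vsum_cat es et eab.
exact: decomp_refine ab ba ds dt es et.
Qed.

End Split2.

(** * Real Schur roots in a decomposition *)

Section Real.
Variables (k : closedFieldType) (hchar : [pchar k] =i pred0).
Variables (n : nat) (Q : quiver n).
Implicit Types a b d e : 'I_n -> nat.
Notation schurv := (schurv k Q).
Notation vdec := (vdec k Q).
Notation orth := (orth k Q).

(** For a matrix of full column rank the formula det(L C) u - u C adj(L C) L gives kernel vectors at
    every point, with no exceptional locus. *)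
Lemma full_kernel_lift (X : pspace k) p q (C : pt X -> 'M[k]_(p, q)) x0 (u : 'rV[k]_p) :
  polymx C -> row_full (C x0) -> u *m C x0 = 0 ->
  exists w : pt X -> 'rV[k]_p, [/\ polymx w, w x0 = u & forall x, w x *m C x = 0].
Proof.
move=> hC /row_fullP [L hL] hu; pose D x := L *m C x.
have hD : polymx D by apply: polymxM => //; apply: polymx_const.
exists (fun x => \det (D x) *: u - u *m C x *m \adj (D x) *m L); split.
- apply: polymxD; first by apply: polymxZ; [apply: polyfun_det | apply: polymx_const].
  apply: polymxN; apply: polymxM; last exact: polymx_const.
  by apply: polymxM; [apply: polymxM => //; apply: polymx_const | apply: polymx_adj].
- by rewrite /D hL det1 scale1r hu !mul0mx subr0.
move=> x; rewrite mulmxBl -scalemxAl -(mulmxA _ L) -/(D x) -(mulmxA _ (\adj _)).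
by rewrite mul_adj_mx mul_mx_scalar subrr.
Qed.

Section WithA.
Variables (a : 'I_n -> nat) (A : rep k Q a).

(* An open form of "A is a direct summand of M". *)
Definition summand d (M : rep k Q d) : Prop :=
  (ext_zero A M /\ ext_zero M A) /\
  exists (f : vtxmaps k a d) (g : vtxmaps k d a),
    [/\ is_hom A M f, is_hom M A g & exists v, \tr (f v *m g v) != 0].

(** Vanishing of Ext makes the Ringel matrices full, so f and g extend polynomially in M and the
    trace of their composite is a polynomial function. *)
Lemma zopen_summand d : @zopen k (rsp k Q d) (@summand d).
Proof.
move=> M0 [he [f [g [hf hg [v htr]]]]].
have hid := @polyrep_id k n Q d; have hc := @polyrep_const k n Q (rsp k Q d) a A.
have z : @zopen k (rsp k Q d) (fun M => ext_zero A M /\ ext_zero M A).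
  by apply: zopenI; apply: zopen_ext_zero.
have [G [G1 G2 G3]] := z M0 he; have [/row_full_ext h1 /row_full_ext h2] := he.
have [w1 [p1 e1 k1]] := @full_kernel_lift (rsp k Q d) _ _ (fun M => dmat A M) M0 (encV f)
  (polymx_dmat hc hid) h1 (iffLR (is_homE _ _ _) hf).
have [w2 [p2 e2 k2]] := @full_kernel_lift (rsp k Q d) _ _ (fun M => dmat M A) M0 (encV g)
  (polymx_dmat hid hc) h2 (iffLR (is_homE _ _ _) hg).
exists (fun M => G M * \tr (decV (w1 M) v *m decV (w2 M) v)); split.
- apply: polyfunM => //; apply: polyfun_tr; apply: polymxM.
    by move=> i j; apply: polyfun_ext (p1 0 _) => M; rewrite mxE.
  by move=> i j; apply: polyfun_ext (p2 0 _) => M; rewrite mxE.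
- by rewrite mulf_neq0 // e1 e2 !encVK.
move=> M; rewrite mulf_eq0 negb_or => /andP[/G3 hM tM]; split=> //.
exists (decV (w1 M)), (decV (w2 M)); split; last by exists v.
  by apply/is_homE; rewrite decVK k1.
by apply/is_homE; rewrite decVK k2.
Qed.

Lemma summand_iso d (M M' : rep k Q d) : rep_iso M M' -> summand M -> summand M'.
Proof.
move=> iM [[/row_full_ext h1 /row_full_ext h2] [f [g [hf hg [v tv]]]]]; split.
  split; apply/row_full_ext; move: h1 h2; rewrite /row_full.
    by rewrite (rank_isor _ iM).
  by rewrite (rank_isol _ iM).
have [u [w [uw wu e]]] := iM.
exists (fun v => f v *m w v), (fun v => u v *m g v); split.
- move=> x; rewrite mulmxA hf e !mulmxA; congr (_ *m _ *m _).
  by rewrite -mulmxA wu mulmx1.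
- move=> x; rewrite e -!mulmxA (mulmxA (w _)) wu mul1mx; congr (_ *m _); exact: hg.
by exists v; rewrite -mulmxA (mulmxA (w v)) wu mul1mx.
Qed.

Lemma ext_zero_dsumr b d (B : rep k Q b) (C : rep k Q d) :
  ext_zero A (dsum B C) <-> ext_zero A B /\ ext_zero A C.
Proof.
rewrite -!row_full_ext /row_full rank_dsumr.
have := rank_leq_col (dmat A B); have := rank_leq_col (dmat A C).
have := dimADr Q a b d; rewrite /dimA => -> h1 h2.
split=> [/eqP h|[/eqP -> /eqP ->] //].
by split; apply/eqP; move: h h1 h2; rewrite /dimA; lia.
Qed.

Lemma ext_zero_dsuml b d (B : rep k Q b) (C : rep k Q d) :
  ext_zero (dsum B C) A <-> ext_zero B A /\ ext_zero C A.
Proof.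
rewrite -!row_full_ext /row_full rank_dsuml.
have := rank_leq_col (dmat B A); have := rank_leq_col (dmat C A).
have := dimADl Q b d a; rewrite /dimA => -> h1 h2.
split=> [/eqP h|[/eqP -> /eqP ->] //].
by split; apply/eqP; move: h h1 h2; rewrite /dimA; lia.
Qed.

(** The trace of f g is the sum of the traces through B and through C, so one of them is nonzero. *)
Lemma summand_dsum b d (B : rep k Q b) (C : rep k Q d) :
  summand (dsum B C) -> summand B \/ summand C.
Proof.
move=> [[/ext_zero_dsumr [r1 r2] /ext_zero_dsuml [l1 l2]] [f [g [hf hg [v0 tv]]]]].
pose f1 v : 'M_(a v, b v) := lsubmx (f v : 'M_(_, b v + d v)).
pose f2 v : 'M_(a v, d v) := rsubmx (f v : 'M_(_, b v + d v)).
pose g1 v : 'M_(b v, a v) := usubmx (g v : 'M_(b v + d v, _)).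
pose g2 v : 'M_(d v, a v) := dsubmx (g v : 'M_(b v + d v, _)).
have ef v : f v = row_mx (f1 v) (f2 v) by rewrite hsubmxK.
have eg v : g v = col_mx (g1 v) (g2 v) by rewrite vsubmxK.
have hf12 x : A x *m f1 (qtgt Q x) = f1 (qsrc Q x) *m B x /\
              A x *m f2 (qtgt Q x) = f2 (qsrc Q x) *m C x.
  have := hf x; rewrite !ef /dsum mul_mx_row mul_row_block !mulmx0 addr0 add0r.
  by move/eq_row_mx.
have hg12 x : B x *m g1 (qtgt Q x) = g1 (qsrc Q x) *m A x /\
              C x *m g2 (qtgt Q x) = g2 (qsrc Q x) *m A x.
  have := hg x; rewrite !eg /dsum mul_block_col mul_col_mx !mul0mx addr0 add0r.
  by move/eq_col_mx.
move: tv; rewrite ef eg mul_row_col mxtraceD => tv.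
have [t1|t1] := eqVneq (\tr (f1 v0 *m g1 v0)) 0; [right|left]; split=> //.
  exists f2, g2; split; [by move=> x; case: (hf12 x) | by move=> x; case: (hg12 x)|].
  by exists v0; move: tv; rewrite t1 add0r.
exists f1, g1; split; [by move=> x; case: (hf12 x) | by move=> x; case: (hg12 x)|].
by exists v0.
Qed.

Hypothesis bA : end_is_k A.

Lemma summand_brick b (B : rep k Q b) : end_is_k B -> summand B -> a = b.
Proof.
move=> bB [_ [f [g [hf hg [v tv]]]]].
have [c hc] : exists c, forall v, f v *m g v = c%:M.
  by apply: bA => x; rewrite mulmxA hf -mulmxA hg mulmxA.
have [c' hc'] : exists c, forall v, g v *m f v = c%:M.
  by apply: bB => x; rewrite mulmxA hg -mulmxA hf mulmxA.
have c0 : c != 0 by apply: contraNneq tv => e; rewrite hc e raddf0 raddf0.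
have ecc : c = c'.
  apply/eqP; apply: contraT => ne; case/eqP: tv.
  suff -> : f v = 0 by rewrite mul0mx raddf0.
  have : c *: f v = c' *: f v by rewrite -mul_scalar_mx -hc -mulmxA hc' mul_mx_scalar.
  by move/eqP; rewrite -subr_eq0 -scalerBl scaler_eq0 subr_eq0 (negPf ne) => /eqP.
have r1 w : (a w <= b w)%N.
  have : \rank (f w *m g w) = a w by rewrite hc -scalemx1 mxrank_scale_nz // mxrank1.
  by move=> <-; apply: leq_trans (mxrankM_maxl _ _) (rank_leq_col _).
have r2 w : (b w <= a w)%N.
  have : \rank (g w *m f w) = b w by rewrite hc' -ecc -scalemx1 mxrank_scale_nz // mxrank1.
  by move=> <-; apply: leq_trans (mxrankM_maxl _ _) (rank_leq_col _).
by apply: functional_extensionality_dep => w; apply/eqP; rewrite eqn_leq r1 r2.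
Qed.

(** The open condition survives at a representation that splits off a brick of the first type x.
    Then A is a summand of that brick, which forces a = x, or of the rest, to which induction
    applies. *)
Lemma summand_mem (s : seq (dvec n)) d (M : rep k Q d) :
  vdec s -> d = vsum s -> summand M -> exists2 x : dvec n, x \in s & a = x.
Proof.
elim: s d M => [|x s IH] d M [sS sO] ed.
  move=> [_ [f [g [_ _ [v]]]]]; case/eqP; rewrite mxtrace_mulC /mxtrace big1 // => i _.
  by case: i => i hi; exfalso; move: hi; rewrite ed vsum_nil.
rewrite vsum_cons in ed; subst d => sM.
move: sO; rewrite pairwise_cons => /andP[/(orth_vsum hchar) [xs sx] sO].
have sx' : schurv x by apply: sS (mem_head _ _).
have [|B [C [/= bB _ _ [M' sM' iM]]]] := @generic_dsum k hchar n Q x (vsum s) (@summand _)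
    (fun z => end_is_k z.1) xs sx (@zopen_summand _) (ex_intro _ M sM)
    (zopen_fst (zopen_brick sx'.1)).
  by case: sx' => _ [B hB]; exists (B, rep0 k (vsum s)).
have [sB|sC] := summand_dsum (summand_iso (rep_iso_sym iM) sM').
  by exists x; [apply: mem_head | apply: summand_brick sB].
have [||y ys ey] := IH _ C _ _ sC => //.
  by split=> // y ys; apply: sS; rewrite inE ys orbT.
by exists y => //; rewrite inE ys orbT.
Qed.
End WithA.

(** The Tits form q(a) = [dimV a a] - [dimA Q a a] is at most 0; any other Schur root is real, with
    q = 1. *)
Definition imag a : bool := (dimV a a <= dimA Q a a)%N.

Lemma pairwise_perm (T : eqType) (r : rel T) (s t : seq T) : symmetric r ->
  perm_eq s t -> pairwise r s -> pairwise r t.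
Proof.
move=> rs; elim: t s => [|x t IH] s st ps //.
have : x \in s by rewrite (perm_mem st) mem_head.
move=> xs; case/splitPr: xs st ps => s1 s2.
rewrite perm_catC /= perm_cons perm_catC => st; rewrite pairwise_cat !pairwise_cons allrel_consr.
move=> /andP[/andP[h1 h2] /andP[p1 /andP[h3 p2]]].
rewrite (IH (s1 ++ s2)) // ?pairwise_cat ?h2 ?p1 // andbT -(perm_all _ st) all_cat h3 andbT.
by apply/allP => y /(allP h1); rewrite rs.
Qed.

Lemma vdec_perm (s t : seq (dvec n)) : perm_eq s t -> vdec s -> vdec t.
Proof.
move=> st [h1 h2]; split=> [x|]; first by rewrite -(perm_mem st) => /h1.
exact: pairwise_perm (@orth_sym k n Q) st h2.
Qed.

Lemma vdec_rem x (s : seq (dvec n)) : vdec s -> vdec (rem x s).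
Proof.
move=> [h1 h2]; split=> [y /mem_rem /h1 //|].
exact: subseq_pairwise (rem_subseq x s) h2.
Qed.

Lemma vsum_rem x (s : seq (dvec n)) : x \in s -> vsum s = vadd x (vsum (rem x s)).
Proof. by move=> /perm_to_rem /vsum_perm ->; rewrite vsum_cons. Qed.

(** A real root has a brick A without self-extensions, and A can be completed to a sum A + B of type
    s with vanishing mixed Ext groups. There the open condition [summand A] holds, so a must occur
    in t. *)
Lemma real_mem (s t : seq (dvec n)) (a : dvec n) :
  vdec s -> vdec t -> vsum s = vsum t -> a \in s -> ~~ imag a -> a \in t.
Proof.
move=> ds dt est as_ ra; have sa : schurv a by case: ds => h _; apply: h.
have ea : dimV a a = (dimA Q a a).+1.
  by apply/eqP; rewrite eqn_leq (schur_dim sa) /= ltnNge.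
have da : vdec (a :: rem a s) := vdec_perm (perm_to_rem as_) ds.
case: (da) => _; rewrite pairwise_cons => /andP[/(orth_vsum hchar) [ar ra'] _].
have [A0 [bA0 eA0]] := schur_real_ext sa ea.
have z : @zopen k (rsp2 k Q a (vsum (rem a s))) (fun z => end_is_k z.1 /\ ext_zero z.1 z.1).
  apply: zopenI; first exact: zopen_fst (zopen_brick sa.1).
  by apply: zopen_ext_zero; apply: polyrep_fst.
have [|A [B [/= [bA eA] eAB eBA _]]] := generic_dsum hchar ar ra' (@zopenT _ _)
    (ex_intro _ (rep0 k (vadd a (vsum (rem a s)))) I) z.
  by exists (A0, rep0 k _).
have sM : summand A (dsum A B).
  split; first by split; [apply/ext_zero_dsumr | apply/ext_zero_dsuml].
  exists (fun v => row_mx 1%:M 0), (fun v => col_mx 1%:M 0); split.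
  - by move=> x; rewrite mul_mx_row mul_row_block !mulmx0 !mul1mx !mulmx1 !mul0mx !addr0.
  - by move=> x; rewrite mul_block_col mul_col_mx !mulmx0 !mul1mx !mulmx1 !mul0mx !addr0.
  have [[v hv] _] := sa; exists v.
  by rewrite mul_row_col mulmx1 mulmx0 addr0 mxtrace1 natr_neq0.
have [|x xt eax] := summand_mem bA dt _ sM; first by rewrite -est (vsum_rem as_).
by have -> : a = x by apply/ffunP => v; rewrite eax.
Qed.

(** Both ext numbers are additive over ext-orthogonal sums, and by [schur_sext] they differ by one
    exactly at the imaginary members. Their number therefore depends on the sum alone. *)
Lemma count_imag (s : seq (dvec n)) : vdec s ->
  sext k Q (vsum s) = (gext k Q (vsum s) (vsum s) + count (fun x : dvec n => imag x) s)%N.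
Proof.
elim: s => [|x s IH] [h1 h2].
  by rewrite vsum_nil gext0l /=; have := sextE k Q (fun=> 0%N); rewrite dimAE big1 // => ?; lia.
move: h2; rewrite pairwise_cons => /andP[/(orth_vsum hchar) [xs sx] h2].
rewrite vsum_cons sext_sum // gext_self_sum // IH; last first.
  by split=> // y ys; apply: h1; rewrite inE ys orbT.
rewrite (schur_sext hchar (h1 x (mem_head _ _))) /= -/(imag x); lia.
Qed.

(** A real member of one list lies in the other and is removed from both; once none is left,
    [count_imag] counts everything. *)
Lemma decomp_size (s t : seq (dvec n)) : vdec s -> vdec t -> vsum s = vsum t -> size s = size t.
Proof.
have [m] := ubnP (size s); elim: m s t => // m IH s t hm ds dt est.
have [/allP hs|] := boolP (all (fun x : dvec n => imag x) s); last first.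
  case/allPn => x xs rx; have xt := real_mem ds dt est xs rx.
  have e1 : size s = (size (rem x s)).+1 by rewrite size_rem // prednK //; case: (s) xs.
  have e2 : size t = (size (rem x t)).+1 by rewrite size_rem // prednK //; case: (t) xt.
  rewrite e1 e2; congr _.+1; apply: IH; [by rewrite -ltnS -e1 | exact: vdec_rem | exact: vdec_rem |].
  apply: functional_extensionality_dep => v; have := congr1 (fun f => f v) est.
  by rewrite (vsum_rem xs) (vsum_rem xt) /vadd => /addnI.
have /allP ht : all (fun x : dvec n => imag x) t.
  by apply/allPn => -[x xt rx]; have := hs _ (real_mem dt ds (esym est) xt rx); apply/negP.
have := count_imag ds; have := count_imag dt; rewrite est => -> /addnI.
have := introT allP hs; have := introT allP ht.
by rewrite !all_count => /eqP -> /eqP ->.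
Qed.

(** Decomposing each member of u further gives a decomposition of the same vector, whose size is
    known. *)
Lemma decomp_max_size (s u : seq (dvec n)) : vdec s -> pairwise orth u ->
  (forall x : dvec n, x \in u -> nzv x) -> vsum u = vsum s -> (size u <= size s)%N.
Proof.
move=> ds ou nu eu.
suff [w [dw ew hw]] : exists w, [/\ vdec w, vsum w = vsum u & (size u <= size w)%N].
  by rewrite (decomp_size ds dw) // ew eu.
elim: u ou nu {eu} => [|x u IH]; first by exists [::].
rewrite pairwise_cons => /andP[/(orth_vsum hchar) [xu ux] ou] nu.
have [|w [dw ew hw]] := IH ou; first by move=> y yu; apply: nu; rewrite inE yu orbT.
have [w' dw' ew'] := decomp_exists hchar Q x.
exists (w' ++ w); split.
- exact: (decomp_refine hchar xu ux).
- by rewrite vsum_cat vsum_cons ew ew'.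
rewrite size_cat /= -add1n leq_add // lt0n size_eq0; apply/eqP => w0.
have [v] := nu x (mem_head _ _); have := congr1 (fun f => f v) ew'.
by rewrite w0 vsum_nil => <-.
Qed.

End Real.

(** * Comparing two decompositions *)

Section HmxMore.
Variable k : closedFieldType.

Lemma hmx_conj m (g h A : 'M[k]_m) p : g *m h = 1%:M -> h *m g = 1%:M ->
  hmx (g *m A *m h) p = g *m hmx A p *m h.
Proof.
move=> gh hg; elim/poly_ind: p => [|p c IH]; first by rewrite !hmx0 mulmx0 mul0mx.
have e : g *m c%:M *m h = c%:M by rewrite scalar_mxC -mulmxA gh mulmx1.
rewrite !hmxD !hmxM !hmxX !hmxC IH mulmxDr mulmxDl e; congr (_ + _).
by rewrite -!mulmxA (mulmxA h g) hg mul1mx.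
Qed.

Lemma hmx_block m m' (A : 'M[k]_m) (B : 'M[k]_m') p :
  hmx (block_mx A 0 0 B) p = block_mx (hmx A p) 0 0 (hmx B p).
Proof.
elim/poly_ind: p => [|p c IH]; first by rewrite !hmx0 block_mx0.
rewrite !hmxD !hmxM !hmxX !hmxC IH mulmx_block !mulmx0 !mul0mx !addr0 !add0r.
by rewrite scalar_mx_block add_block_mx !addr0.
Qed.

Lemma hmx_scalar m z p : hmx (z%:M : 'M[k]_m) p = (p.[z])%:M.
Proof.
elim/poly_ind: p => [|p c IH]; first by rewrite hmx0 horner0 raddf0.
by rewrite hmxD hmxM hmxX hmxC IH -scalar_mxM -raddfD /= hornerD hornerM hornerX hornerC.
Qed.

Definition mxp (R : pzRingType) m i (A : 'M[R]_m) : 'M[R]_m := iter i (mulmx A) 1%:M.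

Lemma hmx_mxp m (A : 'M[k]_m) i : hmx A ('X ^+ i) = mxp i A.
Proof.
elim: i => [|i IH]; first by rewrite expr0 hmx1.
by rewrite exprS hmxM hmxX IH.
Qed.

Lemma mxev_mxp m (A : 'M[{poly k}]_m) i t : mxev t (mxp i A) = mxp i (mxev t A).
Proof.
elim: i => [|i IH]; first exact: mxev1.
by rewrite /= mxevM IH.
Qed.
End HmxMore.

(** * Hankel determinants of weighted power sums *)

Section Hankel.
Variables (k : closedFieldType) (r : nat).
Variables (c e : 'I_r -> k).

(** The matrix is V diag(e) V^T for the Vandermonde matrix V of the nodes c. *)
Lemma det_hankel :
  \det (\matrix_(i < r, j < r) \sum_l e l * c l ^+ (i + j)) =
  (\prod_(i < r) \prod_(j < r | (i < j)%N) (c j - c i)) ^+ 2 * \prod_l e l.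
Proof.
pose V := Vandermonde r (\row_l c l).
have -> : (\matrix_(i < r, j < r) \sum_l e l * c l ^+ (i + j)) =
    V *m diag_mx (\row_l e l) *m V^T.
  apply/matrixP => i j; rewrite mul_mx_diag mxE mxE; apply: eq_bigr => l _.
  by rewrite !mxE exprD mulrCA mulrA.
rewrite !det_mulmx det_tr det_diag det_Vandermonde expr2 mulrAC; congr (_ * _ * _).
- by apply: eq_bigr => i _; apply: eq_bigr => j _; rewrite !mxE.
- by apply: eq_bigr => i _; apply: eq_bigr => j _; rewrite !mxE.
by apply: eq_bigr => l _; rewrite mxE.
Qed.
End Hankel.

Section Compare.
Variables (k : closedFieldType) (hchar : [pchar k] =i pred0).
Variables (n : nat) (Q : quiver n).
Implicit Types a b d e : 'I_n -> nat.
Notation schurv := (schurv k Q).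
Notation vdec := (vdec k Q).
Notation orth := (orth k Q).
Notation dvec := (dvec n).

Lemma polymx_block (X : pspace k) p q p' q' (A : pt X -> 'M[k]_(p, q)) (B : pt X -> 'M[k]_(p', q')) :
  polymx A -> polymx B -> polymx (fun x => block_mx (A x) 0 0 (B x)).
Proof.
move=> hA hB i j; rewrite -[i]splitK -[j]splitK.
case: (split i) => i'; case: (split j) => j' /=.
- by apply: polyfun_ext (hA i' j') => x; rewrite block_mxEul.
- by apply: polyfun_ext (polyfun_const X 0) => x; rewrite block_mxEur mxE.
- by apply: polyfun_ext (polyfun_const X 0) => x; rewrite block_mxEdl mxE.
- by apply: polyfun_ext (hB i' j') => x; rewrite block_mxEdr.
Qed.

Lemma zopen_comp (X : pspace k) d (F : pt X -> rep k Q d) (O : rep k Q d -> Prop) :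
  polyrep F -> @zopen k (rsp k Q d) O -> zopen (fun x => O (F x)).
Proof.
move=> hF zO x0 /zO [G [[Gh [G1 G2]] G3 G4]].
have /dep_choice [Fh hFh] : forall x, exists Fh : pth X -> 'M[{poly k}]_(d (qsrc Q x), d (qtgt Q x)),
    (forall P t i j, (Fh P i j).[t] = F (pev P t) x i j) /\
    (forall m P P', pcg m P P' -> forall i j, 'X^m %| Fh P i j - Fh P' i j).
  move=> x; have /choice [f hf] : forall ij : _ * _, exists g : pth X -> {poly k},
     (forall P t, (g P).[t] = F (pev P t) x ij.1 ij.2) /\
     (forall m P P', pcg m P P' -> 'X^m %| g P - g P').
    by case=> i j; exact: (hF x i j).
  exists (fun P => \matrix_(i, j) f (i, j) P); split=> [P t i j|m P P' h i j]; rewrite !mxE.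
    by case: (hf (i, j)).
  by case: (hf (i, j)) => _; apply.
exists (fun x => G (F x)); split=> //; last by move=> y /G4.
exists (fun P => Gh (fun x => Fh x P)); split=> [P t|m P P' h].
  rewrite G1; congr G; apply: functional_extensionality_dep => x; apply/matrixP => i j.
  by rewrite mxE /horner_eval; case: (hFh x).
by apply: G2 => x i j; case: (hFh x) => _; apply.
Qed.

(** The endomorphism is recorded only by its power traces: eigenvalue [zs_i] with multiplicity
    vector [s_i]. *)
Definition has_spectrum d (M : rep k Q d) (phi : vtxmaps k d d) (s : seq dvec) (zs : seq k) :=
  is_hom M M phi /\ forall v i, \tr (hmx (phi v) ('X ^+ i)) =
    \sum_(p <- zip s zs) (p.1 v)%:R * p.2 ^+ i.

(** The endomorphism acts by one scalar on each summand. To stay inside O, the induction applies to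
    the pullback of O along B' |-> g (A + B') h, with A, g and h already fixed. *)
Lemma spectral_wit (s : seq dvec) (zs : seq k) d (O : rep k Q d -> Prop) :
  vdec s -> size zs = size s -> d = vsum s -> @zopen k (rsp k Q d) O -> (exists M, O M) ->
  exists2 M, O M & exists phi, has_spectrum M phi s zs.
Proof.
elim: s zs d O => [|x s IH] [|z zs] d O [sS sO] //= hsz ed zO [M0 OM0].
  exists M0 => //; exists (fun v => 0); split; first by move=> y; rewrite mulmx0 mul0mx.
  move=> v i; rewrite big_nil; move: (hmx _ _) => F.
  rewrite /mxtrace big1 // => -[j hj] _; exfalso; move: hj; by rewrite ed vsum_nil.
rewrite vsum_cons in ed; subst d; case: hsz => hsz.
move: sO; rewrite pairwise_cons => /andP[/(orth_vsum hchar) [xs sx] sO].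
have [A [B [_ _ _ [M1 OM1 [g [h [gh hg eM1]]]]]]] := generic_dsum hchar xs sx zO
   (ex_intro _ M0 OM0) (@zopenT k _) (ex_intro _ (rep0 k x, rep0 k (vsum s)) I).
pose F (B' : rep k Q (vsum s)) : rep k Q (vadd x (vsum s)) :=
  fun y => g (qsrc Q y) *m dsum A B' y *m h (qtgt Q y).
have pF : @polyrep k n Q (rsp k Q (vsum s)) _ F.
  move=> y; apply: polymxM; last exact: polymx_const.
  apply: polymxM; first exact: polymx_const.
  by apply: polymx_block; [apply: polymx_const | apply: polymx_coord].
have [||B' OB' [phi [hphi tphi]]] := IH zs _ (fun B' => O (F B')) _ hsz erefl (zopen_comp pF zO).
- by split=> // y ys; apply: sS; rewrite inE ys orbT.
- exists B; have -> // : F B = M1.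
  by apply: functional_extensionality_dep => y; rewrite eM1.
exists (F B') => //.
exists (fun v => g v *m block_mx (z%:M : 'M_(x v)) 0 0 (phi v) *m h v); split.
  move=> y; rewrite /F /dsum !mulmxA; congr (_ *m _).
  rewrite -!mulmxA (mulmxA (h _)) hg mul1mx (mulmxA (h _)) hg mul1mx; congr (_ *m _).
  by rewrite !mulmx_block !mulmx0 !mul0mx !addr0 !add0r hphi scalar_mxC.
move=> v i; rewrite hmx_conj // mxtrace_mulC mulmxA hg mul1mx hmx_block mxtrace_block.
rewrite hmx_scalar hornerXn mxtrace_scalar tphi big_cons /=.
by rewrite mulr_natl.
Qed.

Definition dot (x : 'I_n -> k) (y : 'I_n -> nat) : k := \sum_v x v * (y v)%:R.

Definition hankel r d (x : 'I_n -> k) (Phi : forall v, 'M[{poly k}]_(d v)) : {poly k} :=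
  \det (\matrix_(i < r, j < r) \sum_v (x v)%:P * \tr (mxp (i + j) (Phi v))).

Lemma hankelE r d x (Phi : forall v, 'M[{poly k}]_(d v)) t (c : 'I_r -> k) (e : 'I_r -> 'I_n -> nat) :
  (forall v i, \tr (hmx (mxev t (Phi v)) ('X ^+ i)) = \sum_l (e l v)%:R * c l ^+ i) ->
  (hankel r x Phi).[t] = (\prod_(i < r) \prod_(j < r | (i < j)%N) (c j - c i)) ^+ 2 *
    \prod_l dot x (e l).
Proof.
move=> h; rewrite -det_hankel -[LHS]/(horner_eval t _) -det_map_mx; congr (\det _).
apply/matrixP => i j; rewrite !mxE rmorph_sum /=.
rewrite (eq_bigr (fun v => \sum_l (x v * (e l v)%:R) * c l ^+ (i + j))); last first.
  move=> v _; rewrite /horner_eval hornerM hornerC -[(\tr _).[t]]/(horner_eval t _) -trace_map_mx.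
  rewrite -[map_mx _ _]/(mxev t _) mxev_mxp -hmx_mxp h mulr_sumr.
  by apply: eq_bigr => l _; rewrite mulrA.
by rewrite exchange_big; apply: eq_bigr => l _; rewrite /dot mulr_suml.
Qed.

Lemma zip_sum (s : seq dvec) r (hs : size s = r) v i :
  \sum_(p <- zip s [seq (j%:R : k) | j <- iota 0 r]) (p.1 v)%:R * p.2 ^+ i =
  \sum_(l < r) (nth [ffun=> 0%N] s l v)%:R * ((l%:R : k) ^+ i).
Proof.
have hz : size [seq (j%:R : k) | j <- iota 0 r] = size s by rewrite size_map size_iota hs.
rewrite (big_nth ([ffun=> 0%N], 0)) size_zip hz minnn hs big_mkord.
apply: eq_bigr => l _; rewrite nth_zip // (nth_map 0%N) ?size_iota // nth_iota //.
Qed.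

(* Along a path from a generic sum of type s to one of type t, the normalized
   Hankel determinant takes finitely many values, hence is constant. *)
Lemma decomp_hyperplanes (s t : seq dvec) (x : 'I_n -> k) :
  vdec s -> vdec t -> vsum s = vsum t ->
  (exists2 a : dvec, a \in s & dot x a = 0) -> exists2 b : dvec, b \in t & dot x b = 0.
Proof.
move=> ds dt est [a0 a0s da0].
pose r := size s; have szt : size t = r by rewrite -(decomp_size hchar ds dt est).
pose d := vsum s; pose zs := [seq (j%:R : k) | j <- iota 0 r].
have szz : size zs = r by rewrite size_map size_iota.
have zg := @zopen_generic k n Q d; have wg := generic_wit k Q d.
have [M0 gM0 [phi [hphi tphi]]] := spectral_wit ds szz erefl zg wg.
have szz' : size zs = size t by rewrite szz szt.
have [N0 gN0 [psi [hpsi tpsi]]] := spectral_wit dt szz' est zg wg.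
pose P := @pline k (rsp k Q d) M0 N0.
have P0 : pev P 0 = M0 by exact: pline0.
have P1 : pev P 1 = N0 by exact: pline1.
have [||ph [f [ph0 f0 hf]]] := @end_lift k n Q d P 0 phi; rewrite ?P0 //.
have [||qh [g [qh1 g1 hg]]] := @end_lift k n Q d P 1 psi; rewrite ?P1 //.
(* Endomorphisms over a fixed representation form a linear space, so the two lifts can be
   interpolated: [phi] at 0, [psi] at 1. *)
pose Phi v := (1 - 'X : {poly k}) *: ph v + 'X *: qh v.
have Phi0 v : mxev 0 (Phi v) = phi v.
  by rewrite mxevD !mxevZ hornerD hornerN hornerC hornerX subr0 scale1r scale0r addr0 ph0.
have Phi1 v : mxev 1 (Phi v) = psi v.
  by rewrite mxevD !mxevZ hornerD hornerN hornerC hornerX subrr scale1r scale0r add0r qh1.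
have hPhi u : f.[u] != 0 -> g.[u] != 0 -> is_hom (pev P u) (pev P u) (fun v => mxev u (Phi v)).
  move=> /hf h1 /hg h2 y; rewrite !mxevD !mxevZ mulmxDr mulmxDl -!scalemxAr -!scalemxAl.
  by rewrite h1 h2.
have [f2 f20 hf2] : exists2 f2 : {poly k}, f2.[0] != 0 &
    forall u, f2.[u] != 0 -> rep_generic (pev P u : rep k Q d).
  by apply: (zopen_path zg); rewrite P0.
(* The weight 1 normalizes: [H x] over [H one] is free of the Vandermonde factor, and [dot one] is
   nonzero on every nonzero dimension vector. *)
pose one : 'I_n -> k := fun=> 1.
pose H y := hankel r y Phi.
pose V : k := (\prod_(i < r) \prod_(j < r | (i < j)%N) ((j%:R : k) - i%:R)) ^+ 2.
have V0 : V != 0.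
  rewrite expf_neq0 //; apply/prodf_neq0 => i _; apply/prodf_neq0 => j ij.
  rewrite subr_eq0; apply: contraTneq ij => /(natr_inj_char0 hchar) -> ; by rewrite ltnn.
have H0 y : (H y).[0] = V * \prod_(l < r) dot y (nth [ffun=> 0%N] s l : dvec).
  by apply: hankelE => v i; rewrite Phi0 tphi zip_sum.
have H1 y : (H y).[1] = V * \prod_(l < r) dot y (nth [ffun=> 0%N] t l : dvec).
  by apply: hankelE => v i; rewrite Phi1 tpsi zip_sum.
have dot1 (y : 'I_n -> nat) : dot one y = (\sum_v y v)%N%:R.
  by rewrite natr_sum; apply: eq_bigr => v _; rewrite mul1r.
have dot1_neq0 (w : seq dvec) : vdec w -> size w = r ->
    \prod_(l < r) dot one (nth [ffun=> 0%N] w l : dvec) != 0.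
  move=> [hw _] sw; apply/prodf_neq0 => l _; rewrite dot1 natr_neq0 // total_dim_gt0 //.
  by have [|] := hw (nth [ffun=> 0%N] w l); rewrite ?mem_nth ?sw.
have H1neq : H one != 0.
  have : (H one).[0] != 0 by rewrite H0 mulf_neq0 // dot1_neq0.
  by apply: contraNneq => ->; rewrite horner0.
pose D := (\sum_v d v)%N.
(* The multiplicity vectors at a parameter u have entries bounded by [D], so only finitely many
   lists of them are possible. *)
pose Ev : finType := {ffun 'I_r -> {ffun 'I_n -> 'I_D.+1}}.
pose XE (E : Ev) y := \prod_(l < r) dot y (fun v => E l v : nat).
have key u : f.[u] != 0 -> g.[u] != 0 -> f2.[u] != 0 -> (H one).[u] != 0 ->
    exists2 E : Ev, XE E one != 0 & XE E one * (H x).[u] = XE E x * (H one).[u].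
  move=> fu gu f2u Hu.
  have [cs [e [N [ucs e0 eorth etr _]]]] := spectral_split hchar (hf2 _ f2u) (hPhi _ fu gu).
  have ed v : d v = (\sum_(c <- cs) e c v)%N.
    have E0 := etr v 0%N; rewrite expr0 hmx1 mxtrace1 in E0.
    apply: (natr_inj_char0 hchar); rewrite /= E0 natr_sum.
    by apply: eq_bigr => c _; rewrite expr0 mulr1.
  (* At a generic representation the eigenspaces are pairwise ext-orthogonal, so there are at most r
     eigenvalues; shorter lists are padded by zero multiplicities. *)
  have csr : (size cs <= r)%N.
    pose us := [seq [ffun v => e c v] | c <- cs] : seq dvec.
    have hus z : ([ffun v => e z v] : dvec) = e z :> ('I_n -> nat).
      by apply: functional_extensionality_dep => v; rewrite ffunE.
    have -> : size cs = size us by rewrite size_map.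
    apply: (decomp_max_size hchar ds).
    - rewrite pairwise_map.
      have: pairwise [rel c c' | c != c'] cs by rewrite -uniq_pairwise.
      apply: (@sub_in_pairwise _ (mem cs)); last exact/allP.
      move=> c c' hc hc' /= ne; rewrite /orth !hus !eorth //.
      by rewrite eq_sym.
    - by move=> z /mapP [c hc ->]; rewrite hus; apply: e0.
    apply: functional_extensionality_dep => v; rewrite -/d ed /vsum big_map.
    by apply: eq_bigr => c _; rewrite ffunE.
  pose cl (l : 'I_r) := nth 0 cs l.
  pose el (l : 'I_r) v := if (l < size cs)%N then e (cl l) v else 0%N.
  have elb l v : (el l v < D.+1)%N.
    rewrite /el ltnS; case: ltnP => // hl; apply: leq_trans (_ : (d v <= D)%N).
      by rewrite ed (big_rem (cl l)) ?mem_nth //= leq_addr.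
    by rewrite /D (bigD1 v) //= leq_addr.
  have trl v i : \tr (hmx (mxev u (Phi v)) ('X ^+ i)) = \sum_l (el l v)%:R * cl l ^+ i.
    rewrite etr (big_nth 0) big_mkord (big_ord_widen _ (fun l => (e (nth 0 cs l) v)%:R * nth 0 cs l ^+ i) csr).
    rewrite big_mkcond; apply: eq_bigr => l _; rewrite /el /cl; case: ifP => //.
    by rewrite mul0r.
  pose E : Ev := [ffun l => [ffun v => Ordinal (elb l v)]].
  have EX y : XE E y = \prod_l dot y (el l).
    by apply: eq_bigr => l _; apply: eq_bigr => v _; rewrite !ffunE.
  have := hankelE x trl; have := hankelE one trl; rewrite -/(H x) -/(H one) -!EX => h1 h2.
  exists E; last by rewrite h1 h2; ring.
  by move: Hu; rewrite h1 mulf_eq0 negb_or => /andP[].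
(* At each good u some factor vanishes, so the product is the zero polynomial and one E serves all
   u, in particular 0 and 1. *)
have fin : \prod_(E : Ev | XE E one != 0) ((XE E one)%:P * H x - (XE E x)%:P * H one) = 0.
  apply: (poly_eq0_nonroot hchar (g := f * g * f2 * H one)).
    have nz (w : {poly k}) u : w.[u] != 0 -> w != 0 by apply: contraNneq => ->; rewrite horner0.
    by rewrite !mulf_neq0 // ?(nz _ _ f0) ?(nz _ _ g1) ?(nz _ _ f20).
  move=> u; rewrite !hornerM !mulf_eq0 !negb_or => /andP[/andP[/andP[fu gu] f2u] Hu].
  have [E E1 E2] := key u fu gu f2u Hu.
  rewrite horner_prod; apply/eqP/prodf_eq0; exists E => //.
  by rewrite hornerD hornerN !hornerM !hornerC E2 subrr.
have /eqP/prodf_eq0 [E E1 /eqP eE] := fin.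
have ev u : XE E one * (H x).[u] = XE E x * (H one).[u].
  have := congr1 (fun w => w.[u]) eE; rewrite horner0 hornerD hornerN !hornerM !hornerC.
  by move/eqP; rewrite subr_eq0 => /eqP.
have XEx : XE E x = 0.
  have := ev 0; rewrite !H0.
  have -> : \prod_(l < r) dot x (nth [ffun=> 0%N] s l : dvec) = 0.
    have hl : (index a0 s < r)%N by rewrite index_mem.
    apply/eqP/prodf_eq0; exists (Ordinal hl) => //=; by rewrite nth_index // da0.
  rewrite !mulr0 => /esym/eqP.
  by rewrite mulf_eq0 (negPf (mulf_neq0 V0 (dot1_neq0 s ds erefl))) orbF => /eqP.
have := ev 1; rewrite XEx mul0r H1 => /eqP; rewrite mulrA mulf_eq0 (negPf (mulf_neq0 E1 V0)) /=.
case/prodf_eq0 => l _ /eqP hl; exists (nth [ffun=> 0%N] t l) => //.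
by rewrite mem_nth // szt.
Qed.

(** If a were proportional to no b in t, each b would have a weight, a 2 x 2 minor against a, that
    vanishes on a but not on b. A combination with generic powers of z vanishes on a and on no
    member of t, contrary to [decomp_hyperplanes]. *)
Lemma decomp_proportional (s t : seq dvec) (a : dvec) :
  vdec s -> vdec t -> vsum s = vsum t -> a \in s ->
  exists2 b : dvec, b \in t & forall u v, (a u * b v = a v * b u)%N.
Proof.
move=> ds dt est as_; apply: contrapT => hn.
have /choice [uv huv] : forall b : dvec, exists uv : 'I_n * 'I_n,
    b \in t -> (a uv.1 * b uv.2)%N != (a uv.2 * b uv.1)%N.
  move=> b; case bt: (b \in t); last first.
    have [v _] : nzv a by case: ds => h _; case: (h a as_).
    by exists (v, v).
  apply: contrapT => h; apply: hn; exists b => // u v; apply/eqP; apply: contraT => ne.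
  by case: h; exists (u, v).
pose xb (b : dvec) : 'I_n -> k := fun v =>
  (a (uv b).2)%:R * (v == (uv b).1)%:R - (a (uv b).1)%:R * (v == (uv b).2)%:R.
have dotE (b : dvec) (y : 'I_n -> nat) : dot (xb b) y =
    (a (uv b).2)%:R * (y (uv b).1)%:R - (a (uv b).1)%:R * (y (uv b).2)%:R.
  rewrite /dot /xb; under eq_bigr do rewrite mulrBl -!mulrA.
  rewrite sumrB -!mulr_sumr; congr (_ * _ - _ * _).
    rewrite (bigD1 (uv b).1) //= eqxx mul1r big1 ?addr0 // => v /negPf ->.
    by rewrite mul0r.
  rewrite (bigD1 (uv b).2) //= eqxx mul1r big1 ?addr0 // => v /negPf ->.
  by rewrite mul0r.
pose pb (b : dvec) : {poly k} := \sum_(i < size t) (dot (xb (nth [ffun=> 0%N] t i)) b) *: 'X^i.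
have pb0 (b : dvec) : b \in t -> pb b != 0.
  move=> bt; have hi : (index b t < size t)%N by rewrite index_mem.
  have /eqP : (pb b)`_(index b t) != 0.
    rewrite coef_sum (bigD1 (Ordinal hi)) //= big1 => [|j].
      rewrite addr0 coefZ coefXn eqxx mulr1 nth_index // dotE subr_eq0 -!natrM.
      by apply: contra (huv b bt) => /eqP /(natr_inj_char0 hchar) ->.
    rewrite coefZ coefXn -val_eqE /= eq_sym => /negPf ->; by rewrite mulr0.
  by move=> h; apply/eqP => e; apply: h; rewrite e coef0.
have nz : \prod_(b <- t) pb b != 0.
  by rewrite prodf_seq_neq0; apply/allP => b bt /=; apply: pb0.
have [z hz] := poly_nonroot hchar nz.
pose xx v := \sum_(i < size t) z ^+ i * xb (nth [ffun=> 0%N] t i) v.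
have xxE (y : 'I_n -> nat) : dot xx y = \sum_(i < size t) z ^+ i * dot (xb (nth [ffun=> 0%N] t i)) y.
  rewrite /dot /xx; under eq_bigr do rewrite mulr_suml.
  rewrite exchange_big; apply: eq_bigr => i _ /=; rewrite mulr_sumr.
  by apply: eq_bigr => v _; rewrite mulrA.
have [|b bt hb] := @decomp_hyperplanes s t xx ds dt est.
  exists a => //; rewrite xxE big1 // => i _; rewrite dotE.
  by rewrite [X in _ - X]mulrC subrr mulr0.
rewrite xxE in hb; move: hz; rewrite horner_prod => /eqP; apply.
apply/eqP; rewrite prodf_seq_eq0; apply/hasP; exists b => //=.
rewrite horner_sum -[X in _ == X]hb; apply/eqP; apply: eq_bigr => i _.
by rewrite hornerZ hornerXn mulrC.
Qed.

End Compare.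

(** * Ext numbers between the members of two decompositions *)

Section Uniqueness.
Variables (k : closedFieldType) (hchar : [pchar k] =i pred0).
Variables (n : nat) (Q : quiver n).
Notation schurv := (schurv k Q).
Notation vdec := (vdec k Q).
Notation orth := (orth k Q).
Notation gext := (gext k Q).
Notation dvec := (dvec n).
Implicit Types x y z : dvec.

Definition tot (x : 'I_n -> nat) : nat := (\sum_v x v)%N.
Definition proportional (x y : 'I_n -> nat) : Prop := forall u v, (x u * y v = x v * y u)%N.

Lemma proportional_sym x y : proportional x y -> proportional y x.
Proof. by move=> h u v; rewrite mulnC h mulnC. Qed.

Lemma proportional_tot (x y : 'I_n -> nat) : proportional x y -> vmul (tot y) x = vmul (tot x) y.
Proof.
move=> h; apply: functional_extensionality_dep => u; rewrite /vmul /tot !big_distrl /=.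
by apply: eq_bigr => v _; rewrite mulnC h.
Qed.

Lemma proportional_eq x y : proportional x y -> nzv x -> tot x = tot y -> x = y.
Proof.
move=> h x0 e; apply/ffunP => v; have := proportional_tot h.
move=> /(congr1 (fun f => f v)); rewrite /vmul -e => /eqP.
by rewrite eqn_pmul2l => [/eqP //|]; apply: total_dim_gt0.
Qed.

(** For proportional vectors the Euler form is a rescaled q(x), and ext is at least minus the Euler
    form. *)
Lemma proportional_gext x y : proportional x y -> nzv x ->
  (dimV x x <= dimA Q x x)%N ->
  (tot y * (dimA Q x x - dimV x x) <= tot x * gext x y)%N.
Proof.
move=> h x0 q; have e := proportional_tot h.
have eA : (tot x * dimA Q x y = tot y * dimA Q x x)%N by rewrite -!dimA_mulr e.
have eV : (tot x * dimV x y = tot y * dimV x x)%N by rewrite -!dimV_mulr e.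
have := gextE k Q x y; have := rkmax_dimV k Q x y => h1 h2.
by rewrite mulnBr -eA -eV -mulnBr leq_mul2l; apply/orP; right; lia.
Qed.

Lemma vdec_orth (t : seq dvec) x y : vdec t -> x \in t -> y \in t -> x != y -> orth x y.
Proof.
move=> dt xt yt xy; have [_] := vdec_perm (perm_to_rem xt) dt.
rewrite pairwise_cons => /andP[/allP h _]; apply: h.
by move: yt; rewrite (perm_mem (perm_to_rem xt)) inE eq_sym (negPf xy).
Qed.

Lemma gext_own (s : seq dvec) x : vdec s -> x \in s ->
  gext x (vsum s) = gext x x /\ gext (vsum s) x = gext x x.
Proof.
move=> ds xs; have [_] := vdec_perm (perm_to_rem xs) ds.
rewrite pairwise_cons => /andP[/(orth_vsum hchar) [h1 h2] _].
by rewrite (vsum_rem xs) gext_sumr // gext_suml // h1 h2 !addn0.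
Qed.

(** With d the common sum, ext(x, d) is ext(x, x) when computed from s, and a sum of nonnegative
    terms including ext(x, y) when computed from t. *)
Lemma gext_other (s t : seq dvec) x y : vdec s -> vdec t -> vsum s = vsum t ->
  x \in s -> y \in t -> (gext x y <= gext x x)%N /\ (gext y x <= gext x x)%N.
Proof.
move=> ds dt est xs yt; have [<- e2] := gext_own ds xs; rewrite -{2}e2 est.
case: dt => _ ot; rewrite gext_vsumrE // gext_vsumlE //.
by rewrite !(big_rem y yt) /= !leq_addr.
Qed.

Lemma gext_self_gt0 x : schurv x -> gext x x != 0%N ->
  (dimV x x < dimA Q x x)%N /\ (gext x x = dimA Q x x - dimV x x)%N.
Proof.
move=> sx h; have hlt : (dimV x x < dimA Q x x)%N.
  by rewrite ltnNge; apply: contraNN h => /(schur_gext0 hchar sx) ->.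
by split=> //; have := schur_gext hchar sx (ltnW hlt); lia.
Qed.

(** If x or y has no self-ext, [gext_other] suffices. Otherwise x is proportional to some b in t,
    and comparing ext in both directions gives equal total dimensions; so x = b, and x and y lie in
    one decomposition. *)
Lemma decomp_orth (s t : seq dvec) x y : vdec s -> vdec t -> vsum s = vsum t ->
  x \in s -> y \in t -> x != y -> orth x y.
Proof.
move=> ds dt est xs yt xy.
have [x0|x1] := eqVneq (gext x x) 0%N.
  by have := gext_other ds dt est xs yt; rewrite x0 !leqn0 => -[h1 h2]; rewrite /orth h1 h2.
have [y0|y1] := eqVneq (gext y y) 0%N.
  by have := gext_other dt ds (esym est) yt xs; rewrite y0 !leqn0 => -[h1 h2]; rewrite /orth h1 h2.
have sx : schurv x by case: ds => h _; apply: h.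
have [qx gx] := gext_self_gt0 sx x1.
have [b bt pxb] := decomp_proportional hchar ds dt est xs.
have sb : schurv b by case: dt => h _; apply: h.
have pbx : proportional b x by apply: proportional_sym.
have tx : (0 < tot x)%N := total_dim_gt0 sx.1.
have tb : (0 < tot b)%N := total_dim_gt0 sb.1.
have h1 : (tot b <= tot x)%N.
  have := proportional_gext pxb sx.1 (ltnW qx).
  have [h _] := gext_other ds dt est xs bt; rewrite -gx => h'.
  have := leq_trans h' (leq_mul (leqnn _) h).
  by rewrite leq_pmul2r // lt0n.
have qb : (dimV b b < dimA Q b b)%N.
  have eb := proportional_tot pxb.
  have eA : (tot x * tot x * dimA Q b b = tot b * tot b * dimA Q x x)%N.
    by rewrite -!mulnA -[(tot x * dimA Q b b)%N]dimA_mulr -dimA_mull -eb dimA_mulr dimA_mull.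
  have eV : (tot x * tot x * dimV b b = tot b * tot b * dimV x x)%N.
    by rewrite -!mulnA -[(tot x * dimV b b)%N]dimV_mulr -dimV_mull -eb dimV_mulr dimV_mull.
  by rewrite -(ltn_pmul2l (m := tot x * tot x)) ?muln_gt0 ?tx // eA eV ltn_pmul2l ?muln_gt0 ?tb.
have gb : (gext b b = dimA Q b b - dimV b b)%N.
  by have := schur_gext hchar sb (ltnW qb); lia.
have h2 : (tot x <= tot b)%N.
  have := proportional_gext pbx sb.1 (ltnW qb).
  have [h _] := gext_other dt ds (esym est) bt xs; rewrite -gb => h'.
  have := leq_trans h' (leq_mul (leqnn _) h).
  by rewrite leq_pmul2r // gb subn_gt0.
have exb : x = b by apply: proportional_eq pxb sx.1 _; apply/eqP; rewrite eqn_leq h1 h2.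
by apply: (vdec_orth dt _ yt xy); rewrite exb.
Qed.

(** * Linear independence of compatible Schur roots *)

Definition compat (L : seq dvec) : Prop :=
  [/\ uniq L, forall x, x \in L -> schurv x &
      forall x y, x \in L -> y \in L -> x != y -> orth x y].

Definition toffun (f : 'I_n -> nat) : dvec := [ffun v => f v].
Lemma toffunE (f : 'I_n -> nat) : toffun f = f :> ('I_n -> nat).
Proof. by apply: functional_extensionality_dep => v; rewrite ffunE. Qed.

Lemma vdec_nseq m x : schurv x -> gext x x = 0%N -> vdec (nseq m x).
Proof.
move=> sx h; split=> [y|]; first by rewrite mem_nseq => /andP[_ /eqP ->].
elim: m => // m IH; rewrite /= IH andbT; apply/allP => y.
by rewrite mem_nseq => /andP[_ /eqP ->]; rewrite /orth h.
Qed.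

(** If q < 0 for one of them, ext between them is positive. Otherwise [tot y] copies of x and
    [tot x] copies of y decompose the same vector, and [decomp_size] gives equal totals. *)
Lemma orth_not_proportional x y : schurv x -> schurv y -> x != y -> orth x y ->
  proportional x y -> False.
Proof.
move=> sx sy xy /andP[/eqP oxy /eqP oyx] p.
have tx : (0 < tot x)%N := total_dim_gt0 sx.1.
have ty : (0 < tot y)%N := total_dim_gt0 sy.1.
have [gx|/(gext_self_gt0 sx) [qx _]] := eqVneq (gext x x) 0%N; last first.
  have := proportional_gext p sx.1 (ltnW qx); rewrite oxy muln0 leqn0 muln_eq0 subn_eq0.
  by rewrite leqNgt qx orbF -leqn0 leqNgt ty.
have [gy|/(gext_self_gt0 sy) [qy _]] := eqVneq (gext y y) 0%N; last first.
  have := proportional_gext (proportional_sym p) sy.1 (ltnW qy).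
  rewrite oyx muln0 leqn0 muln_eq0 subn_eq0.
  by rewrite leqNgt qy orbF -leqn0 leqNgt tx.
have := decomp_size hchar (vdec_nseq (tot y) sx gx) (vdec_nseq (tot x) sy gy).
rewrite !vsum_nseq !size_nseq => /(_ (proportional_tot p)) e.
by move/eqP: xy; apply; apply: proportional_eq p sx.1 (esym e).
Qed.

(* The generic decomposition of m x: a root with q(x) < 0 has only Schur multiples,
   while the other roots satisfy ext(x, x) = 0. *)
Definition block m x : seq dvec :=
  if m == 0%N then [::] else if (dimV x x < dimA Q x x)%N then [:: toffun (vmul m x)] else nseq m x.

Lemma vsum_block m x : vsum (block m x) = vmul m x.
Proof.
rewrite /block; case: eqP => [->|_]; first by rewrite vsum_nil.
case: ifP => _; last exact: vsum_nseq.
rewrite vsum_cons vsum_nil toffunE; apply: functional_extensionality_dep => v.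
by rewrite /vadd addn0.
Qed.

Lemma vdec_block m x : schurv x -> vdec (block m x).
Proof.
move=> sx; rewrite /block; case: eqP => [_|/eqP m0]; first by split.
case: ltnP => q; last by apply: vdec_nseq => //; apply: schur_gext0.
split=> // y; rewrite inE => /eqP ->; rewrite toffunE.
by apply: schur_vmul; rewrite // lt0n.
Qed.

Lemma mem_block m x y : y \in block m x -> exists2 j, (y : 'I_n -> nat) = vmul j x & (0 < m)%N && (0 < j)%N.
Proof.
rewrite /block; case: (posnP m) => // m0; case: ifP => _.
  by rewrite inE => /eqP ->; exists m; rewrite ?toffunE ?m0.
rewrite mem_nseq m0 => /eqP ->; exists 1%N; rewrite ?m0 //.
by apply: functional_extensionality_dep => v; rewrite /vmul mul1n.
Qed.

Lemma orth_vmul x y m j : orth x y -> gext (vmul m x) (vmul j y) = 0%N.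
Proof.
move=> /andP[/eqP h _]; apply/eqP; rewrite -leqn0.
apply: leq_trans (gext_vmull hchar Q m _ x) _.
by rewrite -[X in (_ <= X)%N](muln0 m) leq_mul2l (leq_trans (gext_vmulr hchar Q j x y)) ?h ?muln0 ?orbT.
Qed.

Definition blocks (P : dvec -> nat) (L : seq dvec) := flatten [seq block (P x) x | x <- L].

Lemma vsum_blocks P L v : vsum (blocks P L) v = (\sum_(x <- L) P x * x v)%N.
Proof.
elim: L => [|x L IH]; first by rewrite big_nil vsum_nil.
by rewrite big_cons -IH /blocks /= vsum_cat vsum_block.
Qed.

Lemma vdec_blocks P L : compat L -> vdec (blocks P L).
Proof.
elim: L => [|x L IH] [u s o] //; have {}IH : vdec (blocks P L).
  apply: IH; split; first by move: u => /= /andP[].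
    by move=> y yL; apply: s; rewrite inE yL orbT.
  by move=> y z yL zL; apply: o; rewrite inE ?yL ?zL orbT.
have sx := vdec_block (P x) (s x (mem_head _ _)).
apply: (decomp_refine hchar _ _ sx IH erefl erefl).
all: rewrite vsum_block; apply/eqP; rewrite -leqn0.
  apply: leq_trans (gext_vsumr hchar Q _ _) _; rewrite leqn0 sum_nat_seq_eq0.
  apply/allP => y /flatten_mapP [z zL /mem_block [j -> _]] /=; apply/eqP/orth_vmul/o.
  - exact: mem_head.
  - by rewrite inE zL orbT.
  by apply: contraTneq zL => <-; case/andP: u.
apply: leq_trans (gext_vsuml hchar Q _ _) _; rewrite leqn0 sum_nat_seq_eq0.
apply/allP => y /flatten_mapP [z zL /mem_block [j -> _]] /=; apply/eqP/orth_vmul/o.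
- by rewrite inE zL orbT.
- exact: mem_head.
by apply: contraTneq zL => ->; case/andP: u.
Qed.

(** P and N are the positive and negative parts of a relation. Their blocks give two decompositions
    of one vector, so [decomp_proportional] yields proportional members x and y, distinct because
    the supports are disjoint. *)
Lemma compat_relation L (P N : dvec -> nat) : compat L ->
  (forall x, x \in L -> P x = 0%N \/ N x = 0%N) ->
  (forall v, \sum_(x <- L) P x * x v = \sum_(x <- L) N x * x v)%N ->
  forall x, x \in L -> P x = 0%N.
Proof.
move=> cL PN e x xL; have [u s o] := cL; apply/eqP; apply: contraT => Px.
have e' : vsum (blocks P L) = vsum (blocks N L).
  by apply: functional_extensionality_dep => v; rewrite !vsum_blocks.
have [z zx] : exists z, z \in block (P x) x.
  rewrite /block (negPf Px); case: ifP => _; first by eexists; apply: mem_head.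
  by exists x; rewrite mem_nseq lt0n Px eqxx.
have zb : z \in blocks P L by apply/flatten_mapP; exists x.
have [b bt pzb] := decomp_proportional hchar (vdec_blocks P cL) (vdec_blocks N cL) e' zb.
have [j ez /andP[_ j0]] := mem_block zx.
have /flatten_mapP [y yL by_] := bt; have [i eb /andP[Ny i0]] := mem_block by_.
have xy : x != y.
  apply: contraTneq Ny => <-; case: (PN x xL) => h; last by rewrite h.
  by rewrite h in Px.
exfalso; apply: (orth_not_proportional (s x xL) (s y yL) xy (o x y xL yL xy)) => a c.
have := pzb a c; rewrite ez eb /vmul !mulnA ![(j * _ * i)%N]mulnAC -!mulnA => /eqP.
by rewrite !eqn_pmul2l // => /eqP.
Qed.

Lemma integer_relation (L : seq dvec) : uniq L -> (n < size L)%N ->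
  exists2 w : dvec -> int, (exists2 x, x \in L & w x != 0) &
    forall v, \sum_(x <- L) w x * (x v)%:Z = 0.
Proof.
move=> uL hL; pose m := size L; pose A : 'M[rat]_(m, n) := \matrix_(i, v) (nth [ffun=> 0%N] L i v)%:R.
have /rowV0Pn [z zk z0] : kermx A != 0.
  rewrite kermx_eq0 /row_free; apply/negP => /eqP h.
  by have := rank_leq_col A; rewrite h leqNgt hL.
have {zk} zA : z *m A = 0 by apply/sub_kermxP.
pose D := \prod_j denq (z 0 j).
(* A rational kernel vector multiplied by the product of all its denominators. *)
pose wi i := numq (z 0 i) * \prod_(j | j != i) denq (z 0 j).
have D0 : D != 0 by apply/prodf_neq0 => j _; rewrite denq_neq0.
have wiE i : (wi i)%:~R = z 0 i * D%:~R :> rat.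
  rewrite /wi /D [in RHS](bigD1 i) //= !intrM mulrA; congr (_ * _).
  exact: numqE.
pose w x : int := if insub (index x L) is Some i then wi i else 0.
have wE (i : 'I_m) : w (nth [ffun=> 0%N] L i) = wi i by rewrite /w index_uniq // valK.
exists w.
  have /rV0Pn [i zi] := z0; exists (nth [ffun=> 0%N] L i); first exact: mem_nth.
  by rewrite wE -(intr_eq0 rat) wiE mulf_neq0 // intr_eq0.
move=> v; rewrite (big_nth [ffun=> 0%N]) big_mkord.
apply/eqP; rewrite -(intr_eq0 rat) rmorph_sum /=.
have /rowP /(_ v) := zA; rewrite !mxE => h.
have -> : \sum_(i < size L) ((w (nth [ffun=> 0%N] L i) * (nth [ffun=> 0%N] L i v)%:Z)%:~R : rat) =
    D%:~R * \sum_j z 0 j * A j v.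
  rewrite mulr_sumr; apply: eq_bigr => i _; rewrite intrM wE wiE !mxE.
  by rewrite mulrA [_ * D%:~R]mulrC.
by rewrite h mulr0.
Qed.

Lemma compat_size L : compat L -> (size L <= n)%N.
Proof.
move=> cL; have [u s o] := cL; rewrite leqNgt; apply/negP => hL.
have [w [x xL wx] hw] := integer_relation u hL.
pose P y := if 0 <= w y then `|w y|%N else 0%N.
pose N y := if 0 <= w y then 0%N else `|w y|%N.
have wE y : w y = (P y)%:Z - (N y)%:Z.
  rewrite /P /N; case: ifP => h; first by rewrite subr0 gez0_abs.
  by rewrite sub0r ltz0_abs ?opprK // ltNge h.
have PN y : P y = 0%N \/ N y = 0%N by rewrite /P /N; case: ifP; [right|left].
have e v : (\sum_(y <- L) P y * y v = \sum_(y <- L) N y * y v)%N.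
  apply/eqP; rewrite -eqz_nat -subr_eq0 -!natz !natr_sum -sumrB; apply/eqP.
  by rewrite -[RHS](hw v); apply: eq_bigr => y _; rewrite !natrM !natz wE mulrBl.
have h1 := compat_relation cL (fun y _ => PN y) e xL.
have h2 := compat_relation cL (fun y _ => iffLR (or_comm _ _) (PN y)) (fun v => esym (e v)) xL.
by move/eqP: wx; apply; rewrite wE h1 h2.
Qed.

End Uniqueness.

(** * Generalized Schur roots *)

Section Link.
Variables (k : closedFieldType) (hchar : [pchar k] =i pred0).
Variables (n : nat) (Q : quiver n).
Notation schurv := (schurv k Q).
Notation vdec := (vdec k Q).
Notation orth := (orth k Q).
Notation gext := (gext k Q).
Notation dvec := (dvec n).
Notation zvec := (zvec n).

Lemma row_free_indep d e r (M : rep k Q d) (N : rep k Q e) (F : 'I_r -> vtxmaps k d e) :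
  arr_indep (fun j => ringel_delta M N (F j)) <->
  row_free (\matrix_j encA (ringel_delta M N (F j))).
Proof.
set G := \matrix_j _.
have key (c : 'rV[k]_r) : c *m G = encA (fun x => \sum_j c 0 j *: ringel_delta M N (F j) x).
  apply/rowP => l; rewrite !mxE summxE; apply: eq_bigr => j _.
  by rewrite !mxE.
split=> [h|fG c hc j].
  rewrite -kermx_eq0; apply/rowV0P => c /sub_kermxP; rewrite key => e0.
  apply/rowP => j; rewrite [RHS]mxE; apply: h => x.
  have := congr1 (@decA k n Q d e) e0; rewrite encAK => /(congr1 (fun f => f x)) ->.
  by rewrite /decA dec0.
have : (\row_j c j) *m G = 0.
  rewrite key -(enc0 _ _ k); congr encA; apply: functional_extensionality_dep => x.
  by rewrite -[RHS](hc x); apply: eq_bigr => i _; rewrite mxE.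
rewrite -(mul0mx _ G) => /(row_free_inj fG) /rowP /(_ j).
by rewrite !mxE.
Qed.

Lemma ext_dim0 d e (M : rep k Q d) (N : rep k Q e) : ext_dim M N 0 <-> ext_zero M N.
Proof.
rewrite /ext_dim -dimAE -row_full_ext; split.
  case=> r [[[F /row_free_indep hF] _]]; rewrite add0n => er.
  have : (\matrix_j encA (ringel_delta M N (F j)) <= dmat M N)%MS.
    by apply/row_subP => j; rewrite rowK; apply/submxP; exists (encV (F j)); rewrite dmat_enc.
  move/mxrankS; move/eqP: hF => ->; rewrite er /row_full => h.
  by rewrite eqn_leq rank_leq_col.
move=> /row_full_ext h; exists (dimA Q d e); rewrite add0n; split=> //; split.
  have /choice [F hF] : forall j : 'I_(dimA Q d e), exists phi,
      encA (ringel_delta M N phi) = delta_mx 0 j.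
    move=> j; case: (h (decA (delta_mx 0 j))) => phi hp; exists phi.
    by rewrite -[RHS]decAK; congr encA; apply: functional_extensionality_dep.
  exists F; apply/row_free_indep; suff -> : \matrix_j encA (ringel_delta M N (F j)) = 1%:M.
    by rewrite row_free_unit unitmx1.
  by apply/row_matrixP => j; rewrite rowK hF rowE mulmx1.
move=> F /row_free_indep hF.
by have := rank_leq_col (\matrix_j encA (ringel_delta M N (F j))); move/eqP: hF => ->; rewrite ltnn.
Qed.

Definition tod (d : zvec) : dvec := toffun (natdv d).
Definition ofd (x : dvec) : zvec := [ffun i => (x i)%:Z].

Lemma todE d : tod d = natdv d :> ('I_n -> nat). Proof. exact: toffunE. Qed.
Lemma ofdK x : tod (ofd x) = x.
Proof. by apply/ffunP => i; rewrite todE /natdv ffunE. Qed.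
Lemma todK (d : zvec) : posvec d -> ofd (tod d) = d.
Proof. by move=> [h _]; apply/ffunP => i; rewrite ffunE todE /natdv gez0_abs. Qed.

Lemma ext_is0 (a b : zvec) : ext_is k Q a b 0 <-> gext (tod a) (tod b) = 0%N.
Proof.
rewrite gext_eq0 !todE /ext_is; split.
  by case=> -[M [N /ext_dim0 h]] _; exists M, N.
by case=> M [N /ext_dim0 h]; split=> //; exists M, N.
Qed.

Lemma posvec_nzv (d : zvec) : posvec d -> nzv (tod d).
Proof.
move=> [h d0]; apply: contrapT => hn; move/eqP: d0; apply; apply/ffunP => i; rewrite ffunE.
apply/eqP; rewrite -absz_eq0 -leqn0 leqNgt; apply/negP => hi; apply: hn; exists i.
by rewrite todE.
Qed.

Lemma schur_rootE (d : zvec) : schur_root k Q d <-> posvec d /\ schurv (tod d).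
Proof.
rewrite /schur_root /schurv todE; split=> [[h1 h2]|[h1 [_ h2]]]; split=> //; split=> //.
by have := posvec_nzv h1; rewrite todE.
Qed.

Lemma posvec_ofd (x : dvec) : nzv x -> posvec (ofd x).
Proof.
move=> [i hi]; split=> [j|]; first by rewrite ffunE.
by apply/eqP => /ffunP /(_ i); rewrite !ffunE => -[h]; rewrite h in hi.
Qed.

Lemma evec_neg (i j : 'I_n) : (- evec i : zvec) j = - (i == j)%:Z.
Proof. by rewrite !ffunE. Qed.

Lemma pos_not_neg (d : zvec) : posvec d -> negroot d -> False.
Proof.
move=> [h _] [i e]; have := h i; rewrite e evec_neg eqxx.
by [].
Qed.

Lemma neg_inj (i j : 'I_n) : - evec i = - evec j :> zvec -> i = j.
Proof.
move=> /ffunP /(_ i); rewrite !evec_neg eqxx; by case: eqVneq => // ->.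
Qed.

Lemma ext_orth_sym (a b : zvec) : ext_orth k Q a b -> ext_orth k Q b a.
Proof.
case=> [[h1 [h2 [h3 h4]]]|[[i [h1 [h2 h3]]]|[[i [h1 [h2 h3]]]|[h1 h2]]]].
- by left.
- by right; right; left; exists i.
- by right; left; exists i.
by right; right; right.
Qed.

Lemma ext_orth_pos (a b : zvec) : posvec a -> posvec b ->
  ext_orth k Q a b <-> orth (tod a) (tod b).
Proof.
move=> pa pb; split=> [|/andP[/eqP h1 /eqP h2]]; last by left; rewrite !ext_is0.
case=> [[_ [_ [/ext_is0 h3 /ext_is0 h4]]]|[[i [h1 _]]|[[i [h1 _]]|[h1 _]]]].
- by rewrite /orth h3 h4.
- by case: (pos_not_neg pa); exists i.
- by case: (pos_not_neg pb); exists i.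
by case: (pos_not_neg pa h1).
Qed.

Lemma ext_orth_neg i (b : zvec) : posvec b -> ext_orth k Q (- evec i) b <-> b i = 0.
Proof.
move=> pb; split=> [|h]; last by right; left; exists i.
case=> [[h _]|[[j [/neg_inj -> [_ h]]]|[[j [h _]]|[_ h]]]] //.
- by case: (pos_not_neg h); exists i.
- by case: (pos_not_neg pb); exists j.
by case: (pos_not_neg pb h).
Qed.

Lemma neg_neg_orth (i j : 'I_n) : ext_orth k Q (- evec i) (- evec j).
Proof. by right; right; right; split; [exists i | exists j]. Qed.

Lemma gen_cases (x : zvec) : gen_schur_root k Q x -> posvec x \/ exists i, x = - evec i.
Proof. by case=> [/schur_rootE [h _]|h]; [left|right]. Qed.

Lemma gen_pos (x : zvec) : gen_schur_root k Q x -> posvec x -> schurv (tod x).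
Proof. by case=> [/schur_rootE [_ h] //|h p]; case: (pos_not_neg p h). Qed.

(** * Generic decompositions of integer vectors *)

Definition dplus (d : zvec) : 'I_n -> nat := fun i => if 0 <= d i then `|d i|%N else 0%N.
Definition posb (d : zvec) : bool := [forall i, 0 <= d i].

Lemma posbP x : gen_schur_root k Q x -> reflect (posvec x) (posb x).
Proof.
move=> gx; apply: (iffP idP) => [/forallP h|[h _]]; last by apply/forallP.
case: (gen_cases gx) => // -[i e]; have := h i; rewrite e evec_neg eqxx.
by [].
Qed.

Definition pospart (s : seq zvec) : seq dvec := [seq tod x | x <- s & posb x].

Lemma gen_decomp_neg s d i : gen_decomp k Q s d -> - evec i \in s ->
  d i < 0 /\ forall x, x \in s -> posvec x -> x i = 0.
Proof.
move=> [es gs os] is_; have orthi x : x \in s -> posvec x -> x i = 0.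
  move=> xs px; have ne : x != - evec i by apply/eqP => e; apply: (pos_not_neg px); exists i.
  have h1 : (index (- evec i) s < size s)%N by rewrite index_mem.
  have h2 : (index x s < size s)%N by rewrite index_mem.
  have := os _ _ h1 h2; rewrite !nth_index // => h.
  apply/(ext_orth_neg i px)/h; apply: contra ne => /eqP e.
  by rewrite -(nth_index 0 xs) -e nth_index.
split=> //; rewrite -es (big_rem _ is_) /= ffunE evec_neg eqxx.
have key (z : int) : z <= 0 -> - (true : nat)%:Z + z < 0 by lia.
apply: key.
rewrite sum_ffunE big_seq; apply: sumr_le0 => y /mem_rem ys.
case: (gen_cases (gs _ ys)) => [py|[j ->]]; first by rewrite orthi.
by rewrite evec_neg; case: (j == i).
Qed.

(** There is no cancellation: if -e_i occurs, every positive member vanishes at i. *)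
Lemma pospart_vsum s d : gen_decomp k Q s d -> vsum (pospart s) = dplus d.
Proof.
move=> ds; have [es gs os] := ds; apply: functional_extensionality_dep => i.
rewrite /vsum big_map big_filter /dplus.
have [is_|is_] := boolP (- evec i \in s).
  have [h1 h2] := gen_decomp_neg ds is_; rewrite leNgt h1 /=.
  rewrite big_seq_cond big1 // => x /andP[xs /(posbP (gs _ xs)) px].
  by rewrite todE /natdv h2.
have e : d i = ((\sum_(x <- s | posb x) tod x i)%N)%:Z.
  rewrite -es sum_ffunE -natz natr_sum [RHS]big_mkcond big_seq [RHS]big_seq.
  apply: eq_bigr => x xs; case: (posbP (gs _ xs)) => px.
    by rewrite natz todE /natdv gez0_abs //; case: px.
  case: (gen_cases (gs _ xs)) => [//|[j ej]]; rewrite ej evec_neg.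
  by case: eqVneq => // eji; move: is_; rewrite -eji -ej xs.
by rewrite e.
Qed.

Lemma pospart_vdec s d : gen_decomp k Q s d -> vdec (pospart s).
Proof.
move=> [es gs os]; split.
  move=> y /mapP [x]; rewrite mem_filter => /andP[px xs] ->.
  by apply: gen_pos; [apply: gs | apply/posbP => //; apply: gs].
rewrite pairwise_map.
have hp : pairwise (fun x y => posb x ==> posb y ==> orth (tod x) (tod y)) s.
  apply/(pairwiseP 0) => i j; rewrite !inE => hi hj ij.
  apply/implyP => px; apply/implyP => py.
  have gi := gs _ (mem_nth 0 hi); have gj := gs _ (mem_nth 0 hj).
  apply/(ext_orth_pos (posbP gi px) (posbP gj py)); apply: os => //.
  by rewrite neq_ltn ij.
have := pairwise_filter posb hp.
apply: (@sub_in_pairwise _ posb); last exact: filter_all.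
by move=> x y px py /=; rewrite (px : posb x) (py : posb y).
Qed.

Lemma mem_pospart s x : x \in s -> gen_schur_root k Q x -> posvec x -> tod x \in pospart s.
Proof. by move=> xs gx px; apply: map_f; rewrite mem_filter xs andbT; apply/posbP. Qed.

(** The positive part is decomposed and |d_i| copies of -e_i are added wherever d_i < 0;
    orthogonality holds since the positive part is 0 there. *)
Lemma gen_decomp_exists d : exists s, gen_decomp k Q s d.
Proof.
have [t dt et] := decomp_exists hchar Q (dplus d); have [st ot] := dt.
pose negs := flatten [seq nseq `|d i|%N (- evec i : zvec) | i <- enum 'I_n & d i < 0].
have negP x : x \in negs -> exists2 i, x = - evec i & d i < 0.
  move=> /flatten_mapP [i]; rewrite mem_filter => /andP[hi _].
  by rewrite mem_nseq => /andP[_ /eqP ->]; exists i.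
have posP x : x \in map ofd t -> posvec x /\ forall i, d i < 0 -> x i = 0.
  move=> /mapP [y yt ->]; split; first by apply: posvec_ofd; case: (st _ yt).
  move=> i di; rewrite ffunE; congr Posz.
  have := congr1 (fun f => f i) et; rewrite /vsum /dplus leNgt di /= => /eqP.
  by rewrite sum_nat_seq_eq0 => /allP /(_ _ yt) /= /eqP.
exists (map ofd t ++ negs); split.
- rewrite big_cat /=; apply/ffunP => i; rewrite ffunE !sum_ffunE.
  have -> : \sum_(x <- map ofd t) x i = (dplus d i)%:Z.
    rewrite big_map -et /vsum -natz natr_sum; apply: eq_bigr => y _.
    by rewrite ffunE natz.
  have -> : \sum_(x <- negs) x i = if d i < 0 then d i else 0.
    rewrite /negs big_flatten big_map big_filter.
    under eq_bigr => j _ do rewrite big_nseq iter_addr_0 evec_neg.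
    rewrite big_mkcond /= -(big_map id xpredT (fun j => if d j < 0 then - (j == i)%:Z *+ `|d j|%N else 0)) map_id.
    rewrite enumT -/(index_enum _) (bigD1 i) //= big1 => [|j /negPf ->]; last first.
      by rewrite oppr0 mul0rn; case: ifP.
    rewrite addr0 eqxx; case: ifP => // h.
    by rewrite mulNrn -[X in - X]/(`|d i|%N%:R : int) natz ltz0_abs ?opprK.
  rewrite /dplus; case: ltP => h; first by rewrite add0r.
  by rewrite addr0 gez0_abs.
- move=> x; rewrite mem_cat => /orP[/mapP [y yt ->]|/negP [i -> _]]; last by right; exists i.
  left; apply/schur_rootE; rewrite ofdK; split; last exact: st.
  by apply: posvec_ofd; case: (st _ yt).
have sym0 x y : (fun x y => `[< ext_orth k Q x y >]) x y -> ext_orth k Q x y by move/asboolP.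
suff hp : pairwise (fun x y => `[< ext_orth k Q x y >]) (map ofd t ++ negs).
  move=> i j hi hj; rewrite neq_ltn => /orP[ij|ij].
    by apply: sym0; apply: (pairwiseP 0 hp).
  by apply: ext_orth_sym; apply: sym0; apply: (pairwiseP 0 hp).
rewrite pairwise_cat; apply/and3P; split.
- apply/allrelP => x y /posP [px h] /negP [i -> di]; apply/asboolP.
  by apply: ext_orth_sym; apply/ext_orth_neg => //; apply: h.
- rewrite pairwise_map; move: (ot); apply: (@sub_in_pairwise _ (mem t)); last exact/allP.
  move=> x y xt yt o; apply/asboolP; apply/ext_orth_pos; rewrite ?ofdK //.
    by apply: posvec_ofd; case: (st _ xt).
  by apply: posvec_ofd; case: (st _ yt).
elim: negs negP {posP} => //= x l IH h; apply/andP; split; last first.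
  by apply: IH => y yl; apply: h; rewrite inE yl orbT.
apply/allP => y yl; have [i -> _] := h x (mem_head _ _).
have [|j -> _] := h y; first by rewrite inE yl orbT.
exact/asboolP/neg_neg_orth.
Qed.

(** Both positive parts sum to [dplus d], which reduces to [decomp_orth]; a member -e_i of one list
    forces d_i < 0 and hence coordinate 0 in the positive members of the other. *)
Lemma gen_decomp_orth s t d x y : gen_decomp k Q s d -> gen_decomp k Q t d ->
  x \in s -> y \in t -> x != y -> ext_orth k Q x y.
Proof.
move=> ds dt xs yt xy.
have [_ gs _] := ds; have [_ gt _] := dt.
have npos z w i : gen_decomp k Q z d -> gen_decomp k Q w d -> - evec i \in z ->
    forall y, y \in w -> posvec y -> y i = 0.
  move=> dz dw iz u uw pu; have [di _] := gen_decomp_neg dz iz.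
  have gu : gen_schur_root k Q u by case: dw => _ h _; apply: h.
  have := congr1 (fun f => f i) (pospart_vsum dw); rewrite /vsum /dplus leNgt di /= => /eqP.
  rewrite sum_nat_seq_eq0 => /allP /(_ _ (mem_pospart uw gu pu)) /=.
  by rewrite todE absz_eq0 => /eqP.
case: (gen_cases (gs _ xs)) => [px|[i ex]]; case: (gen_cases (gt _ yt)) => [py|[j ey]].
- apply/ext_orth_pos => //; apply: (decomp_orth hchar (pospart_vdec ds) (pospart_vdec dt)).
  + by rewrite (pospart_vsum ds) (pospart_vsum dt).
  + by apply: mem_pospart => //; apply: gs.
  + by apply: mem_pospart => //; apply: gt.
  by apply: contra xy => /eqP e; rewrite -(todK px) -(todK py) e.
- apply: ext_orth_sym; rewrite ey; apply/ext_orth_neg => //.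
  by apply: (npos t s) => //; rewrite -ey.
- rewrite ex; apply/ext_orth_neg => //; apply: (npos s t) => //; by rewrite -ex.
by rewrite ex ey; apply: neg_neg_orth.
Qed.

(** * Subtracting e_i at a vertex outside the support of the other argument *)

Definition vdel (a : 'I_n -> nat) i : 'I_n -> nat := fun v => (a v - (i == v))%N.

Section Delete.
Variables (a : 'I_n -> nat) (i : 'I_n).
Let P v : 'M[k]_(a v, vdel a i v) := pid_mx (vdel a i v).
Let S v : 'M[k]_(vdel a i v, a v) := pid_mx (vdel a i v).

Lemma vdel_SP v : S v *m P v = 1%:M.
Proof. by rewrite pid_mx_id ?pid_mx_1 // leq_subr. Qed.

Lemma vdel_PS v : v != i -> P v *m S v = 1%:M.
Proof.
move=> ne; rewrite pid_mx_id //; have -> : vdel a i v = a v.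
  by rewrite /vdel eq_sym (negPf ne) subn0.
exact: pid_mx_1.
Qed.

(** A cocycle is extended by [S], solved, and compressed by [P]. The identity P S = 1 can fail only
    at i, where the homomorphism has no rows because g i = 0. *)
Lemma gext_vdelr g : g i = 0%N -> gext g a = 0%N -> gext g (vdel a i) = 0%N.
Proof.
move=> gi /gext_eq0 [N [M h]]; apply/gext_eq0.
exists N, (fun x => S _ *m M x *m P _) => Z.
have [phi hphi] := h (fun x => Z x *m S _); exists (fun v => phi v *m P v) => x.
have e v : phi v *m P v *m S v = phi v.
  have [ev|ne] := eqVneq v i; last by rewrite -mulmxA vdel_PS ?mulmx1.
  by apply/matrixP => -[u hu]; exfalso; move: hu; rewrite ev gi.
have := congr1 (fun F => F *m P _) (hphi x); rewrite -[RHS]mulmxA vdel_SP mulmx1 => <-.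
by rewrite /ringel_delta mulmxBl !mulmxA e.
Qed.

Lemma gext_vdell g : g i = 0%N -> gext a g = 0%N -> gext (vdel a i) g = 0%N.
Proof.
move=> gi /gext_eq0 [M [N h]]; apply/gext_eq0.
exists (fun x => S _ *m M x *m P _), N => Z.
have [phi hphi] := h (fun x => P _ *m Z x); exists (fun v => S v *m phi v) => x.
have e v : P v *m (S v *m phi v) = phi v.
  have [ev|ne] := eqVneq v i; last by rewrite mulmxA vdel_PS ?mul1mx.
  by apply/matrixP => u [w hw]; exfalso; move: hw; rewrite ev gi.
have := congr1 (fun F => S _ *m F) (hphi x); rewrite mulmxA vdel_SP mul1mx => <-.
by rewrite /ringel_delta mulmxBr -!mulmxA e.
Qed.
End Delete.

(** Truncated subtraction matches the positive part: if b_i = 0, the sum is negative at i and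
    nothing is removed. *)
Lemma dplus_neg_pos i (b : zvec) : posvec b -> dplus (- evec i + b) = vdel (tod b) i.
Proof.
move=> [pb _]; apply: functional_extensionality_dep => v.
rewrite /dplus /vdel todE /natdv ffunE evec_neg; have := pb v.
by case: (i == v); case: ifP => /=; lia.
Qed.

Lemma gext_dplus (c a b : zvec) : posvec c -> gen_schur_root k Q a -> gen_schur_root k Q b ->
  ext_orth k Q c a -> ext_orth k Q c b ->
  gext (tod c) (dplus (a + b)) = 0%N /\ gext (dplus (a + b)) (tod c) = 0%N.
Proof.
move=> pc ga gb; have c0 i : c i = 0 -> tod c i = 0%N by move=> h; rewrite todE /natdv h.
case: (gen_cases ga) => [pa|[i ->]]; case: (gen_cases gb) => [pb|[j ->]].
- move=> /(ext_orth_pos pc pa) /andP[/eqP h1 /eqP h2] /(ext_orth_pos pc pb) /andP[/eqP h3 /eqP h4].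
  have -> : dplus (a + b) = vadd (tod a) (tod b).
    apply: functional_extensionality_dep => v; rewrite /dplus /vadd !todE /natdv ffunE.
    by case: pa => /(_ v) pa _; case: pb => /(_ v) pb _; case: ifP => /=; lia.
  split; apply/eqP; rewrite -leqn0.
    by apply: leq_trans (gext_addr Q hchar _ _ _) _; rewrite h1 h3.
  by apply: leq_trans (gext_addl Q hchar _ _ _) _; rewrite h2 h4.
- move=> /(ext_orth_pos pc pa) /andP[/eqP h1 /eqP h2] /ext_orth_sym /(ext_orth_neg _ pc) /c0 h3.
  by rewrite addrC dplus_neg_pos //; split; [apply: gext_vdelr | apply: gext_vdell].
- move=> /ext_orth_sym /(ext_orth_neg _ pc) /c0 h3 /(ext_orth_pos pc pb) /andP[/eqP h1 /eqP h2].
  by rewrite dplus_neg_pos //; split; [apply: gext_vdelr | apply: gext_vdell].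
have e0 : dplus (- evec i + - evec j) = (fun=> 0%N).
  apply: functional_extensionality_dep => v; rewrite /dplus ffunE !evec_neg.
  by case: (i == v); case: (j == v).
by rewrite e0 => _ _; split; [apply: gext0r | apply: gext0l].
Qed.

Lemma gen_decomp_sum_orth (c a b : zvec) s x :
  gen_schur_root k Q c -> gen_schur_root k Q a -> gen_schur_root k Q b ->
  ext_orth k Q c a -> ext_orth k Q c b -> gen_decomp k Q s (a + b) -> x \in s ->
  ext_orth k Q c x.
Proof.
move=> gc ga gb oa ob ds xs; have [_ gs _] := ds; have gx := gs _ xs.
case: (gen_cases gc) => [pc|[i ec]]; case: (gen_cases gx) => [px|[j ex]].
- have [h1 h2] := gext_dplus pc ga gb oa ob.
  have [_ od] := pospart_vdec ds; have xp := mem_pospart xs gx px.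
  rewrite -(pospart_vsum ds) gext_vsumrE // in h1.
  rewrite -(pospart_vsum ds) gext_vsumlE // in h2.
  apply/ext_orth_pos => //; rewrite /orth.
  move/eqP: h1; rewrite sum_nat_seq_eq0 => /allP /(_ _ xp) /= ->.
  by move/eqP: h2; rewrite sum_nat_seq_eq0 => /allP /(_ _ xp) /= ->.
- rewrite ex; apply: ext_orth_sym; apply/ext_orth_neg => //.
  have [] := gen_decomp_neg ds (_ : - evec j \in s); first by rewrite -ex.
  rewrite ffunE => hj _.
  (* Since (a + b)_j < 0, one of a and b is negative at j, hence equals -e_j, to which c is
     orthogonal. *)
  have key z : gen_schur_root k Q z -> ext_orth k Q c z -> z j < 0 -> c j = 0.
    move=> gz oz zj; case: (gen_cases gz) => [[pz _]|[l el]]; first by move: (pz j); rewrite leNgt zj.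
    move: zj oz; rewrite el evec_neg; case: eqVneq => [->|] // _.
    by move=> /ext_orth_sym /(ext_orth_neg _ pc).
  have [aj|aj] := ltP (a j) 0; first exact: key aj.
  by apply: (key b) => //; apply: le_lt_trans hj; rewrite lerDr.
- rewrite ec; apply/ext_orth_neg => //.
  (* A root orthogonal to -e_i is at most 0 at i, so the positive part of a + b vanishes there, and
     with it every positive summand. *)
  have key z : gen_schur_root k Q z -> ext_orth k Q c z -> z i <= 0.
    move=> gz oz; case: (gen_cases gz) => [pz|[l ->]].
      by move: oz; rewrite ec => /(ext_orth_neg _ pz) ->.
    by rewrite evec_neg; case: (l == i).
  have := congr1 (fun f => f i) (pospart_vsum ds); rewrite /vsum /dplus ffunE.
  have := key _ ga oa; have := key _ gb ob => hb ha.
  have -> : (if 0 <= a i + b i then absz (a i + b i) else 0%N) = 0%N.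
    by case: ifP => // h; apply/eqP; rewrite absz_eq0 eq_le h andbT; rewrite -[leRHS]addr0 lerD.
  move/eqP; rewrite sum_nat_seq_eq0 => /allP /(_ _ (mem_pospart xs gx px)) /=.
  by rewrite todE absz_eq0 => /eqP.
by rewrite ec ex; apply: neg_neg_orth.
Qed.

(** * Extension of compatible families to component clusters *)

Definition gcompat (L : seq zvec) : Prop :=
  [/\ uniq L, forall x, x \in L -> gen_schur_root k Q x &
      forall x y, x \in L -> y \in L -> x != y -> ext_orth k Q x y].

Lemma gcompat_size L : gcompat L -> (size L <= n + n)%N.
Proof.
move=> [u g o]; rewrite -(count_predC posb L) leq_add //.
  have -> : count posb L = size (pospart L) by rewrite size_map size_filter.
  apply: (compat_size (k := k) (Q := Q) hchar).
  have inj : {in [seq x <- L | posb x] &, injective tod}.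
    move=> x y; rewrite !mem_filter => /andP[px xL] /andP[py yL] e.
    by rewrite -(todK (posbP (g _ xL) px)) -(todK (posbP (g _ yL) py)) e.
  split.
  - by rewrite map_inj_in_uniq // filter_uniq.
  - move=> x /mapP [y]; rewrite mem_filter => /andP[py yL] ->.
    by apply: gen_pos; [apply: g | apply/posbP => //; apply: g].
  move=> x y /mapP [z]; rewrite mem_filter => /andP[pz zL] -> /mapP [w].
  rewrite mem_filter => /andP[pw wL] -> ne.
  apply/ext_orth_pos; [exact: (posbP (g _ zL)) | exact: (posbP (g _ wL)) |].
  by apply: o => //; apply: contra ne => /eqP ->.
rewrite -size_filter; have h : {subset [seq x <- L | predC posb x] <= [seq (- evec i : zvec) | i <- enum 'I_n]}.
  move=> x; rewrite mem_filter => /andP[/= px xL].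
  case: (gen_cases (g _ xL)) => [p|[i ->]]; first by move/(posbP (g _ xL)): p => p; rewrite p in px.
  by apply: map_f; rewrite mem_enum.
by have := uniq_leq_size (filter_uniq _ u) h; rewrite size_map size_enum_ord.
Qed.

Lemma gcompat_max (T : seq zvec -> Prop) : (exists L, gcompat L /\ T L) ->
  exists L, [/\ gcompat L, T L & forall L', gcompat L' -> T L' -> (size L' <= size L)%N].
Proof.
move=> [L0 [g0 T0]]; pose F m := `[< exists L, [/\ gcompat L, T L & size L = m] >].
have Fex : exists m, F m by exists (size L0); apply/asboolP; exists L0.
have Fb m : F m -> (m <= n + n)%N by move=> /asboolP [L [gL _ <-]]; apply: gcompat_size.
have [m /asboolP [L [gL TL sL]] hm] := ex_maxnP Fex Fb; exists L; split=> // L' gL' TL'.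
by rewrite sL; apply: hm; apply/asboolP; exists L'.
Qed.

Lemma gcompat_cons z L : gcompat L -> gen_schur_root k Q z -> z \notin L ->
  (forall x, x \in L -> ext_orth k Q z x) -> gcompat (z :: L).
Proof.
move=> [u g o] gz zL oz; split; first by rewrite /= zL.
  by move=> x; rewrite inE => /orP[/eqP ->|/g].
move=> x y; rewrite !inE => /orP[/eqP ->|xL] /orP[/eqP ->|yL]; rewrite ?eqxx // => ne.
- exact: oz.
- by apply: ext_orth_sym; apply: oz.
exact: o.
Qed.

(** T is a predicate, not a list: the size bound makes a largest list inside T exhaust T. A largest
    compatible list containing that one is then a cluster. *)
Lemma cluster_exists (T : zvec -> Prop) :
  (forall x, T x -> gen_schur_root k Q x) ->
  (forall x y, T x -> T y -> x != y -> ext_orth k Q x y) ->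
  exists2 C, component_cluster k Q C & forall x, T x -> x \in C.
Proof.
move=> gT oT.
have [|L [gL TL mL]] := @gcompat_max (fun L => forall x, x \in L -> T x); first by exists [::].
have LT x : T x -> x \in L.
  move=> Tx; apply: contraT => xL; have := mL (x :: L); rewrite /= ltnn; apply.
    apply: gcompat_cons => //; first exact: gT.
    move=> y yL; apply: oT => //; first exact: TL.
    by apply: contraNneq xL => ->.
  by move=> y; rewrite inE => /orP[/eqP ->|/TL].
have [|C [gC LC mC]] := @gcompat_max (fun C => {subset L <= C}); first by exists L; split.
exists C; last by move=> x /LT /LC.
have [u g o] := gC; split=> // z gz oz; apply: contraT => zC.
have := mC (z :: C); rewrite /= ltnn; apply; first exact: gcompat_cons.
by move=> x /LC h; rewrite inE h orbT.
Qed.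

End Link.

Theorem mainTheorem15 (k : closedFieldType) (hchar : [pchar k] =i pred0)
  (n : nat) (Q : quiver n)
  (hconn : connected_quiver Q) (hacyc : acyclic_quiver Q)
  (C1 C2 : seq (zvec n))
  (hC1 : component_cluster k Q C1) (hC2 : component_cluster k Q C2)
  (hmut : connected_by_mutation C1 C2)
  (alpha alpha' : zvec n)
  (ha : alpha \in C1) (ha2 : alpha \notin C2)
  (ha' : alpha' \in C2) (ha'1 : alpha' \notin C1) :
  exists C3 : seq (zvec n),
    [/\ component_cluster k Q C3,
        {subset [seq x <- C1 | x \in C2] <= C3},
        (exists s, gen_decomp k Q s (alpha + alpha')) &
        (forall s, gen_decomp k Q s (alpha + alpha') -> {subset s <= C3})].
Proof.
have [_ g1 o1 _] := hC1; have [_ g2 o2 _] := hC2.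
(* The summands of all generic decompositions are taken together, so that a single cluster serves
   every [s]. *)
pose T x := x \in [seq x <- C1 | x \in C2] \/
  exists2 s, gen_decomp k Q s (alpha + alpha') & x \in s.
have mixed c s x : c \in [seq x <- C1 | x \in C2] -> gen_decomp k Q s (alpha + alpha') ->
    x \in s -> ext_orth k Q c x.
  rewrite mem_filter => /andP[c2 c1]; apply: gen_decomp_sum_orth => //.
  - exact: g1.
  - exact: g1.
  - exact: g2.
  - by apply: o1 => //; apply: contraNneq ha2 => <-.
  by apply: o2 => //; apply: contraNneq ha'1 => <-.
have [|x y|C3 hC3 TC3] := @cluster_exists k hchar n Q T.
- move=> x [|[s [_ gs _] /gs //]]; by rewrite mem_filter => /andP[_ /g1].
- move=> [xC|[s ds xs]] [yC|[t dt yt]] xy.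
  + by move: xC yC; rewrite !mem_filter => /andP[_ x1] /andP[_ y1]; apply: o1.
  + exact: mixed xC dt yt.
  + by apply: ext_orth_sym; apply: mixed yC ds xs.
  exact: gen_decomp_orth ds dt xs yt xy.
exists C3; split=> //.
- by move=> x xC; apply: TC3; left.
- exact: gen_decomp_exists.
by move=> s ds x xs; apply: TC3; right; exists s.
Qed.
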